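(* Let $(i,j)\in\mathbb Z_2^2$. The group $SU_3\rtimes\mathbb Z_2$ acts on $(\mathbb S^1\times\mathbb S^1)_{ij}=(\mathbb S^1\times\mathbb S^1)\setminus\{((-1)^j,(-1)^i)\}$ by $$(\rho,\varepsilon)\cdot(a,b)=(K^\varepsilon(a),K^\varepsilon(b)).$$ The map $\mathcal F^{ij}: {}_{SU_3\rtimes\mathbb Z_2}(\mathbb S^1\times\mathbb S^1)_{ij}\to\mathcal D_{1,1,6}^{ij}$ acting on objects by $(a,b)\mapsto\mathbb O_{\lambda_a^{(j)},\lambda_b^{(i)}}$ and on morphisms by $(\rho,\varepsilon)\mapsto\rho\widehat\varepsilon$ is an equivalence of categories.
   Context: Algebras are not assumed associative or unital. $\mathbb O$ denotes the real octonions, with standard involution $K:x\mapsto\overline x$ and Euclidean norm. For linear orthogonal operators $f,g$ on $\mathbb O$, the isotope $\mathbb O_{f,g}$ is the vector space $\mathbb O$ with multiplication $x\cdot y=f(x)g(y)$. $\mathcal A_8$ is the category of 8-dimensional real division composition algebras (equivalently, 8-dimensional absolute valued real algebras, i.e. those with a norm satisfying $\|xy\|=\|x\|\,\|y\|$), with non-zero algebra homomorphisms as morphisms (these are all isomorphisms). The double sign of $A\in\mathcal A_8$ is $(\operatorname{sgn}\det L_a,\operatorname{sgn}\det R_a)$ for any $a\in A\setminus\{0\}$ (it does not depend on $a$), where $L_a,R_a$ are left and right multiplication by $a$. $\mathcal D$ is the full subcategory of $\mathcal A_8$ of all $A$ whose derivation Lie algebra $\operatorname{Der}(A)$ is non-abelian;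 each such $A$ is a completely reducible $\operatorname{Der}(A)$-module. $\mathcal D_{1,1,6}$ is the full subcategory of those $A\in\mathcal D$ whose irreducible components have dimensions $1,1,6$, and $\mathcal D_{1,1,6}^{ij}$ is its full subcategory of objects with double sign $((-1)^i,(-1)^j)$; elements of $\mathbb Z_2$ are treated as $0,1$. A Cayley triple is an orthonormal triple $(u,v,z)$ of octonions orthogonal to $1$ with $z\perp uv$; $G_2=\operatorname{Aut}(\mathbb O)$ acts simply transitively on Cayley triples. Fix a Cayley triple $(u,v,z)$; $\mathbb C=\langle1,u\rangle\subset\mathbb O$, and $\mathbb S^1$ is the set of norm one elements of $\mathbb C$. For $t\in\mathbb S^1$, $k\in\mathbb Z_2$, $\lambda_t^{(k)}:\mathbb O\to\mathbb O$ is the linear map with $\lambda_t^{(k)}(x)=tK^k(x)$ for $x\in\mathbb C$ and $\lambda_t^{(k)}(x)=x$ for $x\in\mathbb C^\perp$. $SU_3$ is identified with the subgroup of all $\phi\in G_2$ with $\phi(u)=u$. For $\varepsilon\in\mathbb Z_2$, $\widehat\varepsilon\in G_2$ is the automorphism with $(u,v,z)\mapsto((-1)^\varepsilon u,v,z)$. The semi-direct product $SU_3\rtimes\mathbb Z_2$ is taken with respect to the action $\varepsilon\cdot\rho=\widehat\varepsilon\rho\widehat\varepsilon$, where in general $G\rtimes H$ has multiplication $(g,h)(g',h')=(g\,(h\cdot g'),hh')$. For a group $G$ acting on a set $M$, ${}_GM$ is the groupoid with object set $M$ and morphisms $x\to y$ the elements $g\in G$ with $g\cdot x=y$. *)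

(* Defs.v *)
From HB Require Import structures.
From mathcomp Require Import all_boot all_order all_fingroup all_algebra.
From mathcomp Require Import boolp reals ring lra.

Set Implicit Arguments.
Unset Strict Implicit.
Unset Printing Implicit Defensive.

Import Order.TTheory GRing.Theory Num.Theory.
Local Open Scope ring_scope.

Record category := Category {
  obj :> Type;
  hom : obj -> obj -> Type;
  idm : forall x, hom x x;
  cmp : forall x y z, hom y z -> hom x y -> hom x z;
  cmp_idl : forall x y (f : hom x y), cmp (idm y) f = f;
  cmp_idr : forall x y (f : hom x y), cmp f (idm x) = f;
  cmpA : forall x y z w (h : hom z w) (g : hom y z) (f : hom x y),
    cmp h (cmp g f) = cmp (cmp h g) f
}.

Arguments hom {c} x y.
Arguments idm {c} x.
Arguments cmp {c x y z} g f.

Definition is_iso (C : category) (x y : C) (f : hom x y) : Prop :=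
  exists g : hom y x, cmp g f = idm x /\ cmp f g = idm y.

Record functor (C D : category) := Functor {
  fobj :> C -> D;
  fmap : forall x y : C, hom x y -> hom (fobj x) (fobj y);
  fmap_id : forall x, fmap (idm x) = idm (fobj x);
  fmap_cmp : forall x y z (g : hom y z) (f : hom x y),
    fmap (cmp g f) = cmp (fmap g) (fmap f)
}.

Arguments fmap {C D} _ {x y} _.

Definition id_functor (C : category) : functor C C :=
  @Functor C C id (fun _ _ => id) (fun=> erefl) (fun _ _ _ _ _ => erefl).

Section CompFunctor.
Variables (C D E : category) (G : functor D E) (F : functor C D).

Definition comp_fmap (x y : C) (f : hom x y) : hom (G (F x)) (G (F y)) :=
  fmap G (fmap F f).

Fact comp_fmap_id x : comp_fmap (idm x) = idm (G (F x)).
Proof. by rewrite /comp_fmap !fmap_id. Qed.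

Fact comp_fmap_cmp x y z (g : hom y z) (f : hom x y) :
  comp_fmap (cmp g f) = cmp (comp_fmap g) (comp_fmap f).
Proof. by rewrite /comp_fmap !fmap_cmp. Qed.

Definition comp_functor : functor C E := Functor comp_fmap_id comp_fmap_cmp.

End CompFunctor.

Definition nat_isomorphic (C D : category) (F G : functor C D) : Prop :=
  exists eta : forall x, hom (F x) (G x),
    (forall x, is_iso (eta x)) /\
    (forall x y (f : hom x y), cmp (eta y) (fmap F f) = cmp (fmap G f) (eta x)).

Definition is_equivalence (C D : category) (F : functor C D) : Prop :=
  exists G : functor D C,
    nat_isomorphic (comp_functor G F) (id_functor C) /\
    nat_isomorphic (comp_functor F G) (id_functor D).

Definition full_subcategory (C : category) (P : C -> Prop) : category :=
  @Category {x : C | P x} (fun x y => hom (sval x) (sval y))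
    (fun x => idm (sval x)) (fun x y z => @cmp C (sval x) (sval y) (sval z))
    (fun x y => @cmp_idl C (sval x) (sval y))
    (fun x y => @cmp_idr C (sval x) (sval y))
    (fun x y z w => @cmpA C (sval x) (sval y) (sval z) (sval w)).

Record left_action (G : groupType) (M : Type) := LeftAction {
  lact :> G -> M -> M;
  lact1 : forall x, lact 1%g x = x;
  lactM : forall g h x, lact (g * h)%g x = lact g (lact h x)
}.

Section ActionGroupoid.
Variables (G : groupType) (M : Type) (a : left_action G M).

Definition gpd_hom (x y : M) := {g : G | a g x = y}.

Definition gpd_id x : gpd_hom x x := exist _ 1%g (lact1 a x).

Fact gpd_cmp_subproof x y z (g : gpd_hom y z) (f : gpd_hom x y) :
  a (sval g * sval f)%g x = z.
Proof. by rewrite lactM (svalP f) (svalP g). Qed.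

Definition gpd_cmp x y z (g : gpd_hom y z) (f : gpd_hom x y) : gpd_hom x z :=
  exist _ (sval g * sval f)%g (gpd_cmp_subproof g f).

Fact gpd_cmp_idl x y (f : gpd_hom x y) : gpd_cmp (gpd_id y) f = f.
Proof. by case: f => f fP; apply: eq_exist; rewrite /= mul1g. Qed.

Fact gpd_cmp_idr x y (f : gpd_hom x y) : gpd_cmp f (gpd_id x) = f.
Proof. by case: f => f fP; apply: eq_exist; rewrite /= mulg1. Qed.

Fact gpd_cmpA x y z w (h : gpd_hom z w) (g : gpd_hom y z) (f : gpd_hom x y) :
  gpd_cmp h (gpd_cmp g f) = gpd_cmp (gpd_cmp h g) f.
Proof. by apply: eq_exist; rewrite /= mulgA. Qed.

Definition action_groupoid : category :=
  Category gpd_cmp_idl gpd_cmp_idr gpd_cmpA.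

End ActionGroupoid.

Record aut_action (H G : groupType) := AutAction {
  aact :> H -> G -> G;
  aact1 : forall g, aact 1%g g = g;
  aactM : forall h k g, aact (h * k)%g g = aact h (aact k g);
  aact_morph : forall h g g', aact h (g * g')%g = (aact h g * aact h g')%g
}.

Definition semidirect (G H : groupType) (a : aut_action H G) : Type := (G * H)%type.

Section SemiDirect.
Variables (G H : groupType) (a : aut_action H G).

HB.instance Definition _ := Choice.copy (semidirect a) (G * H)%type.

Definition sd_one : semidirect a := (1%g, 1%g).
Definition sd_mul (x y : semidirect a) : semidirect a :=
  ((x.1 * a x.2 y.1)%g, (x.2 * y.2)%g).
Definition sd_inv (x : semidirect a) : semidirect a :=
  (a x.2^-1%g x.1^-1%g, x.2^-1%g).

Fact aact_one h : a h 1%g = 1%g.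
Proof. by apply: (@mulgI _ (a h 1%g)); rewrite -aact_morph !mulg1. Qed.

Fact sd_mulA : associative sd_mul.
Proof. by move=> x y z; rewrite /sd_mul /= aact_morph aactM !mulgA. Qed.
Fact sd_mul1 : left_id sd_one sd_mul.
Proof. by case=> g h; rewrite /sd_mul /= aact1 !mul1g. Qed.
Fact sd_mulr1 : right_id sd_one sd_mul.
Proof. by case=> g h; rewrite /sd_mul /= aact_one !mulg1. Qed.
Fact sd_mulV : left_inverse sd_one sd_inv sd_mul.
Proof. by case=> g h; rewrite /sd_mul /= -aact_morph !mulVg aact_one. Qed.
Fact sd_mulrV : right_inverse sd_one sd_inv sd_mul.
Proof.
by case=> g h; rewrite /sd_mul /= -aactM !mulgV aact1 mulgV.
Qed.

HB.instance Definition _ := isGroup.Build (semidirect a)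
  sd_mulA sd_mul1 sd_mulr1 sd_mulV sd_mulrV.

End SemiDirect.

(** Neither associativity nor a unit is assumed. *)
Record algebra (R : realType) := Algebra {
  carrier :> vectType R;
  amul : {bilinear carrier -> carrier -> carrier}
}.

Arguments amul {R} a.

Section Algebras.
Variable R : realType.
Implicit Types A B C : algebra R.

Definition lmult A (a : A) : 'End(A) := linfun (fun x => amul A a x).
Definition rmult A (a : A) : 'End(A) := linfun (fun x => amul A x a).

Definition is_division A : Prop :=
  (exists a : A, a != 0) /\
  (forall a : A, a != 0 -> bijective (lmult a) /\ bijective (rmult a)).

Definition polar (V : lmodType R) (q : V -> R) (x y : V) : R :=
  q (x + y) - q x - q y.

Definition quadratic_form (V : lmodType R) (q : V -> R) : Prop :=
  [/\ forall (c : R) x, q (c *: x) = c ^+ 2 * q x,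
      forall x y z, polar q (x + y) z = polar q x z + polar q y z
    & forall (c : R) x y, polar q (c *: x) y = c * polar q x y].

Definition nondegenerate (V : lmodType R) (q : V -> R) : Prop :=
  forall x, (forall y, polar q x y = 0) -> x = 0.

Definition is_composition A : Prop :=
  exists q : A -> R, [/\ quadratic_form q, nondegenerate q
                       & forall x y, q (amul A x y) = q x * q y].

Definition in_A8 A : Prop :=
  [/\ \dim {:A} = 8, is_division A & is_composition A].

Definition is_morphism A B (f : 'Hom(A, B)) : Prop :=
  f != 0 /\ forall x y, f (amul A x y) = amul B (f x) (f y).

Definition derivation A (d : 'End(A)) : Prop :=
  forall x y, d (amul A x y) = amul A (d x) y + amul A x (d y).

Definition der_nonabelian A : Prop :=
  exists d d' : 'End(A), [/\ derivation d, derivation d'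
                           & ((d \o d')%VF - (d' \o d)%VF) != 0].

Definition der_submodule A (U : {vspace A}) : Prop :=
  forall d : 'End(A), derivation d -> (d @: U <= U)%VS.

Definition der_irreducible A (U : {vspace A}) : Prop :=
  [/\ der_submodule U, U != 0%VS
    & forall W : {vspace A}, der_submodule W -> (W <= U)%VS ->
        W = 0%VS \/ W = U].

(** The irreducible components of the [Der A]-module [A] have the dimensions
    listed in [s]. *)
Definition der_components A (s : seq nat) : Prop :=
  exists U : 'I_(size s) -> {vspace A},
    [/\ forall k, der_irreducible (U k),
        forall k, \dim (U k) = nth 0%N s k,
        directv (\sum_k U k)
      & (\sum_k U k)%VS = {:A}%VS].

(** Any basis gives the same value. *)
Definition endo_det (V : vectType R) (f : 'End(V)) : R :=
  \det (passmx.mxof (vbasis {:V}) (vbasis {:V}) f).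

(** The double sign of [A] is [((-1)^i, (-1)^j)]. *)
Definition has_double_sign A (i j : 'Z_2) : Prop :=
  forall a : A, a != 0 ->
    Num.sg (endo_det (lmult a)) = (-1) ^+ i /\
    Num.sg (endo_det (rmult a)) = (-1) ^+ j.

Definition in_D A : Prop := in_A8 A /\ der_nonabelian A.
Definition in_D116 A : Prop := in_D A /\ der_components A [:: 1; 1; 6]%N.
Definition in_D116ij (i j : 'Z_2) A : Prop := in_D116 A /\ has_double_sign A i j.

Definition A8_obj := {A : algebra R | in_A8 A}.
Definition A8_hom (A B : A8_obj) := {f : 'Hom(sval A, sval B) | is_morphism f}.

Fact A8_id_subproof (A : A8_obj) : is_morphism (\1%VF : 'End(sval A)).
Proof.
split=> [|x y]; last by rewrite !id_lfunE.
have [_ [[a a0] _] _] := svalP A.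
by apply: contraNneq a0 => /lfunP/(_ a); rewrite id_lfunE zero_lfunE => ->.
Qed.

Definition A8_id (A : A8_obj) : A8_hom A A := exist _ _ (A8_id_subproof A).

Lemma morphism_inj A B (f : 'Hom(A, B)) :
  is_division A -> is_morphism f -> injective f.
Proof.
move=> [_ divA] [f0 fM].
suff k0 : lker f == 0%VS by move/lker0P: k0.
apply: contraNT f0 => kN0.
have a0 : vpick (lker f) != 0 by rewrite vpick0.
have fa : f (vpick (lker f)) = 0 by apply/eqP; rewrite -memv_ker memv_pick.
have [[g _ gK] _] := divA _ a0.
apply/eqP/lfunP => x; rewrite zero_lfunE -(gK x) lfunE /= fM fa.
by rewrite linear0l.
Qed.

Fact A8_cmp_subproof (A B C : A8_obj) (g : A8_hom B C) (f : A8_hom A B) :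
  is_morphism (sval g \o sval f)%VF.
Proof.
case: f g => [f [f0 fM]] [g gm] /=; split=> [|x y]; last first.
  by rewrite !comp_lfunE fM gm.2.
have [_ divB _] := svalP B.
apply: contraNneq f0 => gf0; apply/eqP/lfunP => x.
apply: (morphism_inj divB gm).
by rewrite -comp_lfunE gf0 !zero_lfunE linear0.
Qed.

Definition A8_cmp (A B C : A8_obj) (g : A8_hom B C) (f : A8_hom A B) :
  A8_hom A C := exist _ _ (A8_cmp_subproof g f).

Fact A8_cmp_idl (A B : A8_obj) (f : A8_hom A B) : A8_cmp (A8_id B) f = f.
Proof. by case: f => f fP; apply: eq_exist; rewrite /= comp_lfun1l. Qed.

Fact A8_cmp_idr (A B : A8_obj) (f : A8_hom A B) : A8_cmp f (A8_id A) = f.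
Proof. by case: f => f fP; apply: eq_exist; rewrite /= comp_lfun1r. Qed.

Fact A8_cmpA (A B C D : A8_obj)
    (h : A8_hom C D) (g : A8_hom B C) (f : A8_hom A B) :
  A8_cmp h (A8_cmp g f) = A8_cmp (A8_cmp h g) f.
Proof. by apply: eq_exist; rewrite /= comp_lfunA. Qed.

Definition cat_A8 : category := Category A8_cmp_idl A8_cmp_idr A8_cmpA.

Definition cat_D116ij (i j : 'Z_2) : category :=
  @full_subcategory cat_A8 (fun A : A8_obj => in_D116ij i j (sval A)).

Definition D116ij_obj (i j : 'Z_2) A (h : in_D116ij i j A) : cat_D116ij i j :=
  exist _ (exist _ A h.1.1.1) h.

Definition D116ij_hom (i j : 'Z_2) A B
    (hA : in_D116ij i j A) (hB : in_D116ij i j B)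
    (f : 'Hom(A, B)) (hf : is_morphism f) :
  hom (D116ij_obj hA) (D116ij_obj hB) := exist _ f hf.

End Algebras.

(** Cayley-Dickson doubling: [(a, b)(c, d) = (ac - d^* b, da + b c^* )] and
    [(a, b)^* = (a^*, - b)]. *)
Section Doubling.
Variables (V : zmodType) (mul : V -> V -> V) (conj : V -> V).

Definition cd_mul (x y : V * V) : V * V :=
  (mul x.1 y.1 - mul (conj y.2) x.2, mul y.2 x.1 + mul x.2 (conj y.1)).

Definition cd_conj (x : V * V) : V * V := (conj x.1, - x.2).

End Doubling.

Definition octonion (R : realType) : Type := 'rV[R]_8.

HB.instance Definition _ (R : realType) := Vector.on (octonion R).

Definition oct8 (R : realType) (a b c d e f g h : R) : octonion R :=
  \row_k nth 0 [:: a; b; c; d; e; f; g; h] k.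

Definition oct_cd (R : realType) (x : octonion R) :
    ((R * R) * (R * R)) * ((R * R) * (R * R)) :=
  let r k (lt_k8 : (k < 8)%N) := x 0 (Ordinal lt_k8) in
  (((r 0 isT, r 1 isT), (r 2 isT, r 3 isT)),
   ((r 4 isT, r 5 isT), (r 6 isT, r 7 isT)))%N.

Definition cd_oct (R : realType)
    (x : ((R * R) * (R * R)) * ((R * R) * (R * R))) : octonion R :=
  let: (((a, b), (c, d)), ((e, f), (g, h))) := x in oct8 a b c d e f g h.

(** The operations are locked because unification otherwise unfolds them to
    coordinates. *)
HB.lock Definition omul (R : realType) (x y : octonion R) : octonion R :=
  cd_oct (cd_mul (cd_mul (cd_mul (fun a b : R => a * b) id) (cd_conj id))
                 (cd_conj (cd_conj id)) (oct_cd x) (oct_cd y)).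

HB.lock Definition oconj (R : realType) (x : octonion R) : octonion R :=
  cd_oct (cd_conj (cd_conj (cd_conj id)) (oct_cd x)).

Definition oone (R : realType) : octonion R := delta_mx 0 0.

HB.lock Definition odot (R : realType) (x y : octonion R) : R :=
  \sum_k x 0 k * y 0 k.

Arguments omul {R} x y.
Arguments oconj {R} x.
Arguments odot {R} x y.

Definition onorm (R : realType) (x : octonion R) : R := Num.sqrt (odot x x).

Section Octonions.
Variable R : realType.
Implicit Types (x y z : octonion R) (a b c d e f g h r : R).

Local Notation "x ** y" := (omul x y) (at level 40, left associativity).
Local Notation "''1'" := (oone R).

Fact oct8_ind (P : octonion R -> Prop) :
  (forall a b c d e f g h, P (oct8 a b c d e f g h)) -> forall x, P x.
Proof.
move=> H x; pose r k (lt_k8 : (k < 8)%N) := x 0 (Ordinal lt_k8).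
suff -> : x = oct8 (r 0 isT) (r 1 isT) (r 2 isT) (r 3 isT)
                   (r 4 isT) (r 5 isT) (r 6 isT) (r 7 isT) by [].
apply/rowP => k; rewrite mxE.
by case: k; do 8 (case=> [|] /=; first by move=> lt_k8; rewrite /r; congr (x 0 _); apply: val_inj).
Qed.

Fact oct_cdE a b c d e f g h : oct_cd (oct8 a b c d e f g h) =
  (((a, b), (c, d)), ((e, f), (g, h))).
Proof. by rewrite /oct_cd !mxE. Qed.

Fact oct8D a b c d e f g h a' b' c' d' e' f' g' h' :
  oct8 a b c d e f g h + oct8 a' b' c' d' e' f' g' h' =
  oct8 (a + a') (b + b') (c + c') (d + d') (e + e') (f + f') (g + g') (h + h').
Proof.
apply/rowP => k; rewrite !mxE.
by case: k; do 8 (case=> [|] //=).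
Qed.

Fact oct8Z r a b c d e f g h : r *: oct8 a b c d e f g h =
  oct8 (r * a) (r * b) (r * c) (r * d) (r * e) (r * f) (r * g) (r * h).
Proof.
apply/rowP => k; rewrite !mxE.
by case: k; do 8 (case=> [|] //=).
Qed.

Fact oct8N a b c d e f g h : - oct8 a b c d e f g h =
  oct8 (- a) (- b) (- c) (- d) (- e) (- f) (- g) (- h).
Proof. by rewrite -scaleN1r oct8Z !mulN1r. Qed.

Fact oone8 : '1 = oct8 1 0 0 0 0 0 0 0.
Proof.
apply/rowP => k; rewrite !mxE.
by case: k; do 8 (case=> [|] //=).
Qed.

Fact odot8 a b c d e f g h a' b' c' d' e' f' g' h' :
  odot (oct8 a b c d e f g h) (oct8 a' b' c' d' e' f' g' h') =
  a * a' + b * b' + c * c' + d * d' + e * e' + f * f' + g * g' + h * h'.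
Proof.
by rewrite unlock !big_ord_recl big_ord0 !mxE /= addr0 !addrA.
Qed.

Fact oconj8 a b c d e f g h : oconj (oct8 a b c d e f g h) =
  oct8 a (- b) (- c) (- d) (- e) (- f) (- g) (- h).
Proof. by rewrite unlock oct_cdE. Qed.

Fact omul8 a b c d e f g h a' b' c' d' e' f' g' h' :
  omul (oct8 a b c d e f g h) (oct8 a' b' c' d' e' f' g' h') =
  cd_oct (cd_mul (cd_mul (cd_mul (fun a b : R => a * b) id) (cd_conj id))
     (cd_conj (cd_conj id)) (((a, b), (c, d)), ((e, f), (g, h)))
     (((a', b'), (c', d')), ((e', f'), (g', h')))).
Proof. by rewrite unlock !oct_cdE. Qed.

Ltac coords x := elim/oct8_ind: x => ? ? ? ? ? ? ? ?.
Ltac to8 := rewrite ?oone8;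
  repeat (progress rewrite ?(oct8D, oct8N, oct8Z, odot8, oconj8, omul8) /=).
Ltac oring := to8; congr oct8; ring.
Ltac dring := to8; ring.

Lemma omulDl x y z : (x + y) ** z = x ** z + y ** z.
Proof. coords x; coords y; coords z; oring. Qed.
Lemma omulDr z x y : z ** (x + y) = z ** x + z ** y.
Proof. coords x; coords y; coords z; oring. Qed.
Lemma omulZl a x y : (a *: x) ** y = a *: (x ** y).
Proof. coords x; coords y; oring. Qed.
Lemma omulZr a x y : x ** (a *: y) = a *: (x ** y).
Proof. coords x; coords y; oring. Qed.
Lemma omulNl x y : (- x) ** y = - (x ** y).
Proof. by rewrite -scaleN1r omulZl scaleN1r. Qed.
Lemma omulNr x y : x ** (- y) = - (x ** y).
Proof. by rewrite -scaleN1r omulZr scaleN1r. Qed.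
Lemma omul0l x : 0 ** x = 0.
Proof. by have := omulZl 0 0 x; rewrite !scale0r. Qed.
Lemma omul1l x : '1 ** x = x.
Proof. coords x; oring. Qed.
Lemma omul1r x : x ** '1 = x.
Proof. coords x; oring. Qed.

Lemma oconjD x y : oconj (x + y) = oconj x + oconj y.
Proof. coords x; coords y; oring. Qed.
Lemma oconjZ a x : oconj (a *: x) = a *: oconj x.
Proof. coords x; oring. Qed.
Lemma oconjK : involutive (@oconj R).
Proof. by move=> x; coords x; oring. Qed.
Lemma oconjM x y : oconj (x ** y) = oconj y ** oconj x.
Proof. coords x; coords y; oring. Qed.
Lemma oconj1 : oconj '1 = '1.
Proof. oring. Qed.
Lemma oconjE x : oconj x = (odot x '1 *+ 2) *: '1 - x.
Proof. coords x; oring. Qed.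

Lemma odotC x y : odot x y = odot y x.
Proof. coords x; coords y; dring. Qed.
Lemma odotDl x y z : odot (x + y) z = odot x z + odot y z.
Proof. coords x; coords y; coords z; dring. Qed.
Lemma odotZl a x y : odot (a *: x) y = a * odot x y.
Proof. coords x; coords y; dring. Qed.
Lemma odotDr z x y : odot z (x + y) = odot z x + odot z y.
Proof. by rewrite !(odotC z) odotDl. Qed.
Lemma odotZr a x y : odot x (a *: y) = a * odot x y.
Proof. by rewrite !(odotC x) odotZl. Qed.
Lemma odotNl x y : odot (- x) y = - odot x y.
Proof. by rewrite -scaleN1r odotZl mulN1r. Qed.
Lemma odotNr x y : odot x (- y) = - odot x y.
Proof. by rewrite !(odotC x) odotNl. Qed.
Lemma odot11 : odot '1 '1 = 1.
Proof. dring. Qed.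
Lemma odot_conj x y : odot (oconj x) (oconj y) = odot x y.
Proof. coords x; coords y; dring. Qed.
Lemma odotMl x y z : odot (x ** y) z = odot y (oconj x ** z).
Proof. coords x; coords y; coords z; dring. Qed.
Lemma odotMr x y z : odot (x ** y) z = odot x (z ** oconj y).
Proof. coords x; coords y; coords z; dring. Qed.
Lemma odotMM x y : odot (x ** y) (x ** y) = odot x x * odot y y.
Proof. coords x; coords y; dring. Qed.
Fact odot_sumsq (a b c d e f g h : R) :
  a * a + b * b + c * c + d * d + e * e + f * f + g * g + h * h = 0 ->
  [/\ a = 0, b = 0, c = 0 & d = 0] /\ [/\ e = 0, f = 0, g = 0 & h = 0].
Proof.
have sq (x : R) : 0 <= x * x by rewrite -expr2 sqr_ge0.
have := (sq a, sq b, sq c, sq d, sq e, sq f, sq g, sq h).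
move=> [[[[[[[? ?] ?] ?] ?] ?] ?] ?] /eqP.
rewrite !paddr_eq0 ?addr_ge0 // !mulf_eq0 !orbb.
by rewrite -!andbA => /and5P[/eqP-> /eqP-> /eqP-> /eqP->]; case/and4P=> /eqP-> /eqP-> /eqP-> /eqP->.
Qed.
Lemma odot_eq0 x : odot x x = 0 -> x = 0.
Proof.
coords x; rewrite odot8 => /odot_sumsq[[-> -> -> ->] [-> -> -> ->]].
by rewrite -[RHS](scale0r '1) oone8 oct8Z !mul0r.
Qed.

Lemma omul_conj x y : oconj x ** y + oconj y ** x = (odot x y *+ 2) *: '1.
Proof. coords x; coords y; oring. Qed.
Lemma omul_polarl x y z :
  oconj x ** (y ** z) + oconj y ** (x ** z) = (odot x y *+ 2) *: z.
Proof.
coords x; coords y; coords z; oring.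
Qed.
Lemma omul_polarr x y z :
  (z ** y) ** oconj x + (z ** x) ** oconj y = (odot x y *+ 2) *: z.
Proof.
coords x; coords y; coords z; oring.
Qed.
Lemma omulKl x y : oconj x ** (x ** y) = odot x x *: y.
Proof. coords x; coords y; oring. Qed.
Lemma omulKr x y : (y ** x) ** oconj x = odot x x *: y.
Proof. coords x; coords y; oring. Qed.
Lemma omoufang x y z : (x ** y) ** (z ** x) = x ** ((y ** z) ** x).
Proof. coords x; coords y; coords z; oring. Qed.

End Octonions.

Section Isotopes.
Variable R : realType.

Local Notation "x ** y" := (omul x y) (at level 40, left associativity).
Local Notation "''1'" := (oone R).

Section Isotope.
Variables f g : {linear octonion R -> octonion R}.

Definition isotope_mul (x y : octonion R) : octonion R := f x ** g y.

Fact isotope_mul_addl y : zmod_morphism (isotope_mul^~ y).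
Proof. by move=> a b; rewrite /isotope_mul linearB omulDl omulNl. Qed.
Fact isotope_mul_addr x : zmod_morphism (isotope_mul x).
Proof. by move=> a b; rewrite /isotope_mul linearB omulDr omulNr. Qed.
Fact isotope_mul_scalel y : scalable_for *:%R (isotope_mul^~ y).
Proof. by move=> a x; rewrite /isotope_mul linearZ omulZl. Qed.
Fact isotope_mul_scaler x : scalable_for *:%R (isotope_mul x).
Proof. by move=> a y; rewrite /isotope_mul linearZ omulZr. Qed.

HB.instance Definition _ := isBilinear.Build R (octonion R) (octonion R)
  (octonion R) *:%R *:%R isotope_mul
  isotope_mul_addl isotope_mul_addr isotope_mul_scalel isotope_mul_scaler.

Definition isotope : algebra R := @Algebra R (octonion R) isotope_mul.

End Isotope.

Definition is_oaut (f : 'End(octonion R)) : Prop :=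
  bijective f /\ forall x y, f (x ** y) = f x ** f y.

Record G2 := MkG2 { g2val :> 'End(octonion R); _ : `[< is_oaut g2val >] }.

HB.instance Definition _ := [isSub for g2val].
HB.instance Definition _ := [Choice of G2 by <:].

Implicit Types f g : G2.

Lemma g2P f : is_oaut f. Proof. exact/asboolP/(valP f). Qed.

Lemma g2M f x y : f (x ** y) = f x ** f y.
Proof. by have [_] := g2P f. Qed.

Lemma g2_ker f : lker f == 0%VS.
Proof. by have [/bij_inj/lker0P] := g2P f. Qed.

Fact g2_one_subproof : `[< is_oaut \1%VF >].
Proof.
apply/asboolP; split=> [|x y]; last by rewrite !id_lfunE.
by exists id => x; rewrite id_lfunE.
Qed.
Definition g2_one := MkG2 g2_one_subproof.

Fact g2_mul_subproof f g : `[< is_oaut (g2val f \o g2val g)%VF >].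
Proof.
apply/asboolP; split=> [|x y]; last by rewrite !comp_lfunE !g2M.
have [[f' fK f'K] _] := g2P f; have [[g' gK g'K] _] := g2P g.
by exists (g' \o f') => x; rewrite comp_lfunE /= ?f'K ?fK ?g'K ?gK.
Qed.
Definition g2_mul f g := MkG2 (g2_mul_subproof f g).

Fact g2_inv_subproof f : `[< is_oaut (g2val f)^-1%VF >].
Proof.
have k := g2_ker f; apply/asboolP; split=> [|x y].
  by exists f; [exact: lker0_lfunVK | exact: lker0_lfunK].
move/lker0P: (k); apply.
by rewrite g2M !lker0_lfunVK.
Qed.
Definition g2_inv f := MkG2 (g2_inv_subproof f).

Fact g2_mulA : associative g2_mul.
Proof. by move=> f g h; apply: val_inj; rewrite /= comp_lfunA. Qed.
Fact g2_mul1 : left_id g2_one g2_mul.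
Proof. by move=> f; apply: val_inj; rewrite /= comp_lfun1l. Qed.
Fact g2_mulr1 : right_id g2_one g2_mul.
Proof. by move=> f; apply: val_inj; rewrite /= comp_lfun1r. Qed.
Fact g2_mulV : left_inverse g2_one g2_inv g2_mul.
Proof. by move=> f; apply: val_inj; rewrite /= lker0_compVf ?g2_ker. Qed.
Fact g2_mulrV : right_inverse g2_one g2_inv g2_mul.
Proof. by move=> f; apply: val_inj; rewrite /= lker0_compfV ?g2_ker. Qed.

HB.instance Definition _ := isGroup.Build G2
  g2_mulA g2_mul1 g2_mulr1 g2_mulV g2_mulrV.

Lemma g2_mulE f g x : (f * g)%g x = f (g x).
Proof. by rewrite /= comp_lfunE. Qed.

Lemma g2_1E x : (1%g : G2) x = x.
Proof. by rewrite /= id_lfunE. Qed.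

Lemma g2_fix1 f : f '1 = '1.
Proof.
have [y fy] : exists y, f y = '1 by exists (f^-1%VF '1); rewrite lker0_lfunVK ?g2_ker.
by rewrite -[LHS]omul1r -{2}fy -g2M omul1l.
Qed.

Definition is_cayley (u v z : octonion R) : Prop :=
  [/\ [/\ odot u u = 1, odot v v = 1 & odot z z = 1],
      [/\ odot u v = 0, odot u z = 0 & odot v z = 0],
      [/\ odot u '1 = 0, odot v '1 = 0 & odot z '1 = 0]
    & odot z (u ** v) = 0].

Record cayley_triple := CayleyTriple {
  cu : octonion R;
  cv : octonion R;
  cz : octonion R;
  cayleyP : is_cayley cu cv cz
}.

Section FixedTriple.
Variable c : cayley_triple.
Local Notation u := (cu c).
Local Notation v := (cv c).
Local Notation z := (cz c).
Local Notation w := (v ** z).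

Record SU3 := MkSU3 { su3val :> G2; _ : su3val u == u }.

HB.instance Definition _ := [isSub for su3val].
HB.instance Definition _ := [Choice of SU3 by <:].

Lemma su3P (rho : SU3) : rho u = u. Proof. exact/eqP/(valP rho). Qed.

Fact su3_closed : group_closed [pred f : G2 | f u == u].
Proof.
split=> [|f g]; first by rewrite inE g2_1E.
rewrite !inE => /eqP fu /eqP gu; apply/eqP; rewrite g2_mulE.
by rewrite -[in LHS]gu -[g^-1%g (g u)]g2_mulE mulVg g2_1E fu.
Qed.

HB.instance Definition _ :=
  SubChoice_isSubGroup.Build G2 [pred f : G2 | f u == u] SU3 su3_closed.

(** [H] is the quaternion subalgebra spanned by [1, v, z, v ** z]. *)
Definition proj_H (x : octonion R) : octonion R :=
  odot x '1 *: '1 + odot x v *: v + odot x z *: z + odot x w *: w.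

(** [hat e] is the identity on [H] and [(-1)^e] on the orthogonal complement of
    [H], which contains [u].  Lemmas [hatE] and [hat_unique] say that it is the
    automorphism that sends [(u, v, z)] to [((-1)^e u, v, z)]. *)
Definition hat_fun (e : 'Z_2) (x : octonion R) : octonion R :=
  proj_H x + (-1) ^+ e *: (x - proj_H x).

Fact proj_HD x y : proj_H (x + y) = proj_H x + proj_H y.
Proof.
rewrite /proj_H !odotDl !scalerDl.
move: (_ *: '1) (_ *: '1) (_ *: v) (_ *: v) (_ *: z) (_ *: z) (_ *: w) (_ *: w).
by move=> a a' b b' d d' e e'; rewrite !addrA [LHS](ACl (1*3*5*7*2*4*6*8))%AC.
Qed.

Fact proj_HZ a x : proj_H (a *: x) = a *: proj_H x.
Proof. by rewrite /proj_H !odotZl -!scalerA -!scalerDr. Qed.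

Fact hat_fun_linear e : linear (hat_fun e).
Proof.
move=> a x y; rewrite /hat_fun proj_HD proj_HZ.
move: (proj_H x) (proj_H y) => p q.
have -> : a *: x + y - (a *: p + q) = a *: (x - p) + (y - q).
  by rewrite scalerBr opprD !addrA [LHS](ACl (1*3*2*4))%AC.
move: (x - p) (y - q) ((-1) ^+ e) => X Y s.
rewrite !scalerDr !scalerA [s * a]mulrC.
by rewrite !addrA [LHS](ACl (1*3*2*4))%AC.
Qed.
HB.instance Definition _ e := GRing.isLinear.Build R (octonion R) (octonion R)
  *:%R (hat_fun e) (hat_fun_linear e).

Fact im_conj (y : octonion R) : odot y '1 = 0 -> oconj y = - y.
Proof. by move=> y1; rewrite oconjE y1 mul0rn scale0r sub0r. Qed.

Fact im_sql (y t : octonion R) :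
  odot y '1 = 0 -> odot y y = 1 -> y ** (y ** t) = - t.
Proof.
move=> y1 yy; have := omulKl y t; rewrite (im_conj y1) yy scale1r omulNl.
by move=> /(congr1 -%R); rewrite opprK.
Qed.

Fact im_sqr (y t : octonion R) :
  odot y '1 = 0 -> odot y y = 1 -> (t ** y) ** y = - t.
Proof.
move=> y1 yy; have := omulKr y t; rewrite (im_conj y1) yy scale1r omulNr.
by move=> /(congr1 -%R); rewrite opprK.
Qed.

Fact im_swap (y x : octonion R) :
  odot y '1 = 0 -> odot y x = 0 -> y ** x = oconj x ** y.
Proof.
move=> y1 yx; have := omul_conj (oconj y) x.
rewrite oconjK (im_conj y1) odotNl yx oppr0 mul0rn scale0r omulNr => /eqP.
by rewrite subr_eq0 => /eqP.
Qed.

Fact im_dot_conj (y x : octonion R) :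
  odot y '1 = 0 -> odot y (oconj x) = - odot y x.
Proof.
move=> y1; have := odot_conj (oconj y) x.
rewrite oconjK => ->; by rewrite (im_conj y1) odotNl.
Qed.

Fact mul_hku (y h k : octonion R) : odot y '1 = 0 ->
  odot y h = 0 -> odot y k = 0 -> odot y (k ** h) = 0 ->
  h ** (k ** y) = (k ** h) ** y.
Proof.
move=> y1 yh yk ykh; have := omul_polarl (oconj h) y (oconj k).
rewrite oconjK odotC im_dot_conj // yh oppr0 mul0rn scale0r.
rewrite -oconjM (im_conj y1) omulNl [y ** oconj k]im_swap ?im_dot_conj ?yk ?oppr0 //.
rewrite oconjK [y ** oconj _]im_swap ?im_dot_conj ?ykh ?oppr0 // oconjK => /eqP.
by rewrite subr_eq0 => /eqP.
Qed.

Fact mul_kuh (y h k : octonion R) : odot y '1 = 0 -> odot y h = 0 ->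
  (k ** y) ** h = (k ** oconj h) ** y.
Proof.
move=> y1 yh; have := omul_polarr (oconj h) y k.
rewrite oconjK odotC im_dot_conj // yh oppr0 mul0rn scale0r (im_conj y1) omulNr.
by move=> /eqP; rewrite subr_eq0 => /eqP.
Qed.

Fact mul_kuku (y k k' : octonion R) : odot y '1 = 0 -> odot y y = 1 ->
  odot y k = 0 -> odot y (oconj k ** k') = 0 ->
  (k ** y) ** (k' ** y) = - (oconj k' ** k).
Proof.
move=> y1 yy yk ykk; have -> : k ** y = y ** oconj k.
  by rewrite [RHS]im_swap ?oconjK ?im_dot_conj ?yk ?oppr0.
rewrite omoufang.
have -> : (oconj k ** k') ** y = y ** oconj (oconj k ** k').
  by rewrite [RHS]im_swap ?oconjK ?im_dot_conj ?ykk ?oppr0.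
by rewrite im_sql // oconjM oconjK.
Qed.

Fact u_unit : odot u u = 1. Proof. by case: (cayleyP c) => [[]]. Qed.
Fact v_unit : odot v v = 1. Proof. by case: (cayleyP c) => [[]]. Qed.
Fact z_unit : odot z z = 1. Proof. by case: (cayleyP c) => [[]]. Qed.
Fact u_v : odot u v = 0. Proof. by case: (cayleyP c) => _ []. Qed.
Fact u_z : odot u z = 0. Proof. by case: (cayleyP c) => _ []. Qed.
Fact v_z : odot v z = 0. Proof. by case: (cayleyP c) => _ []. Qed.
Fact u_1 : odot u '1 = 0. Proof. by case: (cayleyP c) => _ _ []. Qed.
Fact v_1 : odot v '1 = 0. Proof. by case: (cayleyP c) => _ _ []. Qed.
Fact z_1 : odot z '1 = 0. Proof. by case: (cayleyP c) => _ _ []. Qed.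
#[local] Hint Resolve u_unit v_unit z_unit u_v u_z v_z u_1 v_1 z_1 : core.

Fact u_w : odot u w = 0.
Proof.
have : odot z (u ** v) = 0 by case: (cayleyP c).
rewrite odotC odotMl (im_conj u_1) omulNl odotNr => /eqP.
rewrite oppr_eq0 => /eqP e.
by rewrite odotC odotMr (im_conj z_1) omulNr odotNr e oppr0.
Qed.
Fact w_1 : odot w '1 = 0.
Proof. by rewrite odotMl omul1r (im_conj v_1) odotNr odotC v_z oppr0. Qed.
Fact w_v : odot w v = 0.
Proof.
by rewrite odotMl -{2}[v]omul1r omulKl v_unit scale1r.
Qed.
Fact w_z : odot w z = 0.
Proof.
by rewrite odotMr -{1}[z]omul1l omulKr z_unit scale1r.
Qed.
Fact w_unit : odot w w = 1.
Proof. by rewrite odotMM v_unit z_unit mulr1. Qed.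

#[local] Hint Resolve w_unit u_w w_1 w_v w_z : core.

Definition quat_of (a b d e : R) : octonion R :=
  a *: '1 + b *: v + d *: z + e *: w.

Definition inH (x : octonion R) := exists a b d e, x = quat_of a b d e.

Fact inHD x y : inH x -> inH y -> inH (x + y).
Proof.
move=> [a [b [d [e ->]]]] [a' [b' [d' [e' ->]]]].
exists (a + a'), (b + b'), (d + d'), (e + e'); rewrite /quat_of !scalerDl.
by rewrite !addrA [LHS](ACl (1*5*2*6*3*7*4*8))%AC.
Qed.
Fact inHZ k x : inH x -> inH (k *: x).
Proof.
move=> [a [b [d [e ->]]]]; exists (k * a), (k * b), (k * d), (k * e).
by rewrite /quat_of !scalerDr !scalerA.
Qed.
Fact inHN x : inH x -> inH (- x).
Proof. by rewrite -scaleN1r; apply: inHZ. Qed.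
Fact inH1 : inH '1.
Proof. by exists 1, 0, 0, 0; rewrite /quat_of !scale0r scale1r !addr0. Qed.
Fact inHv : inH v.
Proof. by exists 0, 1, 0, 0; rewrite /quat_of !scale0r scale1r !addr0 add0r. Qed.
Fact inHz : inH z.
Proof. by exists 0, 0, 1, 0; rewrite /quat_of !scale0r scale1r !addr0 !add0r. Qed.
Fact inHw : inH w.
Proof. by exists 0, 0, 0, 1; rewrite /quat_of !scale0r scale1r !add0r. Qed.
#[local] Hint Resolve inH1 inHv inHz inHw inHD inHZ inHN : core.
Fact inH_conj x : inH x -> inH (oconj x).
Proof.
move=> xH; rewrite oconjE; apply: inHD; last exact: inHN.
exact: inHZ.
Qed.
Fact zv : z ** v = - w.
Proof. by rewrite im_swap ?[odot z v]odotC // (im_conj v_1) omulNl. Qed.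
Fact inHM x y : inH x -> inH y -> inH (x ** y).
Proof.
have vw : v ** w = - z by rewrite im_sql.
have vv : v ** v = - '1 by rewrite -{2}[v]omul1r im_sql.
have zz : z ** z = - '1 by rewrite -{2}[z]omul1r im_sql.
have ww : w ** w = - '1 by rewrite -{2}[w]omul1r im_sql.
have zw : z ** w = v by rewrite -[w]opprK -zv omulNr im_sql // opprK.
have wv : w ** v = z by rewrite -[w]opprK -zv omulNl im_sqr // opprK.
have wz : w ** z = - v by rewrite im_sqr.
move=> [a [b [d [e ->]]]] [a' [b' [d' [e' ->]]]].
rewrite /quat_of !(omulDl, omulDr, omulZl, omulZr) !(omul1l, omul1r).
rewrite vv vw zv zz zw wv wz ww.
by do ![apply: inHD | apply: inHZ | apply: inHN] => //; apply: inHN.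
Qed.
Fact inH_u x : inH x -> odot u x = 0.
Proof.
move=> [a [b [d [e ->]]]].
by rewrite /quat_of !odotDr !odotZr u_1 u_v u_z u_w !mulr0 !addr0.
Qed.

Fact proj_H_id x : inH x -> proj_H x = x.
Proof.
move=> [a [b [d [e ->]]]]; rewrite /proj_H /quat_of !odotDl !odotZl.
rewrite odot11 v_unit z_unit w_unit v_1 z_1 w_1 w_v w_z v_z.
rewrite ![odot '1 _]odotC [odot z v]odotC [odot v w]odotC [odot z w]odotC.
rewrite v_1 z_1 w_1 w_v w_z v_z.
by rewrite !mulr0 !mulr1 !addr0 !add0r.
Qed.

Fact proj_H_u x : inH x -> proj_H (x ** u) = 0.
Proof.
move=> xH; have k y : inH y -> odot (x ** u) y = 0.
  by move=> yH; rewrite odotMl inH_u //; apply/inHM => //; apply: inH_conj.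
by rewrite /proj_H !k // !scale0r !addr0.
Qed.

Definition cayley_basis (k : 'I_8) : octonion R :=
  nth 0 [:: '1; v; z; w; '1 ** u; v ** u; z ** u; w ** u] k.

Definition double_fun (x : octonion R) : octonion R := \sum_k x 0 k *: cayley_basis k.

Fact double_fun_linear : linear double_fun.
Proof.
move=> k x y; rewrite /double_fun scaler_sumr -big_split /=.
by apply: eq_bigr => i _; rewrite !mxE scalerDl scalerA.
Qed.

Fact quat_ofH a b d e : inH (quat_of a b d e).
Proof. by exists a, b, d, e. Qed.

Fact dot_uH x y : inH x -> inH y -> odot x (y ** u) = 0.
Proof.
by move=> xH yH; rewrite odotC odotMl inH_u //; apply/inHM => //; apply: inH_conj.
Qed.

Fact quat_of_dot a b d e :
  odot (quat_of a b d e) (quat_of a b d e) = a * a + b * b + d * d + e * e.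
Proof.
rewrite /quat_of !(odotDl, odotDr, odotZl, odotZr).
rewrite ![odot '1 v]odotC ![odot '1 z]odotC ![odot '1 w]odotC.
rewrite ![odot z v]odotC ![odot v w]odotC ![odot z w]odotC.
rewrite odot11 v_unit z_unit w_unit v_1 z_1 w_1 w_v w_z v_z.
by rewrite !mulr0 !mulr1 !addr0 !add0r.
Qed.

Fact double_fun8 a b d e a' b' d' e' : double_fun (oct8 a b d e a' b' d' e') =
  quat_of a b d e + quat_of a' b' d' e' ** u.
Proof.
rewrite /double_fun !big_ord_recl big_ord0 /cayley_basis !mxE /= /quat_of.
by rewrite !omulDl !omulZl addr0 !addrA.
Qed.

#[local] Hint Resolve quat_ofH inHM inH_conj : core.
Fact double_dot x : odot (double_fun x) (double_fun x) = odot x x.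
Proof.
elim/oct8_ind: x => a b d e a' b' d' e'; rewrite double_fun8 odot8.
have := quat_of_dot a b d e; have := quat_of_dot a' b' d' e'.
move: (quat_of a b d e) (quat_ofH a b d e) => h hH.
move: (quat_of a' b' d' e') (quat_ofH a' b' d' e') => k kH ek eh.
rewrite odotDl !odotDr [odot (k ** u) h]odotC !(dot_uH hH kH) addr0 add0r.
by rewrite odotMM u_unit mulr1 ek eh !addrA.
Qed.

Fact cayley_decomp (x : octonion R) : exists h k : octonion R,
  [/\ inH h, inH k & x = h + k ** u].
Proof.
pose D : {linear octonion R -> octonion R} := HB.pack double_fun
  (GRing.isLinear.Build R (octonion R) (octonion R) *:%R
     double_fun double_fun_linear).
pose F := linfun D.
have k0 : lker F == 0%VS.
  apply/lker0P => a b; rewrite !lfunE /= => e.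
  apply/eqP; rewrite -subr_eq0; apply/eqP/odot_eq0.
  rewrite -double_dot; have -> : double_fun (a - b) = D a - D b by rewrite -linearB.
  by rewrite /= e subrr -(scale0r '1) odotZl mul0r.
rewrite -(lker0_lfunVK k0 x) lfunE /=.
elim/oct8_ind: (F^-1%VF x) => a b d e a' b' d' e'; rewrite double_fun8.
by exists (quat_of a b d e), (quat_of a' b' d' e').
Qed.

Fact hat_funE e h k : inH h -> inH k ->
  hat_fun e (h + k ** u) = h + ((-1) ^+ e *: k) ** u.
Proof.
move=> hH kH; rewrite /hat_fun proj_HD proj_H_id // proj_H_u // addr0.
by rewrite (addrC h (k ** u)) addrK omulZl.
Qed.

Fact hat_funM e x y : hat_fun e (x ** y) = hat_fun e x ** hat_fun e y.
Proof.
have [h [k [hH kH ->]]] := cayley_decomp x.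
have [h' [k' [hH' kH' ->]]] := cayley_decomp y.
have M (a b d f : octonion R) : inH a -> inH b -> inH d -> inH f ->
    (a + b ** u) ** (d + f ** u) =
    (a ** d - oconj f ** b) + (f ** a + b ** oconj d) ** u.
  move=> aH bH dH fH; rewrite omulDl !omulDr.
  rewrite (mul_hku u_1 (inH_u aH) (inH_u fH) (inH_u (inHM fH aH))).
  rewrite (mul_kuh _ u_1 (inH_u dH)).
  rewrite (mul_kuku u_1 u_unit (inH_u bH) (inH_u (inHM (inH_conj bH) fH))).
  by rewrite omulDl !addrA [LHS](ACl (1*4*2*3))%AC.
rewrite M // !hat_funE //; last first.
- by apply: inHD; apply: inHM => //; apply: inH_conj.
- by apply: inHD; [|apply: inHN]; apply: inHM => //; apply: inH_conj.
rewrite M ?inHZ //; try exact: inHZ.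
congr (_ - _ + _ ** u).
  by rewrite oconjZ omulZl omulZr scalerA -exprD addnn -signr_odd odd_double scale1r.
by rewrite !omulZl scalerDr.
Qed.

Fact hat_funK e : involutive (hat_fun e).
Proof.
move=> x; have [h [k [hH kH ->]]] := cayley_decomp x.
rewrite !hat_funE //; last exact: inHZ.
by rewrite scalerA -exprD addnn -signr_odd odd_double scale1r.
Qed.

Fact hat_subproof e : `[< is_oaut (linfun (hat_fun e)) >].
Proof.
apply/asboolP; split=> [|x y]; last by rewrite !lfunE /= hat_funM.
by exists (hat_fun e) => x; rewrite lfunE /= hat_funK.
Qed.
Definition hat (e : 'Z_2) : G2 := MkG2 (hat_subproof e).

Lemma hatE (e : 'Z_2) : [/\ hat e u = (-1) ^+ e *: u, hat e v = v & hat e z = z].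
Proof.
have inH0 : inH 0 by rewrite -(scale0r '1); apply: inHZ.
split; rewrite /= lfunE /=.
- have := @hat_funE e 0 '1 inH0 inH1.
  by rewrite !add0r omulZl omul1l.
- by have := @hat_funE e v 0 inHv inH0; rewrite scaler0 omul0l addr0.
- by have := @hat_funE e z 0 inHz inH0; rewrite scaler0 omul0l addr0.
Qed.

Lemma hat_unique (e : 'Z_2) f :
  f u = (-1) ^+ e *: u -> f v = v -> f z = z -> f = hat e.
Proof.
move=> fu fv fz; have [hu hv hz] := hatE e.
suff q (g : G2) : g u = (-1) ^+ e *: u -> g v = v -> g z = z ->
    forall h k, inH h -> inH k -> g (h + k ** u) = h + (-1) ^+ e *: (k ** u).
  apply/val_inj/lfunP => x; have [h [k [hH kH ->]]] := cayley_decomp x.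
  by rewrite !q.
move=> gu gv gz.
have gH h : inH h -> g h = h.
  move=> [a [b [d [i ->]]]].
  by rewrite /quat_of !linearD !linearZ /= g2M gv gz g2_fix1.
by move=> h k hH kH; rewrite linearD /= g2M gu !gH // omulZr.
Qed.

Fact sign2 (e e' : 'Z_2) : (-1) ^+ (e * e')%g = (-1) ^+ e * (-1) ^+ e' :> R.
Proof.
by case: e e' => [[|[|e]] He] [[|[|e']] He'] //;
  rewrite /= ?expr0 ?expr1 ?mul1r ?mulr1 ?mulrNN ?mulr1.
Qed.

Lemma hatM e e' : hat (e * e')%g = (hat e * hat e')%g.
Proof.
have [hu hv hz] := hatE e; have [hu' hv' hz'] := hatE e'.
apply/esym/hat_unique; rewrite g2_mulE.
- by rewrite hu' linearZ /= hu scalerA sign2 mulrC.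
- by rewrite hv' hv.
- by rewrite hz' hz.
Qed.

Lemma hat1 : hat 1%g = 1%g.
Proof.
by apply/esym/hat_unique; rewrite g2_1E //= expr0 scale1r.
Qed.

Lemma hatK e : (hat e * hat e)%g = 1%g.
Proof.
rewrite -hatM -hat1; congr hat.
by apply: val_inj; case: e => [[|[|e]] He].
Qed.

Fact conj_hat_subproof e (rho : SU3) :
  (hat e * su3val rho * hat e)%g u == u.
Proof.
have [hu _ _] := hatE e.
rewrite !g2_mulE hu linearZ /= su3P linearZ /= hu scalerA -exprD addnn.
by rewrite -signr_odd odd_double scale1r.
Qed.

Definition conj_hat (e : 'Z_2) (rho : SU3) : SU3 := MkSU3 (conj_hat_subproof e rho).

Fact conj_hat1 rho : conj_hat 1%g rho = rho.
Proof. by apply: val_inj; rewrite /= hat1 mul1g mulg1. Qed.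

Fact conj_hatM e e' rho : conj_hat (e * e')%g rho = conj_hat e (conj_hat e' rho).
Proof.
apply: val_inj => /=; rewrite {1}hatM.
have -> : (e * e' = e' * e)%g by rewrite /mulg /= addrC.
by rewrite hatM !mulgA.
Qed.

Fact conj_hat_morph e rho rho' :
  conj_hat e (rho * rho')%g = (conj_hat e rho * conj_hat e rho')%g.
Proof.
apply: val_inj => /=; rewrite !mulgA -[(_ * hat e * hat e)%g]mulgA hatK mulg1.
by [].
Qed.

Definition SU3_action : aut_action 'Z_2 SU3 :=
  AutAction conj_hat1 conj_hatM conj_hat_morph.

Definition SU3_Z2 : groupType := semidirect SU3_action.

Definition plane_C : {vspace octonion R} := (<['1]> + <[u]>)%VS.

Definition circle : {pred octonion R} :=
  [pred a | (a \in plane_C) && (onorm a == 1)].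

Definition Kpow (e : 'Z_2) (x : octonion R) : octonion R := iter e (@oconj R) x.

Definition circle_pairs_pred (i j : 'Z_2) : pred (octonion R * octonion R) :=
  [pred p | [&& p.1 \in circle, p.2 \in circle
              & p != ((-1) ^+ j *: '1, (-1) ^+ i *: '1)]].

Definition circle_pairs (i j : 'Z_2) :=
  {p : octonion R * octonion R | circle_pairs_pred i j p}.

Fact KpowK e : involutive (Kpow e).
Proof. by case: e => [[|[|e]] He] x //; rewrite /Kpow /= ?oconjK. Qed.

Fact Kpow1 e a : Kpow e (a *: '1) = a *: '1.
Proof. by case: e => [[|[|e]] He] //; rewrite /Kpow /= oconjZ oconj1. Qed.

Fact KpowM e e' x : Kpow (e * e')%g x = Kpow e (Kpow e' x).
Proof.
by case: e e' => [[|[|e]] He] [[|[|e']] He'] //; rewrite /Kpow /= ?oconjK.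
Qed.

Fact circle_K e a : a \in circle -> Kpow e a \in circle.
Proof.
case: e => [[|[|e]] He] //; rewrite /Kpow /= !inE => /andP[aC an].
rewrite /onorm odot_conj -/(onorm a) an andbT oconjE.
have C1 : '1 \in plane_C by rewrite (subvP (addvSl _ _)) // memv_line.
by rewrite rpredB // rpredZ.
Qed.

Fact circle_act_subproof i j (g : SU3_Z2) (p : circle_pairs i j) :
  circle_pairs_pred i j (Kpow g.2 (sval p).1, Kpow g.2 (sval p).2).
Proof.
case: p => [[a b] /= /and3P[/= aC bC abN]]; rewrite /circle_pairs_pred inE /=.
rewrite !circle_K //=; apply: contraNneq abN => -[ea eb].
by rewrite -(KpowK g.2 a) -(KpowK g.2 b) ea eb !Kpow1.
Qed.

Definition circle_act i j (g : SU3_Z2) (p : circle_pairs i j) : circle_pairs i j :=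
  exist _ (Kpow g.2 (sval p).1, Kpow g.2 (sval p).2) (circle_act_subproof g p).

Fact circle_act1 i j (p : circle_pairs i j) : circle_act 1%g p = p.
Proof. by case: p => [[a b] abP]; apply: eq_exist. Qed.

Fact circle_actM i j (g h : SU3_Z2) (p : circle_pairs i j) :
  circle_act (g * h)%g p = circle_act g (circle_act h p).
Proof. by apply: eq_exist; rewrite /= !KpowM. Qed.

Definition circle_action i j : left_action SU3_Z2 (circle_pairs i j) :=
  LeftAction (@circle_act1 i j) (@circle_actM i j).

Definition proj_C (x : octonion R) : octonion R :=
  odot x '1 *: '1 + odot x u *: u.

Definition lambda (k : 'Z_2) (t x : octonion R) : octonion R :=
  t ** Kpow k (proj_C x) + (x - proj_C x).

Lemma lambda_in k t x : x \in plane_C -> lambda k t x = t ** Kpow k x.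
Proof.
move=> /memv_addP[_ /vlineP[a ->] [_ /vlineP[b ->] ->]].
have e : proj_C (a *: '1 + b *: u) = a *: '1 + b *: u.
  rewrite /proj_C !odotDl !odotZl [odot '1 u]odotC odot11 u_1 u_unit.
  by rewrite !mulr0 !mulr1 addr0 add0r.
by rewrite /lambda e subrr addr0.
Qed.

Lemma lambda_perp k t x : (forall y, y \in plane_C -> odot x y = 0) ->
  lambda k t x = x.
Proof.
move=> xC; rewrite /lambda /proj_C !xC; last 2 first.
- by rewrite (subvP (addvSr _ _)) // memv_line.
- by rewrite (subvP (addvSl _ _)) // memv_line.
rewrite !scale0r addr0 subr0 -(scale0r '1) Kpow1 omulZr !scale0r.
by rewrite add0r.
Qed.

Fact proj_C_linear : linear proj_C.
Proof.
move=> a x y; rewrite /proj_C !odotDl !odotZl !scalerDl scalerDr !scalerA.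
by rewrite !addrA [LHS](ACl (1*3*2*4))%AC.
Qed.

Fact Kpow_linear k : linear (Kpow k).
Proof.
by case: k => [[|[|k]] Hk] // a x y; rewrite /Kpow /= oconjD oconjZ.
Qed.

Fact lambda_linear k t : linear (lambda k t).
Proof.
move=> a x y; rewrite /lambda proj_C_linear Kpow_linear omulDr omulZr.
move: (proj_C x) (proj_C y) (Kpow k _) => p q r; rewrite !scalerDr scalerN opprD !addrA.
by rewrite [LHS](ACl (1*3*5*2*4*6))%AC.
Qed.
HB.instance Definition _ k t := GRing.isLinear.Build R (octonion R) (octonion R)
  *:%R (lambda k t) (lambda_linear k t).

Section Functor.
Variables i j : 'Z_2.

Definition F_obj (p : circle_pairs i j) : algebra R :=
  isotope (lambda j (sval p).1) (lambda i (sval p).2).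

Definition F_hom (p q : circle_pairs i j) (g : SU3_Z2) :
    'Hom(F_obj p, F_obj q) :=
  (su3val g.1 * hat g.2)%g.

(** [F_functor] depends on proofs that [F_obj] and [F_hom] take their values in
    the target category; neither is obvious, so they are not proved here. *)
Hypothesis F_objP : forall p : circle_pairs i j, in_D116ij i j (F_obj p).
Hypothesis F_homP : forall (p q : circle_pairs i j) (g : SU3_Z2),
  circle_action i j g p = q -> is_morphism (F_hom p q g).

Local Notation C := (action_groupoid (circle_action i j)).
Local Notation D := (cat_D116ij R i j).

Definition F_fobj (p : C) : D := D116ij_obj (F_objP p).

Definition F_fmap (p q : C) (g : hom p q) : hom (F_fobj p) (F_fobj q) :=
  D116ij_hom (F_objP p) (F_objP q) (F_homP (svalP g)).

Fact F_fmap_id (p : C) : F_fmap (idm p) = idm (F_fobj p).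
Proof. by apply: eq_exist; rewrite /= /F_hom hat1 mulg1. Qed.

Fact F_fmap_cmp (p q r : C) (h : hom q r) (g : hom p q) :
  F_fmap (cmp h g) = cmp (F_fmap h) (F_fmap g).
Proof.
apply: eq_exist; case: h g => [[rho e] hP] [[sigma e'] gP].
suff E : (su3val rho * (hat e * su3val sigma * hat e) * hat (e * e') =
    (su3val rho * hat e) * (su3val sigma * hat e'))%g by exact: (congr1 g2val E).
by rewrite hatM !mulgA -[(_ * hat e * hat e)%g]mulgA hatK mulg1.
Qed.

Definition F_functor : functor C D := Functor F_fmap_id F_fmap_cmp.

End Functor.

End FixedTriple.

End Isotopes.

(* Main.v *)
Require Import Defs.
From HB Require Import structures.
From mathcomp Require Import all_boot all_order all_fingroup all_algebra.
From mathcomp Require Import boolp reals ring lra.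
From mathcomp.algebra Require Import spectral.
From mathcomp.real_closed Require Import complex.
Import Defs.

(** Write C for the plane spanned by 1 and u, and W for its orthogonal
    complement.  The derivations of an algebra tell C and W apart, and this is
    what makes both the source and the target of the functor visible.

    The functor is well defined.  Derivations of O that kill C act irreducibly
    on W ([su3_irreducible]), and they are derivations of every isotope O_{f,g}
    whose maps f, g preserve C and fix W pointwise.  Conversely, let d be a
    derivation of the isotope by lambda_a, lambda_b.  It is skew, because
    [d, L_x] = L_{dx} and L_x is a similarity ([isotope_derivation_skew]).  The
    square of a vector w of W is -|w|^2, so d 1 lies in C w for every w, hence
    vanishes; the remaining relations then give d u = 0, except for the excluded
    pair ([lambda_derivation_u]).  So C consists of the invariants, and the
    components have dimensions 1, 1, 6.  Multiplications by nonzero octonions have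
    positive determinant ([sg_det_omul]), hence the double sign comes from the
    determinants of the lambdas ([sg_det_lambda]).

    The functor is fully faithful.  A morphism respects invariants, hence maps
    C to C and W to W.  Squares of vectors of W show that it fixes 1 and is isometric.
    Solving lambda x = 1 in C shows that it intertwines the lambdas, so it is
    an automorphism of O that sends u to u or -u ([isotope_morphism_full]).  The
    value at u also shows that the functor is faithful ([SU3_Z2_inj]).

    The functor is dense.  Let P be the plane of invariants of an algebra A of
    the target ([derivation_plane]).  For unit vectors e1, e2 of P the product
    (R_{e1}^-1 x) (L_{e2}^-1 y) has the unit e2 e1 and a multiplicative norm, so
    by Hurwitz' theorem ([octonion_embedding]) it is the product of O, with C
    in place of P; thus A is the isotope of O by R_{e1} and L_{e2}
    ([kaplansky_isotope]).  These two maps commute with the derivations, which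
    act irreducibly on W by C-linear maps; the commutant of such an action
    consists of multiplications by elements of C ([commutant]).  So each of the
    two maps multiplies W by a unit complex number, and another choice of e1, e2
    in P turns both numbers into 1 ([exists_trivial_multipliers]).  An isometry
    that preserves C and fixes W is a lambda ([lambda_characterization]).  The
    excluded pair cannot occur, since both lambdas then commute with all
    derivations of O, and some of these move u ([excluded_derivation]). *)

Set Implicit Arguments.
Unset Strict Implicit.
Unset Printing Implicit Defensive.

Import Order.TTheory GRing.Theory Num.Theory.
Local Open Scope ring_scope.

(** * Fully faithful, essentially surjective functors *)

Section Equivalence.
Variables (C D : category) (F : functor C D).

(** A quasi-inverse chooses a preimage up to isomorphism of every object; its
    action on morphisms is then forced by full faithfulness. *)
Lemma functor_equivalence :
  (forall (x y : C) (f g : hom x y), fmap F f = fmap F g -> f = g) ->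
  (forall (x y : C) (h : hom (F x) (F y)), exists f, fmap F f = h) ->
  (forall d : D, exists (x : C) (h : hom (F x) d), is_iso h) ->
  is_equivalence F.
Proof.
move=> Ff full ess.
have ess' (d : D) : exists p : {x : C & {h : hom (F x) d & hom d (F x)}},
    cmp (projT2 (projT2 p)) (projT1 (projT2 p)) = idm _ /\
    cmp (projT1 (projT2 p)) (projT2 (projT2 p)) = idm _.
  by have [x [h [k hk]]] := ess d; exists (existT _ x (existT _ h k)).
pose G0 d := projT1 (cid (ess' d)).
have G0P d := projT2 (cid (ess' d)).
pose G d : C := projT1 (G0 d).
pose h d : hom (F (G d)) d := projT1 (projT2 (G0 d)).
pose k d : hom d (F (G d)) := projT2 (projT2 (G0 d)).
have kh d : cmp (k d) (h d) = idm _ := (G0P d).1.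
have hk d : cmp (h d) (k d) = idm _ := (G0P d).2.
pose pre x y (f : hom (F x) (F y)) := projT1 (cid (full x y f)).
have preE x y (f : hom (F x) (F y)) : fmap F (pre x y f) = f.
  by rewrite /pre; case: (cid _).
have pre1 x : pre x x (idm (F x)) = idm x by apply: Ff; rewrite preE fmap_id.
have preM x y z (g : hom (F y) (F z)) (f : hom (F x) (F y)) :
    cmp (pre y z g) (pre x y f) = pre x z (cmp g f).
  by apply: Ff; rewrite fmap_cmp !preE.
have preF x y (f : hom x y) : pre x y (fmap F f) = f by apply: Ff; rewrite preE.
pose Gm d e (f : hom d e) : hom (G d) (G e) := pre _ _ (cmp (k e) (cmp f (h d))).
have Gm1 d : Gm d d (idm d) = idm (G d) by rewrite /Gm cmp_idl kh pre1.
have GmM d e e' (g : hom e e') (f : hom d e) :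
    Gm _ _ (cmp g f) = cmp (Gm _ _ g) (Gm _ _ f).
  by rewrite /Gm preM -!cmpA [cmp (h e) _]cmpA hk cmp_idl.
pose GF := @Functor D C G Gm Gm1 GmM.
exists GF; split.
- exists (fun x => pre (G (F x)) x (h (F x))); split=> [x|x y f].
    exists (pre x (G (F x)) (k (F x))); split.
      by apply: etrans (preM _ _ _ _ _) _; rewrite kh pre1.
    by apply: etrans (preM _ _ _ _ _) _; rewrite hk pre1.
  apply: etrans (preM _ _ _ _ _) _.
  rewrite (cmpA (h (F y)) (k (F y))) hk cmp_idl -preM.
  by rewrite (preF x y f).
- exists h; split=> [d|d e f].
    by exists (k d); split; [exact: kh | exact: hk].
  by rewrite /= /comp_fmap /= preE cmpA hk cmp_idl.
Qed.

End Equivalence.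

(** * Euclidean structures *)

Record euclidean (R : realType) (V : lmodType R) (dot : V -> V -> R) : Prop := {
  dotC : forall x y, dot x y = dot y x;
  dotDl : forall x y z, dot (x + y) z = dot x z + dot y z;
  dotZl : forall (k : R) x y, dot (k *: x) y = k * dot x y;
  dot_gt0 : forall x, x != 0 -> 0 < dot x x
}.

Section Euclidean.
Variables (R : realType) (V : lmodType R) (dot : V -> V -> R).
Hypothesis dotE : euclidean dot.

Lemma dotDr x y z : dot z (x + y) = dot z x + dot z y.
Proof. by rewrite !(dotC dotE z) (dotDl dotE). Qed.
Lemma dotZr (k : R) x y : dot x (k *: y) = k * dot x y.
Proof. by rewrite !(dotC dotE x) (dotZl dotE). Qed.
Lemma dotNl x y : dot (- x) y = - dot x y.
Proof. by rewrite -scaleN1r (dotZl dotE) mulN1r. Qed.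
Lemma dotNr x y : dot x (- y) = - dot x y.
Proof. by rewrite !(dotC dotE x) dotNl. Qed.
Lemma dot0l y : dot 0 y = 0.
Proof. by rewrite -(scale0r 0) (dotZl dotE) mul0r. Qed.
Lemma dot0r y : dot y 0 = 0.
Proof. by rewrite (dotC dotE) dot0l. Qed.

Lemma dot_eq0 x : dot x x = 0 -> x = 0.
Proof.
by move=> xx; apply/eqP/negbNE/negP => /(dot_gt0 dotE); rewrite xx ltxx.
Qed.

Lemma dot_inj x y : (forall z, dot x z = dot y z) -> x = y.
Proof.
move=> xy; apply/eqP; rewrite -subr_eq0; apply/eqP/dot_eq0.
by rewrite (dotDl dotE) dotNl xy subrr.
Qed.

End Euclidean.

(** Orthogonality to s amounts to fewer linear equations than the dimension
    of U. *)
Lemma exists_unit_orthogonal_in (R : realType) (V : vectType R)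
    (dot : V -> V -> R) (U : {vspace V}) (s : seq V) :
  euclidean dot -> (size s < \dim U)%N ->
  exists x, [/\ x \in U, dot x x = 1 & forall y, y \in s -> dot x y = 0].
Proof.
move=> dotE ss.
pose f (x : V) : 'rV[R]_(size s) := \row_k dot x (nth 0 s k).
have fL : linear f.
  by move=> k x y; apply/rowP => j; rewrite !mxE (dotDl dotE) (dotZl dotE).
pose F : {linear V -> 'rV[R]_(size s)} := HB.pack f
  (GRing.isLinear.Build R V 'rV[R]_(size s) *:%R f fL).
have k0 : (U :&: lker (linfun F))%VS != 0%VS.
  apply: contraTneq ss => k0; rewrite -leqNgt.
  have := limg_ker_dim (linfun F) U; rewrite k0 dimv0 add0n => <-.
  apply: leq_trans (dimvS (subvf _)) _.
  by rewrite dimvf dim_matrix mul1r.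
pose x := vpick (U :&: lker (linfun F))%VS.
have x0 : x != 0 by rewrite vpick0.
have /memv_capP[xU xk] : x \in (U :&: lker (linfun F))%VS by rewrite memv_pick.
have Fx : F x = 0 by rewrite -lfunE; apply/eqP; rewrite -memv_ker.
have xx := dot_gt0 dotE x0.
have sxx : Num.sqrt (dot x x) != 0 by rewrite sqrtr_eq0 -ltNge.
exists ((Num.sqrt (dot x x))^-1 *: x); split; first by rewrite rpredZ.
  rewrite (dotZl dotE) (dotZr dotE) mulrA -invfM -expr2 sqr_sqrtr ?ltW //.
  by rewrite mulVf // gt_eqF.
move=> y /(nthP 0)[k ks <-]; rewrite (dotZl dotE).
have /rowP/(_ (Ordinal ks)) := Fx; rewrite !mxE /= => ->.
by rewrite mulr0.
Qed.

Lemma exists_unit_orthogonal (R : realType) (V : vectType R) (dot : V -> V -> R)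
    (s : seq V) : euclidean dot -> (size s < \dim {:V})%N ->
  exists x, dot x x = 1 /\ forall y, y \in s -> dot x y = 0.
Proof.
move=> dotE /(exists_unit_orthogonal_in dotE)[x [_ xx xs]].
by exists x.
Qed.

Lemma isometry_bij (R : realType) (V W : vectType R) (dV : V -> V -> R)
    (dW : W -> W -> R) (f : 'Hom(V, W)) :
  euclidean dV -> euclidean dW -> \dim {:V} = \dim {:W} ->
  (forall x, dW (f x) (f x) = dV x x) ->
  [/\ injective f, cancel f f^-1%VF & cancel f^-1%VF f].
Proof.
move=> EV EW dVW fI.
have f0 : lker f == 0%VS.
  rewrite -subv0; apply/subvP => x; rewrite memv_ker memv0 => /eqP fx.
  by apply/eqP/(dot_eq0 EV); rewrite -fI fx (dot0l EW).
split; [exact/lker0P | exact: lker0_lfunK |].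
move=> y; apply: limg_lfunVK.
suff -> : limg f = {:W}%VS by rewrite memvf.
apply/eqP; rewrite eqEdim subvf /= limg_dim_eq ?dVW //.
by rewrite (eqP f0) capv0.
Qed.

Lemma isometry_dot (R : realType) (V W : lmodType R) (dV : V -> V -> R)
    (dW : W -> W -> R) (f : {linear V -> W}) :
  euclidean dV -> euclidean dW -> (forall x, dW (f x) (f x) = dV x x) ->
  forall x y, dW (f x) (f y) = dV x y.
Proof.
move=> EV EW fI x y; have := fI (x + y); rewrite linearD.
rewrite !(dotDl EV, dotDl EW) !(dotDr EV, dotDr EW) !fI.
rewrite (dotC EV y x) (dotC EW (f y)); lra.
Qed.

Lemma odot_euclidean (R : realType) : euclidean (@odot R).
Proof.
split=> [x y|x y z|k x y|x x0]; [exact: odotC | exact: odotDl | exact: odotZl |].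
rewrite lt_neqAle eq_sym; apply/andP; split.
  by apply: contra_neq x0 => /odot_eq0.
by rewrite odot.unlock; apply: sumr_ge0 => i _; rewrite -expr2 sqr_ge0.
Qed.

Section OctonionNorm.
Variable R : realType.
Implicit Types x y : octonion R.

Lemma odot0l x : odot 0 x = 0. Proof. exact: dot0l (odot_euclidean R) x. Qed.
Lemma odot0r x : odot x 0 = 0. Proof. exact: dot0r (odot_euclidean R) x. Qed.
Lemma odot_gt0 x : x != 0 -> 0 < odot x x.
Proof. exact: dot_gt0 (odot_euclidean R) x. Qed.

Lemma odot_ge0 x : 0 <= odot x x.
Proof. by have [->|/odot_gt0/ltW//] := eqVneq x 0; rewrite odot0l. Qed.

Lemma odot_isometry (f : {linear octonion R -> octonion R}) :
  (forall x, odot (f x) (f x) = odot x x) ->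
  forall x y, odot (f x) (f y) = odot x y.
Proof. exact/isometry_dot/odot_euclidean/odot_euclidean. Qed.

Lemma dim_octonion : \dim {:octonion R} = 8.
Proof. by rewrite dimvf dim_matrix mul1r. Qed.

Lemma octonion_isometry_bij (f : 'End(octonion R)) :
  (forall x, odot (f x) (f x) = odot x x) ->
  [/\ injective f, cancel f f^-1%VF & cancel f^-1%VF f].
Proof. exact: isometry_bij (odot_euclidean R) (odot_euclidean R) erefl. Qed.

End OctonionNorm.

(** * Hurwitz' theorem in dimension 8 *)

Section Hurwitz.
Variables (R : realType) (V : vectType R) (mul : V -> V -> V).
Variables (dot : V -> V -> R) (e : V).
Local Notation "x ** y" := (mul x y) (at level 40, left associativity).
Hypothesis mulDl : forall x y z, (x + y) ** z = x ** z + y ** z.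
Hypothesis mulDr : forall x y z, z ** (x + y) = z ** x + z ** y.
Hypothesis mulZl : forall (k : R) x y, (k *: x) ** y = k *: (x ** y).
Hypothesis mulZr : forall (k : R) x y, x ** (k *: y) = k *: (x ** y).
Hypothesis mul1e : forall x, e ** x = x.
Hypothesis mule1 : forall x, x ** e = x.
Hypothesis dotE : euclidean dot.
Hypothesis ee : dot e e = 1.
Hypothesis dotMM : forall x y, dot (x ** y) (x ** y) = dot x x * dot y y.

Let mulNl x y : (- x) ** y = - (x ** y).
Proof. by rewrite -scaleN1r mulZl scaleN1r. Qed.
Let mulNr x y : x ** (- y) = - (x ** y).
Proof. by rewrite -scaleN1r mulZr scaleN1r. Qed.
Let DL := dotDl dotE.
Let DR := dotDr dotE.
Let ZL := dotZl dotE.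
Let ZR := dotZr dotE.

Let dotMl x y z : dot (x ** y) (x ** z) = dot x x * dot y z.
Proof.
have := dotMM x (y + z); rewrite mulDr !DL !DR !dotMM.
by rewrite (dotC dotE (x ** z)) (dotC dotE z y); lra.
Qed.

Let dotMr x y z : dot (y ** x) (z ** x) = dot x x * dot y z.
Proof.
have := dotMM (y + z) x; rewrite mulDl !DL !DR !dotMM.
by rewrite (dotC dotE (z ** x)) (dotC dotE z y); lra.
Qed.

(** The composition law polarized in both factors.  The identities below
    follow from it by pairing both sides with an arbitrary vector. *)
Lemma dot_exchange x y z t :
  dot (x ** y) (z ** t) + dot (z ** y) (x ** t) = dot x z * dot y t *+ 2.
Proof.
have := dotMl (x + z) y t; rewrite !mulDl !DL !DR !dotMl (dotC dotE z x).
by rewrite mulr2n; lra.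
Qed.

Definition conj (x : V) : V := (dot x e *+ 2) *: e - x.

Let conjE x y : dot (conj x) y = dot x e * dot e y *+ 2 - dot x y.
Proof. by rewrite /conj DL (dotNl dotE) ZL mulrnAl. Qed.

Let conj_adj x y : dot (conj x) y = dot x (conj y).
Proof.
rewrite [RHS](dotC dotE) !conjE (dotC dotE y x).
by rewrite (dotC dotE x e) (dotC dotE y e) mulrC.
Qed.

Let conjK x : conj (conj x) = x.
Proof.
apply: (dot_inj dotE) => y; rewrite !conjE ee (dotC dotE e y); ring.
Qed.

Lemma dot_mull x y z : dot (x ** y) z = dot y (conj x ** z).
Proof.
have := dot_exchange x y e z; rewrite !mul1e /conj mulDl mulNl mulZl mul1e.
by rewrite DR (dotNr dotE) ZR mulrnAl; lra.
Qed.

Lemma dot_mulr x y z : dot (x ** y) z = dot x (z ** conj y).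
Proof.
have := dot_exchange x y z e; rewrite !mule1 /conj mulDr mulNr mulZr mule1.
rewrite DR (dotNr dotE) ZR (dotC dotE (z ** y)).
have -> : dot x z * dot y e *+ 2 = dot y e *+ 2 * dot x z by ring.
lra.
Qed.

Lemma conj_mull x y : conj x ** (x ** y) = dot x x *: y.
Proof.
by apply: (dot_inj dotE) => z; rewrite dot_mull conjK dotMl ZL.
Qed.

Lemma conj_mulr x y : (y ** x) ** conj x = dot x x *: y.
Proof.
by apply: (dot_inj dotE) => z; rewrite dot_mulr conjK dotMr ZL.
Qed.

Lemma conjM x y : conj (x ** y) = conj y ** conj x.
Proof.
apply: (dot_inj dotE) => z; rewrite conj_adj dot_mull.
by rewrite (dotC dotE) dot_mulr conjK (dotC dotE) dot_mull (dotC dotE).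
Qed.

Let mul_polarl x y z :
  conj x ** (y ** z) + conj y ** (x ** z) = (dot x y *+ 2) *: z.
Proof.
apply: (dot_inj dotE) => t; rewrite DL ZL !(dot_mull (conj _)) !conjK.
by rewrite dot_exchange (dotC dotE y x); ring.
Qed.

Let mul_polarr x y z :
  (z ** y) ** conj x + (z ** x) ** conj y = (dot x y *+ 2) *: z.
Proof.
apply: (dot_inj dotE) => t; rewrite DL ZL !(dot_mulr _ (conj _)) !conjK.
rewrite (dotC dotE (z ** x)) (dotC dotE x y) addrC.
have := dot_exchange t y z x; rewrite (dotC dotE t z) addrC (dotC dotE (z ** y)).
by move=> ->; ring.
Qed.

Let im_conj y : dot y e = 0 -> conj y = - y.
Proof. by move=> y1; rewrite /conj y1 mul0rn scale0r sub0r. Qed.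

Let im_sql y t : dot y e = 0 -> dot y y = 1 -> y ** (y ** t) = - t.
Proof.
move=> y1 yy; have := conj_mull y t; rewrite (im_conj y1) yy scale1r mulNl.
by move=> /(congr1 -%R); rewrite opprK.
Qed.

Let im_sqr y t : dot y e = 0 -> dot y y = 1 -> (t ** y) ** y = - t.
Proof.
move=> y1 yy; have := conj_mulr y t; rewrite (im_conj y1) yy scale1r mulNr.
by move=> /(congr1 -%R); rewrite opprK.
Qed.

Let dot_im_conj y x : dot y e = 0 -> dot y (conj x) = - dot y x.
Proof. by move=> y1; rewrite -conj_adj (im_conj y1) (dotNl dotE). Qed.

Let im_swap y x : dot y e = 0 -> dot y x = 0 -> y ** x = conj x ** y.
Proof.
move=> y1 yx; have := mul_polarl (conj y) x e.
rewrite conjK !mule1 (im_conj y1) (dotNl dotE) yx oppr0 mul0rn scale0r mulNr.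
by move/eqP; rewrite subr_eq0 => /eqP.
Qed.

Let mul_hku y h k : dot y e = 0 ->
  dot y h = 0 -> dot y k = 0 -> dot y (k ** h) = 0 ->
  h ** (k ** y) = (k ** h) ** y.
Proof.
move=> y1 yh yk ykh; have := mul_polarl (conj h) y (conj k).
rewrite conjK (dotC dotE) dot_im_conj // yh oppr0 mul0rn scale0r.
rewrite -conjM (im_conj y1) mulNl [y ** conj k]im_swap ?dot_im_conj ?yk ?oppr0 //.
rewrite conjK [y ** conj _]im_swap ?dot_im_conj ?ykh ?oppr0 // conjK => /eqP.
by rewrite subr_eq0 => /eqP.
Qed.

Let mul_kuh y h k : dot y e = 0 -> dot y h = 0 ->
  (k ** y) ** h = (k ** conj h) ** y.
Proof.
move=> y1 yh; have := mul_polarr (conj h) y k.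
rewrite conjK (dotC dotE) dot_im_conj // yh oppr0 mul0rn scale0r (im_conj y1) mulNr.
by move=> /eqP; rewrite subr_eq0 => /eqP.
Qed.

(** Of the three rules for products with multiples of y this is the one that
    does not reduce to alternativity: the exchange law moves y past k. *)
Let mul_kuku y k k' : dot y e = 0 -> dot y y = 1 ->
  dot y k = 0 -> dot y (conj k ** k') = 0 ->
  (k ** y) ** (k' ** y) = - (conj k' ** k).
Proof.
move=> y1 yy yk ykk; apply: (dot_inj dotE) => t.
have ky1 : dot (k ** y) e = 0.
  by rewrite dot_mulr mul1e (im_conj y1) (dotNr dotE) (dotC dotE k) yk oppr0.
rewrite dot_mull (im_conj ky1) mulNl (dotNr dotE) (dotNl dotE).
rewrite (dot_mull (conj k')) conjK.
have := dot_exchange k' y (k ** y) t.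
have -> : dot k' (k ** y) = 0 by rewrite (dotC dotE) dot_mull.
rewrite mul0r mul0rn im_sqr // (dotNl dotE) => /eqP.
by rewrite subr_eq0 => /eqP ->.
Qed.
Section Triple.
Variables u v z : V.
Hypothesis uu : dot u u = 1.
Hypothesis vv : dot v v = 1.
Hypothesis zz : dot z z = 1.
Hypothesis uv : dot u v = 0.
Hypothesis uz : dot u z = 0.
Hypothesis vz : dot v z = 0.
Hypothesis u1 : dot u e = 0.
Hypothesis v1 : dot v e = 0.
Hypothesis z1 : dot z e = 0.
Hypothesis zuv : dot z (u ** v) = 0.
Local Notation w := (v ** z).

Let uw : dot u w = 0.
Proof.
have e1 : dot (u ** v) z = 0 by rewrite (dotC dotE).
move: e1; rewrite dot_mull (im_conj u1) mulNl (dotNr dotE) => /eqP.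
rewrite oppr_eq0 => /eqP e1.
by rewrite (dotC dotE) dot_mulr (im_conj z1) mulNr (dotNr dotE) e1 oppr0.
Qed.
Let w1 : dot w e = 0.
Proof. by rewrite dot_mulr mul1e (im_conj z1) (dotNr dotE) vz oppr0. Qed.
Let wv : dot w v = 0.
Proof. by rewrite dot_mull -{2}[v]mule1 conj_mull vv scale1r z1. Qed.
Let wz : dot w z = 0.
Proof. by rewrite dot_mulr -{1}[z]mul1e conj_mulr zz scale1r v1. Qed.
Let ww : dot w w = 1.
Proof. by rewrite dotMM vv zz mulr1. Qed.

Definition quat (a b d f : R) : V := a *: e + b *: v + d *: z + f *: w.

Lemma quatD a b d f a' b' d' f' :
  quat a b d f + quat a' b' d' f' = quat (a + a') (b + b') (d + d') (f + f').
Proof.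
rewrite /quat !scalerDl.
by rewrite !addrA [LHS](ACl (1*5*2*6*3*7*4*8))%AC.
Qed.

Lemma quatZ k a b d f : k *: quat a b d f = quat (k * a) (k * b) (k * d) (k * f).
Proof. by rewrite /quat !scalerDr !scalerA. Qed.

Lemma quatN a b d f : - quat a b d f = quat (- a) (- b) (- d) (- f).
Proof. by rewrite -scaleN1r quatZ !mulN1r. Qed.

Let vvE : v ** v = - e. Proof. by rewrite -{2}[v]mule1 im_sql. Qed.
Let zzE : z ** z = - e. Proof. by rewrite -{2}[z]mule1 im_sql. Qed.
Let wwE : w ** w = - e. Proof. by rewrite -{2}[w]mule1 im_sql. Qed.
Let vwE : v ** w = - z. Proof. by rewrite im_sql. Qed.
Let wzE : w ** z = - v. Proof. by rewrite im_sqr. Qed.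
Let zvE : z ** v = - w.
Proof.
have zv : dot z v = 0 by rewrite (dotC dotE).
by rewrite (im_swap z1 zv) (im_conj v1) mulNl.
Qed.
Let zwE : z ** w = v.
Proof. by rewrite -[w]opprK -zvE mulNr im_sql // opprK. Qed.
Let wvE : w ** v = z.
Proof. by rewrite -[w]opprK -zvE mulNl im_sqr // opprK. Qed.

Let quatM a b d f a' b' d' f' : quat a b d f ** quat a' b' d' f' =
  quat (a * a' - b * b' - d * d' - f * f') (a * b' + b * a' + d * f' - f * d')
       (a * d' - b * f' + d * a' + f * b') (a * f' + b * d' - d * b' + f * a').
Proof.
have q1 : e ** quat a' b' d' f' = quat a' b' d' f' by rewrite mul1e.
have qN x : - x = (-1) *: x by rewrite scaleN1r.
have qv : v ** quat a' b' d' f' = quat (- b') a' (- f') d'.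
  rewrite /quat !mulDr !mulZr mule1 vvE vwE !scalerN !scaleNr.
  by rewrite [LHS](ACl (2*1*4*3))%AC.
have qz : z ** quat a' b' d' f' = quat (- d') f' a' (- b').
  rewrite /quat !mulDr !mulZr mule1 zvE zzE zwE !scalerN !scaleNr.
  by rewrite [LHS](ACl (3*4*1*2))%AC.
have qw : w ** quat a' b' d' f' = quat (- f') (- d') b' a'.
  rewrite /quat !mulDr !mulZr mule1 wvE wzE wwE !scalerN !scaleNr.
  by rewrite [LHS](ACl (4*3*2*1))%AC.
rewrite {1}/quat !mulDl !mulZl q1 qv qz qw !quatZ !quatD; congr quat; ring.
Qed.

Let quat_conj a b d f : conj (quat a b d f) = quat a (- b) (- d) (- f).
Proof.
rewrite /conj; have -> : dot (quat a b d f) e = a.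
  by rewrite /quat !DL !ZL ee v1 z1 w1 !mulr0 mulr1 !addr0.
have -> : (a *+ 2) *: e = quat (a *+ 2) 0 0 0 by rewrite /quat !scale0r !addr0.
by rewrite quatN quatD mulr2n addrK !add0r.
Qed.

Let dot_uq a b d f : dot u (quat a b d f) = 0.
Proof. by rewrite /quat !DR !ZR u1 uv uz uw !mulr0 !addr0. Qed.

Let dot_q a b d f a' b' d' f' :
  dot (quat a b d f) (quat a' b' d' f') = a * a' + b * b' + d * d' + f * f'.
Proof.
rewrite /quat !DL !DR !ZL !ZR.
rewrite !(dotC dotE e) (dotC dotE z v) (dotC dotE v w) (dotC dotE z w).
by rewrite ee vv zz ww v1 z1 w1 wv wz vz; ring.
Qed.

Let dbl (x : octonion R) : V :=
  let r k (lt_k8 : (k < 8)%N) := x 0 (Ordinal lt_k8) in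
  quat (r 0 isT) (r 1 isT) (r 2 isT) (r 3 isT) +
  quat (r 4 isT) (r 5 isT) (r 6 isT) (r 7 isT) ** u.

Let dbl8 a b d f a' b' d' f' : dbl (oct8 a b d f a' b' d' f') =
  quat a b d f + quat a' b' d' f' ** u.
Proof. by rewrite /dbl !mxE. Qed.

Let dblM x y : dbl (omul x y) = dbl x ** dbl y.
Proof.
elim/oct8_ind: x => a1 a2 a3 a4 a5 a6 a7 a8.
elim/oct8_ind: y => b1 b2 b3 b4 b5 b6 b7 b8.
have M p q r t : (p + q ** u) ** (r + t ** u) =
    p ** r + p ** (t ** u) + ((q ** u) ** r + (q ** u) ** (t ** u)).
  by rewrite mulDl !mulDr.
rewrite omul8 /= !dbl8 M (mul_hku (h := quat a1 a2 a3 a4)) ?quatM ?dot_uq //.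
rewrite (mul_kuh (h := quat b1 b2 b3 b4)) ?dot_uq // quat_conj quatM.
rewrite mul_kuku ?quat_conj ?quatM ?dot_uq // [in RHS]addrA.
rewrite [RHS](ACl ((1*4)*(2*3)))%AC /= -mulDl quatN !quatD.
by congr (quat _ _ _ _ + quat _ _ _ _ ** _); ring.
Qed.

Let dbl_linear : linear dbl.
Proof.
move=> k x y.
elim/oct8_ind: x => a1 a2 a3 a4 a5 a6 a7 a8.
elim/oct8_ind: y => b1 b2 b3 b4 b5 b6 b7 b8.
rewrite oct8Z oct8D !dbl8 scalerDr -mulZl !quatZ addrACA -mulDl.
by rewrite !quatD.
Qed.

Let dbl_dot x : dot (dbl x) (dbl x) = odot x x.
Proof.
elim/oct8_ind: x => a1 a2 a3 a4 a5 a6 a7 a8; rewrite dbl8 odot8.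
have ort : dot (quat a1 a2 a3 a4) (quat a5 a6 a7 a8 ** u) = 0.
  by rewrite (dotC dotE) dot_mull quat_conj quatM dot_uq.
have pyth p q : dot p q = 0 -> dot (p + q) (p + q) = dot p p + dot q q.
  by move=> pq; rewrite DL !DR (dotC dotE q p) pq addr0 add0r.
by rewrite pyth // dotMM uu !dot_q; ring.
Qed.

(** The rules for products of h and k ** u are those that define the doubling
    of the quaternions spanned by e, v, z, v ** z, so the coordinates of O carry
    over. *)
Lemma octonion_embedding : exists F : 'Hom(octonion R, V),
  [/\ forall x y, F (omul x y) = F x ** F y,
      forall x, dot (F x) (F x) = odot x x
    & [/\ F (oone R) = e, F (oct8 0 0 0 0 1 0 0 0) = u,
      F (oct8 0 1 0 0 0 0 0 0) = v & F (oct8 0 0 1 0 0 0 0 0) = z]].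
Proof.
pose D : {linear octonion R -> V} := HB.pack dbl
  (GRing.isLinear.Build R (octonion R) V *:%R dbl dbl_linear).
have q0 : quat 0 0 0 0 = 0 by rewrite /quat !scale0r !addr0.
have u0 : 0 ** u = 0 by rewrite -(scale0r 0) mulZl !scale0r.
exists (linfun D); split=> [x y|x|]; rewrite !lfunE /=.
- exact: dblM.
- exact: dbl_dot.
rewrite oone8 !dbl8 q0 u0 addr0 add0r /quat !scale0r !scale1r !addr0 !add0r.
by rewrite mul1e.
Qed.

End Triple.
End Hurwitz.

(** * Composition division algebras are isotopes of the octonions *)

Definition std_u (R : realType) : octonion R := oct8 0 0 0 0 1 0 0 0.
Definition std_v (R : realType) : octonion R := oct8 0 1 0 0 0 0 0 0.
Definition std_z (R : realType) : octonion R := oct8 0 0 1 0 0 0 0 0.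

Section Kaplansky.
Variable R : realType.
Implicit Types A : algebra R.

Lemma isometry_octonion_bij (V : vectType R) (dot : V -> V -> R)
    (T : 'Hom(octonion R, V)) :
  euclidean dot -> \dim {:V} = 8%N -> (forall x, dot (T x) (T x) = odot x x) ->
  [/\ injective T, cancel T T^-1%VF & cancel T^-1%VF T].
Proof.
move=> dotE V8; apply: isometry_bij; rewrite ?dim_octonion //.
exact: odot_euclidean.
Qed.

(** Reduces statements about an arbitrary Cayley triple to computations in
    coordinates. *)
Lemma std_automorphism (c : cayley_triple R) : exists F : G2 R,
  [/\ forall x, odot (F x) (F x) = odot x x,
      F (std_u R) = cu c, F (std_v R) = cv c & F (std_z R) = cz c].
Proof.
have [[[uu vv zz] [uv uz vz] [u1 v1 z1] zuv]] := cayleyP c.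
have [F [FM FI [F1 Fu Fv Fz]]] := octonion_embedding (@omulDl R)
  (fun x y z => omulDr z x y) (@omulZl R) (@omulZr R) (@omul1l R)
  (@omul1r R) (odot_euclidean R)
  (odot11 R) (@odotMM R) uu vv zz uv uz vz u1 v1 z1 zuv.
have [_ FK KF] := octonion_isometry_bij FI.
have FP : `[< is_oaut F >].
  by apply/asboolP; split=> //; exists F^-1%VF.
by exists (MkG2 FP).
Qed.

Definition composition_dot A (dot : A -> A -> R) : Prop :=
  euclidean dot /\
  forall x y, dot (amul A x y) (amul A x y) = dot x x * dot y y.

(** If q x = 0 with x nonzero then q vanishes identically, since left
    multiplication by x is onto.  If q x < 0 then q changes sign between x and
    its square, hence has a zero on the line through them.  So q is positive
    definite. *)
Lemma composition_dotP A : in_A8 A -> exists dot, @composition_dot A dot.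
Proof.
move=> [A8 [[a0 a00] div] [q [[qZ pD pZ] qnd qM]]].
have q0 : q 0 = 0 by rewrite -(scale0r 0) qZ expr0n mul0r.
have q00 x : q x = 0 -> x = 0.
  move=> qx; apply/eqP/negbNE/negP => x0; move/eqP: a00; apply.
  apply: qnd => y.
  have [_ [g gK Kg]] := div _ x0 => {gK}.
  have zero y' : q y' = 0.
    have [[g' _ Kg'] _] := div _ x0.
    by rewrite -(Kg' y') lfunE /= qM qx mul0r.
  by rewrite /polar !zero !subr0.
have qD x y (t : R) : q (x + t *: y) = q x + t * polar q x y + t ^+ 2 * q y.
  have := pZ t y x; rewrite /polar qZ ![_ + x]addrC; lra.
have qsq x : q (amul A x x) = q x ^+ 2 by rewrite qM expr2.
have qgt0 x : x != 0 -> 0 < q x.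
  move=> x0; rewrite ltNge; apply/negP => qx.
  have {qx} qx : q x < 0.
    by rewrite lt_neqAle qx andbT; apply: contra_neq x0 => /q00.
  set y := amul A x x.
  have qy : 0 < q y by rewrite qsq exprn_even_gt0 //= lt_eqF.
  set P := polar q x y; pose D := P ^+ 2 - 4 * q x * q y.
  have D0 : 0 <= D.
    by rewrite /D subr_ge0; apply: le_trans (sqr_ge0 P); nra.
  pose t := (Num.sqrt D - P) / (2 * q y).
  have /q00 xy : q (x + t *: y) = 0.
    have sD := sqr_sqrtr D0.
    rewrite qD -/P.
    have -> : q x = (P ^+ 2 - Num.sqrt D ^+ 2) / (4 * q y).
      rewrite sD /D; field; by rewrite gt_eqF.
    rewrite /t; field; by rewrite gt_eqF.
  have : q x = t ^+ 2 * q y.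
    have -> : x = - t *: y by apply/eqP; rewrite scaleNr -addr_eq0 xy.
    by rewrite qZ sqrrN.
  by move=> e; move: qx; rewrite e ltNge mulr_ge0 ?sqr_ge0 ?ltW.
exists (fun x y => polar q x y / 2).
have pC x y : polar q x y = polar q y x.
  by rewrite /polar [y + x]addrC; lra.
have pxx x : polar q x x / 2 = q x.
  by rewrite /polar -mulr2n -scaler_nat qZ; field.
split; last by move=> x y; rewrite !pxx qM.
split=> [x y|x y z|k x y|x x0]; first by rewrite pC.
- by rewrite pD mulrDl.
- by rewrite pZ mulrA.
- by rewrite pxx qgt0.
Qed.

Lemma lmultE A (a x : A) : lmult a x = amul A a x.
Proof. by rewrite /lmult lfunE. Qed.

Lemma rmultE A (a x : A) : rmult a x = amul A x a.
Proof.
have l : linear (fun y : A => amul A y a).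
  by move=> k y z; rewrite linearDl linearZl_LR.
pose f : {linear A -> A} := HB.pack (fun y : A => amul A y a)
  (GRing.isLinear.Build R A A *:%R (fun y : A => amul A y a) l).
by rewrite -[RHS]/(f x) -[RHS]lfunE.
Qed.

(** Dividing out the right multiplication by e1 and the left multiplication by
    e2 leaves a multiplicative norm and creates the unit e2 e1; Hurwitz' theorem
    applies to the new product. *)
Lemma kaplansky A dot (c : cayley_triple R) (e1 e2 u' : A) :
  composition_dot dot -> \dim {:A} = 8%N ->
  dot e1 e1 = 1 -> dot e2 e2 = 1 -> dot u' u' = 1 -> dot u' (amul A e2 e1) = 0 ->
  exists T : 'Hom(octonion R, A),
  [/\ forall x, dot (T x) (T x) = odot x x,
      T (oone R) = amul A e2 e1, T (cu c) = u'
    & forall x y a b, T x = amul A a e1 -> T y = amul A e2 b ->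
        T (omul x y) = amul A a b].
Proof.
move=> [dotE dM] A8 e11 e22 uu' u1'.
have [|_ rK Kr] := isometry_bij (f := rmult e1) dotE dotE erefl.
  by move=> x; rewrite rmultE /= dM e11 mulr1.
have [|_ lK Kl] := isometry_bij (f := lmult e2) dotE dotE erefl.
  by move=> x; rewrite lmultE /= dM e22 mul1r.
set r' := (rmult e1)^-1%VF in rK Kr; set l' := (lmult e2)^-1%VF in lK Kl.
have Kr' x : amul A (r' x) e1 = x by rewrite -[RHS]Kr rmultE.
have Kl' x : amul A e2 (l' x) = x by rewrite -[RHS]Kl lmultE.
have rK' x : r' (amul A x e1) = x by rewrite -[RHS]rK rmultE.
have lK' x : l' (amul A e2 x) = x by rewrite -[RHS]lK lmultE.
pose mul x y := amul A (r' x) (l' y).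
have mulDl x y z : mul (x + y) z = mul x z + mul y z.
  by rewrite /mul linearD linearDl.
have mulDr x y z : mul z (x + y) = mul z x + mul z y.
  by rewrite /mul linearD linearDr.
have mulZl k x y : mul (k *: x) y = k *: mul x y.
  by rewrite /mul linearZ linearZl_LR.
have mulZr k x y : mul x (k *: y) = k *: mul x y.
  by rewrite /mul linearZ linearZr_LR.
set e := amul A e2 e1 in u1' *.
have mul1e x : mul e x = x by rewrite /mul /e rK' Kl'.
have mule1 x : mul x e = x by rewrite /mul /e lK' Kr'.
have rI x : dot (r' x) (r' x) = dot x x by rewrite -{3 4}(Kr' x) dM e11 mulr1.
have lI x : dot (l' x) (l' x) = dot x x by rewrite -{3 4}(Kl' x) dM e22 mul1r.
have mulM x y : dot (mul x y) (mul x y) = dot x x * dot y y.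
  by rewrite dM rI lI.
have ee : dot e e = 1 by rewrite dM e11 e22 mulr1.
have [v [vv vP]] : exists v, dot v v = 1 /\ forall y, y \in [:: e; u'] -> dot v y = 0.
  by apply: exists_unit_orthogonal; rewrite ?A8.
have [z [zz zP]] : exists z, dot z z = 1 /\
    forall y, y \in [:: e; u'; v; mul u' v] -> dot z y = 0.
  by apply: exists_unit_orthogonal; rewrite ?A8.
have uv : dot u' v = 0 by rewrite (dotC dotE) vP ?inE ?eqxx ?orbT.
have uz : dot u' z = 0 by rewrite (dotC dotE) zP ?inE ?eqxx ?orbT.
have vz : dot v z = 0 by rewrite (dotC dotE) zP ?inE ?eqxx ?orbT.
have v1 : dot v e = 0 by rewrite vP ?inE ?eqxx.
have z1 : dot z e = 0 by rewrite zP ?inE ?eqxx.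
have zuv : dot z (mul u' v) = 0 by rewrite zP ?inE ?eqxx ?orbT.
have [F [FM FI [F1 Fu _ _]]] := octonion_embedding mulDl mulDr mulZl mulZr mul1e
  mule1 dotE ee mulM uu' vv zz uv uz vz u1' v1 z1 zuv.
have [G [GI Gu _ _]] := std_automorphism c.
have [_ GK KG] := isometry_octonion_bij (odot_euclidean R) (dim_octonion R) GI.
exists (F \o (g2val G)^-1)%VF; split=> [x|||x y a b xa yb].
- by rewrite comp_lfunE FI -GI KG.
- by rewrite comp_lfunE -(g2_fix1 G) GK F1.
- by rewrite comp_lfunE -Gu GK Fu.
rewrite comp_lfunE -[x]KG -[y]KG -g2M GK FM.
by rewrite -!comp_lfunE xa yb /mul rK' lK'.
Qed.

End Kaplansky.

(** * Derivations are skew *)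

Section Skew.
Variable R : realType.
Local Notation "x ** y" := (omul x y) (at level 40, left associativity).
Local Notation "''1'" := (oone R).

Lemma odot_mull (x y z : octonion R) : odot (x ** y) (x ** z) = odot x x * odot y z.
Proof. by rewrite odotMl omulKl odotZr. Qed.

Lemma odot_mulr (x y z : octonion R) : odot (y ** x) (z ** x) = odot x x * odot y z.
Proof. by rewrite odotMr omulKr odotZr. Qed.

Lemma omul_sq (x : octonion R) :
  x ** x = (odot x '1 *+ 2) *: x - odot x x *: '1.
Proof.
have := omulKl x '1; rewrite omul1r => <-.
by rewrite oconjE omulDl omulNl omulZl omul1l opprB addrC subrK.
Qed.

Section Isotope.
Variables f g : {linear octonion R -> octonion R}.
Hypothesis fI : forall x, odot (f x) (f x) = odot x x.
Hypothesis gI : forall x, odot (g x) (g x) = odot x x.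

(** From [d, L_x] = L_{dx} and the fact that L_x is a similarity with ratio
    |x|, the operator L_x^T L_{dx} is traceless; its trace is 8 <x, d x>. *)
Lemma isotope_derivation_skew (d : 'End(isotope f g)) :
  derivation d -> forall x : octonion R, odot x (d x) = 0.
Proof.
move=> dD x.
pose L (a : octonion R) : {linear octonion R -> octonion R} := amul (isotope f g) a.
have LE a y : L a y = f a ** g y by [].
pose M a : 'M[R]_8 := lin1_mx (L a).
pose D : 'M[R]_8 := lin1_mx (d : octonion R -> octonion R).
have rM a k : row k (M a) = L a (delta_mx 0 k) by rewrite rowE mul_rV_lin1.
have MM a b k : (M a *m (M b)^T) k k = odot a b.
  rewrite mxE; have <- : odot (row k (M a)) (row k (M b)) = odot a b.
    rewrite !rM !LE odot_mulr gI (odot_isometry fI).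
    have -> : odot (delta_mx 0 k : octonion R) (delta_mx 0 k) = 1.
      rewrite odot.unlock (bigD1 k) //= big1 => [|j jk]; rewrite !mxE ?eqxx /=.
        by rewrite mulr1 addr0.
      by rewrite (negPf jk) mulr0.
    by rewrite mul1r.
  by rewrite odot.unlock; apply: eq_bigr => j _; rewrite !mxE.
have trM a b : \tr (M a *m (M b)^T) = odot a b *+ 8.
  rewrite /mxtrace (eq_bigr (fun=> odot a b)) => [|k _]; last exact: MM.
  by rewrite sumr_const card_ord.
have MO : M x *m (M x)^T = (odot x x)%:M.
  apply/matrixP => i j; rewrite mxE [RHS]mxE.
  have <- : odot (row i (M x)) (row j (M x)) = odot x x *+ (i == j).
    rewrite !rM !LE odot_mull fI (odot_isometry gI) -mulr_natr; congr (_ * _).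
    rewrite odot.unlock (bigD1 i) //= big1 => [|k ki]; rewrite !mxE ?eqxx /=.
      by rewrite mul1r addr0 eq_sym.
    by rewrite (negPf ki) mul0r.
  by rewrite odot.unlock; apply: eq_bigr => k _; rewrite !mxE.
(* Matrices act on rows, so products appear in reverse order. *)
have MD : M x *m D = M (d x) + D *m M x.
  apply/row_matrixP => k; rewrite !rowE mulmxDr !mulmxA !mul_rV_lin1.
  exact: (dD x).
have [->|x0] := eqVneq x 0; first by rewrite odot0l.
have xx : odot x x != 0 by rewrite gt_eqF // odot_gt0.
have OM : (M x)^T *m M x = (odot x x)%:M.
  have : ((odot x x)^-1 *: M x) *m (M x)^T = 1%:M.
    by rewrite -scalemxAl MO scale_scalar_mx mulVf.
  move/mulmx1C; rewrite -scalemxAr => /(congr1 (fun A => odot x x *: A)).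
  by rewrite scalerA divff // scale1r scalemx1.
have : \tr (M (d x) *m (M x)^T) = 0.
  have -> : M (d x) = M x *m D - D *m M x by rewrite MD addrK.
  rewrite mulmxBl raddfB /= -mulmxA mxtrace_mulC -!mulmxA OM MO.
  by rewrite subrr.
by rewrite trM => /eqP; rewrite mulrn_eq0 odotC => /eqP.
Qed.
End Isotope.

(** Undoing the division: A is the isotope of O by the two multiplications
    that were divided out. *)
Lemma kaplansky_isotope (A : algebra R) dot (c : cayley_triple R) (e1 e2 u' : A) :
  composition_dot dot -> \dim {:A} = 8%N ->
  dot e1 e1 = 1 -> dot e2 e2 = 1 -> dot u' u' = 1 -> dot u' (amul A e2 e1) = 0 ->
  exists (T : 'Hom(octonion R, A)) (f g : 'End(octonion R)),
  [/\ forall x, dot (T x) (T x) = odot x x,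
      T '1 = amul A e2 e1 /\ T (cu c) = u',
      forall x, odot (f x) (f x) = odot x x /\ odot (g x) (g x) = odot x x,
      forall x, T (f x) = amul A (T x) e1 /\ T (g x) = amul A e2 (T x)
    & forall x y, T (f x ** g y) = amul A (T x) (T y)].
Proof.
move=> Ad A8 e11 e22 uu' u1'; have [dotE dM] := Ad.
have [T [TI T1 Tu TM]] := kaplansky c Ad A8 e11 e22 uu' u1'.
have [_ TK KT] := isometry_octonion_bij dotE A8 TI.
exists T, (T^-1 \o (rmult e1 \o T))%VF, (T^-1 \o (lmult e2 \o T))%VF.
have fE x : T ((T^-1 \o (rmult e1 \o T))%VF x) = amul A (T x) e1.
  by rewrite !comp_lfunE KT rmultE.
have gE x : T ((T^-1 \o (lmult e2 \o T))%VF x) = amul A e2 (T x).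
  by rewrite !comp_lfunE KT lmultE.
split=> // [x|x y]; last by apply: TM; rewrite ?fE ?gE.
by rewrite -!TI fE gE !dM TI e11 e22 mulr1 mul1r.
Qed.

Lemma derivation_skew (A : algebra R) dot (c : cayley_triple R) (d : 'End(A)) :
  @composition_dot R A dot -> \dim {:A} = 8%N -> derivation d ->
  forall x, dot x (d x) = 0.
Proof.
move=> Ad A8 dD; have [dotE dM] := Ad.
have [e [ee _]] : exists e, dot e e = 1 /\ forall y, y \in [::] -> dot e y = 0.
  by apply: exists_unit_orthogonal; rewrite ?A8.
have [u' [uu uP]] : exists u', dot u' u' = 1 /\
    forall y, y \in [:: amul A e e] -> dot u' y = 0.
  by apply: exists_unit_orthogonal; rewrite ?A8.
have [T [f [g [TI _ fgI _ TM]]]] :=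
  kaplansky_isotope c Ad A8 ee ee uu (uP _ (mem_head _ _)).
have [_ TK KT] := isometry_octonion_bij dotE A8 TI.
pose d' : 'End(isotope f g) := (T^-1 \o (d \o T))%VF.
have d'E x : T (d' x) = d (T x) by rewrite !comp_lfunE KT.
have d'D : derivation d'.
  move=> x y; apply: (can_inj TK); rewrite linearD d'E.
  by rewrite /= !TM dD !d'E.
have fI y : odot (f y) (f y) = odot y y by have [] := fgI y.
have gI y : odot (g y) (g y) = odot y y by have [] := fgI y.
move=> x; rewrite -(KT x) -d'E (isometry_dot (odot_euclidean R) dotE TI).
exact: (isotope_derivation_skew fI gI d'D).
Qed.

End Skew.

(** * The plane C and its orthogonal complement *)

Section Plane.
Variables (R : realType) (c : cayley_triple R).
Local Notation "x ** y" := (omul x y) (at level 40, left associativity).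
Local Notation "''1'" := (oone R).
Local Notation u := (cu c).
Local Notation C := (plane_C c).

Definition perp (x : octonion R) : Prop := odot x '1 = 0 /\ odot x u = 0.

Lemma planeP x : reflect (exists a b, x = a *: '1 + b *: u) (x \in C).
Proof.
apply: (iffP memv_addP) => [[_ /vlineP[a ->] [_ /vlineP[b ->] ->]]|[a [b ->]]].
  by exists a, b.
exists (a *: '1); rewrite ?memvZ ?memv_line //.
  by exists (b *: u); rewrite ?memvZ ?memv_line.
Qed.

Lemma plane1 : '1 \in C.
Proof. by apply/planeP; exists 1, 0; rewrite scale0r scale1r addr0. Qed.
Lemma plane_u : u \in C.
Proof. by apply/planeP; exists 0, 1; rewrite scale0r scale1r add0r. Qed.

Lemma uuE : u ** u = - '1.
Proof. by rewrite -{2}[u]omul1r im_sql ?u_1 ?u_unit. Qed.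

Lemma plane_conj x : x \in C -> oconj x \in C.
Proof.
by move=> xC; rewrite oconjE rpredB // rpredZ ?plane1.
Qed.

Lemma planeM x y : x \in C -> y \in C -> x ** y \in C.
Proof.
move=> /planeP[a [b ->]] /planeP[a' [b' ->]].
rewrite !omulDl !omulDr !omulZl !omulZr !omul1l !omul1r uuE.
by rewrite !rpredD ?rpredZ ?rpredN ?plane1 ?plane_u.
Qed.

Lemma planeMC x y : x \in C -> y \in C -> x ** y = y ** x.
Proof.
move=> /planeP[a [b ->]] /planeP[a' [b' ->]].
rewrite !(omulDl, omulDr, omulZl, omulZr, omul1l, omul1r) !scalerA !addrA.
by rewrite [RHS](ACl (1*3*2*4))%AC /= ![a' * _]mulrC ![b' * _]mulrC.
Qed.

Lemma ounit_neq0 (x : octonion R) : odot x x = 1 -> x != 0.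
Proof.
apply: contra_eq_neq => ->; rewrite odot0l eq_sym.
exact: oner_neq0.
Qed.

Lemma dim_plane : \dim C = 2.
Proof.
have u0 := ounit_neq0 (u_unit c); have o0 := ounit_neq0 (odot11 R).
rewrite dimv_disjoint_sum ?dim_vline ?u0 ?o0 //.
apply/eqP; rewrite -subv0; apply/subvP => x.
rewrite memv_cap => /andP[/vlineP[a ->] /vlineP[b e]].
have := congr1 (odot u) e; rewrite !odotZr u_1 u_unit mulr0 mulr1 e => <-.
by rewrite scale0r mem0v.
Qed.

Lemma perpD x y : perp x -> perp y -> perp (x + y).
Proof. by case=> x1 xu [y1 yu]; split; rewrite odotDl ?x1 ?xu ?y1 ?yu addr0. Qed.
Lemma perpZ k x : perp x -> perp (k *: x).
Proof. by case=> x1 xu; split; rewrite odotZl ?x1 ?xu mulr0. Qed.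
Lemma perpN x : perp x -> perp (- x).
Proof. by rewrite -scaleN1r; apply: perpZ. Qed.
Lemma perpB x y : perp x -> perp y -> perp (x - y).
Proof. by move=> px py; apply/perpD/perpN. Qed.

Lemma perp_plane x y : perp x -> y \in C -> odot x y = 0.
Proof.
move=> [x1 xu] /planeP[a [b ->]].
by rewrite odotDr !odotZr x1 xu !mulr0 addr0.
Qed.

Lemma perpP x : (forall y, y \in C -> odot x y = 0) -> perp x.
Proof. by move=> xC; split; apply: xC; rewrite ?plane1 ?plane_u. Qed.

Lemma plane_perp0 x : x \in C -> perp x -> x = 0.
Proof.
move=> xC xp; apply: odot_eq0.
exact: perp_plane.
Qed.

Lemma proj_C_plane x : proj_C c x \in C.
Proof. by apply/planeP; exists (odot x '1), (odot x u). Qed.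

Lemma proj_C_perp x : perp (x - proj_C c x).
Proof.
by split; rewrite /proj_C odotDl odotNl odotDl !odotZl ?[odot '1 u]odotC
  ?odot11 ?u_1 ?u_unit; ring.
Qed.

Lemma plane_decomp x : exists a b, [/\ a \in C, perp b & x = a + b].
Proof.
exists (proj_C c x), (x - proj_C c x); split; first exact: proj_C_plane.
  exact: proj_C_perp.
by rewrite addrC subrK.
Qed.

Lemma plane_perp_unique a b a' b' : a \in C -> a' \in C -> perp b -> perp b' ->
  a + b = a' + b' -> a = a' /\ b = b'.
Proof.
move=> aC a'C pb pb' /eqP; rewrite -subr_eq0 opprD addrACA => /eqP e.
have eC : a - a' = b' - b by apply/eqP; rewrite -subr_eq0 opprB e.
have : a - a' = 0.
  by apply: plane_perp0; [rewrite rpredB | rewrite eC; apply: perpB].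
move=> z; split; apply/eqP; first by rewrite -subr_eq0 z.
by rewrite eq_sym -subr_eq0 -eC z.
Qed.

Lemma pythagoras a b : a \in C -> perp b ->
  odot (a + b) (a + b) = odot a a + odot b b.
Proof.
move=> aC pb; rewrite odotDl !odotDr [odot a b]odotC (perp_plane pb aC).
by rewrite addr0 add0r.
Qed.

Lemma perp_conj w : perp w -> oconj w = - w.
Proof. by case=> w1 _; rewrite oconjE w1 mul0rn scale0r sub0r. Qed.

Lemma perp_mulr w a : perp w -> a \in C -> w ** a = oconj a ** w.
Proof. by move=> pw aC; rewrite im_swap ?(perp_plane pw aC) //; case: pw. Qed.

Lemma perpM w a : a \in C -> perp w -> perp (a ** w).
Proof.
move=> aC pw; apply: perpP => y yC.
by rewrite odotMl (perp_plane pw) // planeM ?plane_conj.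
Qed.

Lemma perp_mulA a b w : a \in C -> b \in C -> a ** (b ** w) = (a ** b) ** w.
Proof.
move=> /planeP[x [y ->]] /planeP[x' [y' ->]].
rewrite !(omulDl, omulDr, omulZl, omulZr, omul1l, omul1r) uuE !omulNl.
by rewrite im_sql ?u_1 ?u_unit // ?omul1l scalerDr !scalerA ![_ * y]mulrC.
Qed.

Lemma perp_sq w : perp w -> w ** w = - (odot w w *: '1).
Proof.
move=> pw; have := omulKl w '1; rewrite omul1r perp_conj // omulNl => <-.
by rewrite opprK.
Qed.

Lemma perp_mulD w w' : perp w -> perp w' ->
  w ** w' + w' ** w = - ((odot w w' *+ 2) *: '1).
Proof.
move=> pw pw'; have := omul_conj w w'; rewrite !perp_conj // !omulNl => <-.
by rewrite opprD !opprK.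
Qed.

Lemma plane_inv a : a \in C -> odot a a = 1 -> a ** oconj a = '1.
Proof.
by move=> aC aa; have := omulKr a '1; rewrite omul1l aa scale1r.
Qed.

End Plane.

(** * Commutants of irreducible algebras of derivations *)

(** The real form of an eigenvector x + y i with eigenvalue p + q i. *)
Lemma complex_eigenpair (R : realType) (V : vectType R) (F : 'End(V))
    (U : {vspace V}) :
  U != 0%VS -> (F @: U <= U)%VS ->
  exists (p q : R) (x y : V), [/\ x \in U /\ y \in U, x != 0 \/ y != 0,
    F x = p *: x - q *: y & F y = q *: x + p *: y].
Proof.
move=> U0 FU; pose b := vbasis U.
pose M : 'M[R]_(\dim U) := \matrix_(i, j) coord b j (F b`_i).
have n0 : (0 < \dim U)%N by rewrite lt0n dimv_eq0.
have [a /eigenvalueP[w wM w0]] := eigenvalue_closed (map_mx (real_complex R) M) n0.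
pose X (s : 'I_(\dim U) -> R) := \sum_i s i *: b`_i.
have XU s : X s \in U.
  by apply: rpred_sum => i _; rewrite rpredZ // vbasis_mem // mem_nth ?size_tuple.
have Fb (i : 'I_(\dim U)) : F b`_i = \sum_j M i j *: b`_j.
  rewrite {1}(coord_vbasis (v := F b`_i) (U := U)); last first.
    by rewrite (subvP FU) // memv_img // vbasis_mem // mem_nth ?size_tuple.
  by apply: eq_bigr => j _; rewrite mxE.
have FX s : F (X s) = X (fun j => \sum_i s i * M i j).
  rewrite /X linear_sum /=.
  transitivity (\sum_i \sum_j (s i * M i j) *: b`_j).
    apply: eq_bigr => i _; rewrite linearZ /= Fb scaler_sumr.
    by apply: eq_bigr => j _; rewrite scalerA.
  by rewrite exchange_big; apply: eq_bigr => j _; rewrite scaler_suml.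
have XD s t : X s + X t = X (fun i => s i + t i).
  by rewrite /X -big_split; apply: eq_bigr => i _; rewrite scalerDl.
have XZ k s : k *: X s = X (fun i => k * s i).
  by rewrite /X scaler_sumr; apply: eq_bigr => i _; rewrite scalerA.
have eqX s t : s =1 t -> X s = X t.
  by move=> st; apply: eq_bigr => i _; rewrite st.
pose r i := complex.Re (w 0 i); pose s i := complex.Im (w 0 i).
have reM (z t : R[i]) : complex.Re (z * t) =
    complex.Re z * complex.Re t - complex.Im z * complex.Im t.
  by case: z t => [? ?] [? ?].
have imM (z t : R[i]) : complex.Im (z * t) =
    complex.Im z * complex.Re t + complex.Re z * complex.Im t.
  by case: z t => [? ?] [? ?] /=; rewrite addrC.
have key j : (\sum_i r i * M i j = complex.Re a * r j - complex.Im a * s j) /\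
    (\sum_i s i * M i j = complex.Im a * r j + complex.Re a * s j).
  have := congr1 (fun A : 'rV_(\dim U) => A 0 j) wM; rewrite !mxE => e.
  split.
    have := congr1 (fun z : R[i] => complex.Re z) e; rewrite raddf_sum.
    rewrite (eq_bigr (fun i => r i * M i j)) => [->|i _]; first exact: reM.
    by rewrite mxE /r; case: (w 0 i) => ? ? /=; rewrite mulr0 subr0.
  have := congr1 (fun z : R[i] => complex.Im z) e; rewrite raddf_sum.
  rewrite (eq_bigr (fun i => s i * M i j)) => [->|i _]; first exact: imM.
  by rewrite mxE /s; case: (w 0 i) => ? ? /=; rewrite mulr0 add0r.
exists (complex.Re a), (complex.Im a), (X r), (X s); split=> //; last 2 first.
- rewrite FX -scaleN1r !XZ XD; apply: eqX => j.
  by rewrite (key j).1 mulN1r.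
- by rewrite FX !XZ XD; apply: eqX => j; rewrite (key j).2.
have X0 t : X t = 0 -> forall i, t i = 0.
  by move/freeP: (basis_free (vbasisP U)) => frU; apply: frU.
have [/X0 xr|] := eqVneq (X r) 0; last by left.
have [/X0 xs|] := eqVneq (X s) 0; last by right.
case/eqP: w0; apply/rowP => i; rewrite mxE.
by have := xr i; have := xs i; rewrite /r /s; case: (w 0 i) => x y /= -> ->.
Qed.

Section Multiplications.
Variable R : realType.

Fact omul_linear (a : octonion R) : linear (omul a).
Proof. by move=> k x y; rewrite omulDr omulZr. Qed.
Definition omul_lfun (a : octonion R) : 'End(octonion R) :=
  linfun (HB.pack_for {linear octonion R -> octonion R} (omul a)
    (GRing.isLinear.Build R (octonion R) (octonion R) *:%R
       (omul a) (omul_linear a))).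

Lemma omul_lfunE a x : omul_lfun a x = omul a x.
Proof. by rewrite lfunE. Qed.

End Multiplications.

Section StdFrame.
Variable R : realType.
Local Notation "x ** y" := (omul x y) (at level 40, left associativity).
Local Notation "''1'" := (oone R).
Local Notation u := (std_u R).
Local Notation v := (std_v R).
Local Notation z := (std_z R).

Lemma std_w : v ** z = oct8 0 0 0 1 0 0 0 0.
Proof. by rewrite omul8 /=; congr oct8; ring. Qed.
Lemma std_uv : u ** v = oct8 0 0 0 0 0 (-1) 0 0.
Proof. by rewrite omul8 /=; congr oct8; ring. Qed.
Lemma std_uz : u ** z = oct8 0 0 0 0 0 0 (-1) 0.
Proof. by rewrite omul8 /=; congr oct8; ring. Qed.
Lemma std_uw : u ** (v ** z) = oct8 0 0 0 0 0 0 0 (-1).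
Proof. by rewrite std_w omul8 /=; congr oct8; ring. Qed.

End StdFrame.

Section Frame.
Variables (R : realType) (c : cayley_triple R).
Local Notation "x ** y" := (omul x y) (at level 40, left associativity).
Local Notation "''1'" := (oone R).
Local Notation u := (cu c).
Local Notation v := (cv c).
Local Notation z := (cz c).
Local Notation w := (v ** z).
Local Notation C := (plane_C c).

(** A hermitian product on the complement of C, with values in C: the
    coefficient of y in the expansion of x in a basis over C. *)
Definition herm (x y : octonion R) : octonion R :=
  odot x y *: '1 + odot x (u ** y) *: u.

Lemma herm_plane x y : herm x y \in C.
Proof. by apply/planeP; eexists; eexists. Qed.

Let hermM x y : herm x y ** y = odot x y *: y + odot x (u ** y) *: (u ** y).
Proof. by rewrite omulDl !omulZl omul1l. Qed.

Lemma herm_expand x : perp c x ->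
  x = herm x v ** v + herm x z ** z + herm x w ** w.
Proof.
rewrite /perp !hermM; have [F [FI <- <- <-]] := std_automorphism c.
have [_ FK KF] := octonion_isometry_bij FI.
have FD := odot_isometry FI.
rewrite -(KF x); move: (F^-1%VF x) => y.
rewrite -!g2M -(g2_fix1 F) !FD -!linearZ -!linearD std_uv std_uz std_uw std_w.
elim/oct8_ind: y => y1 y2 y3 y4 y5 y6 y7 y8.
rewrite oone8 !odot8 !oct8Z !oct8D => -[h1 h5]; congr (F _).
have -> : y1 = 0 by rewrite -[RHS]h1; ring.
have -> : y5 = 0 by rewrite -[RHS]h5; ring.
by congr oct8; ring.
Qed.

Lemma perp_v : perp c v. Proof. by split; rewrite ?v_1 // odotC u_v. Qed.
Lemma perp_z : perp c z. Proof. by split; rewrite ?z_1 // odotC u_z. Qed.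
Lemma perp_w : perp c w. Proof. by split; rewrite ?w_1 // odotC u_w. Qed.

Lemma frame_normsq a b d : a \in C -> b \in C -> d \in C ->
  let n := a ** v + b ** z + d ** w in
  odot n n = odot a a + odot b b + odot d d.
Proof.
move=> /planeP[a1 [a2 ->]] /planeP[b1 [b2 ->]] /planeP[d1 [d2 ->]] /=.
rewrite !(omulDl, omulZl, omul1l).
have [F [FI <- <- <-]] := std_automorphism c.
have FD := odot_isometry FI.
rewrite -!g2M -(g2_fix1 F) -!linearZ -!linearD !FD.
rewrite std_uv std_uz std_uw std_w oone8 !oct8Z !oct8D !odot8.
by ring.
Qed.

HB.instance Definition _ := GRing.isLinear.Build R (octonion R) (octonion R)
  *:%R (proj_C c) (proj_C_linear c).

Definition perp_space : {vspace octonion R} := lker (linfun (proj_C c)).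

Lemma perp_spaceP x : reflect (perp c x) (x \in perp_space).
Proof.
rewrite /perp_space memv_ker lfunE /=; apply: (iffP eqP) => [x0|[x1 xu]].
  by have := proj_C_perp c x; rewrite x0 subr0.
by rewrite /proj_C x1 xu !scale0r addr0.
Qed.

Section Commutant.
Variable G : 'End(octonion R) -> Prop.
Hypothesis G_plane : forall d x, G d -> x \in C -> d x = 0.
Hypothesis Gu : forall d x, G d -> d (u ** x) = u ** d x.
Hypothesis G_skew : forall d x, G d -> odot x (d x) = 0.
Hypothesis G_irr : forall W : {vspace octonion R},
  (forall d, G d -> (d @: W <= W)%VS) -> (W <= C)%VS \/ (W + C)%VS = fullv.

Let Gskew d x y : G d -> odot (d x) y = - odot x (d y).
Proof.
move=> Gd; have := G_skew (x + y) Gd; rewrite linearD odotDl !odotDr !G_skew //.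
by rewrite (odotC (d x)) => h; lra.
Qed.

Let Gperp d x : G d -> perp c (d x).
Proof.
by move=> Gd; apply: perpP => y yC; rewrite Gskew // G_plane // odot0r oppr0.
Qed.

Let irr_perp (W : {vspace octonion R}) n :
  (forall d x, G d -> x \in W -> d x \in W) -> (forall x, x \in W -> perp c x) ->
  n \in W -> n != 0 -> forall x, perp c x -> x \in W.
Proof.
move=> WG Wp nW n0 x xp; have [|WC|WC] := G_irr (W := W).
- by move=> d Gd; apply/subvP => _ /memv_imgP[y yW ->]; apply: WG.
- by case/eqP: n0; apply: plane_perp0 (subvP WC _ nW) (Wp _ nW).
have : x \in (W + C)%VS by rewrite WC memvf.
move=> /memv_addP[a aW [b bC e]].
have [_ ->] := plane_perp_unique (mem0v C) bC xp (Wp _ aW)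
  (etrans (add0r x) (etrans e (addrC _ _))).
by [].
Qed.

(** The eigenvalue of a complex eigenpair of a symmetric operator is real, and
    the eigenspace is a submodule. *)
Lemma symmetric_commutant (T : 'End(octonion R)) :
  (forall x, perp c x -> perp c (T x)) ->
  (forall x y, perp c x -> perp c y -> odot (T x) y = odot x (T y)) ->
  (forall d x, G d -> perp c x -> T (d x) = d (T x)) ->
  exists s : R, forall x, perp c x -> T x = s *: x.
Proof.
move=> Tp Tsym TG.
have U0 : perp_space != 0%VS.
  apply/eqP => U0; have /perp_spaceP : perp c v := perp_v.
  by rewrite U0 memv0 (negPf (ounit_neq0 (v_unit c))).
have TU : (T @: perp_space <= perp_space)%VS.
  by apply/subvP => _ /memv_imgP[y /perp_spaceP yp ->]; apply/perp_spaceP/Tp.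
have [p [q [x [y [[/perp_spaceP xp /perp_spaceP yp] xy Tx Ty]]]]] :=
  complex_eigenpair U0 TU.
have q0 : q = 0.
  have := Tsym _ _ xp yp; rewrite Tx Ty odotDl odotDr odotNl !odotZl !odotZr => e.
  have e0 : q * (odot x x + odot y y) = 0 by lra.
  move/eqP: e0; rewrite mulf_eq0 => /orP[/eqP //|].
  rewrite paddr_eq0 ?odot_ge0 // => /andP[/eqP/odot_eq0 x0 /eqP/odot_eq0 y0].
  by case: xy; rewrite ?x0 ?y0 eqxx.
have [n [np n0 Tn]] : exists n, [/\ perp c n, n != 0 & T n = p *: n].
  rewrite q0 !scale0r subr0 add0r in Tx Ty.
  by case: xy => ?; [exists x | exists y].
exists p => t tp.
pose W := (lker (T - p *: \1%VF) :&: perp_space)%VS.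
have WP a : a \in W <-> T a = p *: a /\ perp c a.
  rewrite memv_cap memv_ker !lfunE /= opp_lfunE scale_lfunE id_lfunE subr_eq0.
  split=> [/andP[/eqP ? /perp_spaceP]|[/eqP-> /perp_spaceP]] //.
suff /WP[] : t \in W by [].
apply: (irr_perp (n := n)) => // [d a Gd /WP[Ta ap]|a /WP[]|] //.
  apply/WP; split; last exact: Gperp.
  by rewrite TG // Ta linearZ.
exact/WP.
Qed.

(** A skew antilinear operator in three complex dimensions is the cross product
    with some vector n, so it kills n.  Its kernel is a nonzero submodule. *)
Lemma skew_antilinear_commutant (S : 'End(octonion R)) :
  (forall x, perp c x -> perp c (S x)) ->
  (forall x y, perp c x -> perp c y -> odot (S x) y = - odot x (S y)) ->
  (forall x, perp c x -> S (u ** x) = - (u ** S x)) ->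
  (forall d x, G d -> perp c x -> S (d x) = d (S x)) ->
  forall x, perp c x -> S x = 0.
Proof.
move=> Sp Sskew Su SG.
have uC := plane_u c.
have hS x y : perp c x -> perp c y -> herm (S x) y = - herm (S y) x.
  move=> xp yp; rewrite /herm opprD -!scaleNr; congr (_ *: _ + _ *: _).
    by rewrite Sskew // odotC.
  rewrite Sskew //; last exact: perpM.
  by rewrite Su // odotNr opprK odotC odotMl im_conj ?u_1 // omulNl odotNr.
have hS0 x : perp c x -> herm (S x) x = 0.
  move=> xp; have /eqP := hS x x xp xp; rewrite -addr_eq0 -mulr2n -scaler_nat.
  by rewrite scaler_eq0 pnatr_eq0 => /eqP.
have SC a x : a \in C -> perp c x -> S (a ** x) = oconj a ** S x.
  move=> /planeP[a1 [a2 ->]] xp; rewrite oconjD !oconjZ oconj1 im_conj ?u_1 //.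
  rewrite !omulDl !omulZl !omul1l linearD !linearZ /= Su // scalerN.
  by rewrite omulNl scalerN.
have [vp [zp wp]] := (perp_v, (perp_z, perp_w)).
set al := herm (S v) z; set be := herm (S v) w; set ga := herm (S z) w.
have [alC [beC gaC]] : al \in C /\ be \in C /\ ga \in C.
  by rewrite !herm_plane.
have Sv : S v = al ** z + be ** w.
  by rewrite {1}(herm_expand (Sp v vp)) hS0 // omul0l add0r.
have Sz : S z = - (al ** v) + ga ** w.
  by rewrite {1}(herm_expand (Sp z zp)) hS0 // omul0l addr0 hS // omulNl.
have Sw : S w = - (be ** v) - ga ** z.
  rewrite {1}(herm_expand (Sp w wp)) hS0 // omul0l addr0 hS // omulNl.
  by rewrite (hS w z) // omulNl.
(* n is the vector of the cross product, read off from the matrix of S. *)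
pose n := oconj ga ** v + (- oconj be) ** z + oconj al ** w.
have np : perp c n.
  by apply: perpD; [apply: perpD|]; apply: perpM => //; rewrite ?rpredN plane_conj.
have Sn : S n = 0.
  have conjN : oconj (- oconj be) = - be by rewrite -scaleN1r oconjZ oconjK scaleN1r.
  rewrite /n !linearD /= (SC (oconj ga) v) ?(SC (- oconj be) z) ?(SC (oconj al) w)
    ?rpredN ?plane_conj // conjN !oconjK Sv Sz Sw omulNl !omulDr !omulNr ?opprK.
  rewrite (perp_mulA _ gaC alC) (perp_mulA _ gaC beC) (perp_mulA _ beC alC).
  rewrite (perp_mulA _ beC gaC) (perp_mulA _ alC beC) (perp_mulA _ alC gaC).
  rewrite (planeMC alC gaC) (planeMC beC gaC) (planeMC alC beC).
  rewrite opprD opprK !addrA [LHS](ACl ((1*6)*(2*4)*(3*5)))%AC /=.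
  by rewrite !subrr !addr0.
have kill m : perp c m -> m != 0 -> S m = 0 -> forall x, perp c x -> S x = 0.
  move=> mp m0 Sm x xp.
  pose W := (lker S :&: perp_space)%VS.
  have WP a : a \in W <-> S a = 0 /\ perp c a.
    rewrite memv_cap memv_ker.
    by split=> [/andP[/eqP ? /perp_spaceP]|[/eqP-> /perp_spaceP]].
  suff /WP[] : x \in W by [].
  apply: (irr_perp (n := m)) => // [d a Gd /WP[Sa ap]|a /WP[]|] //.
    by apply/WP; split; [rewrite SG // Sa linear0 | exact: Gperp].
  exact/WP.
have [n0|n0] := eqVneq n 0; last exact: kill n0 Sn.
apply: (kill v) => //; first by rewrite ounit_neq0 // v_unit.
have nC : - oconj be \in C by rewrite rpredN plane_conj.
have : odot n n = _ := frame_normsq (plane_conj gaC) nC (plane_conj alC).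
rewrite n0 odot0l odotNl odotNr opprK !odot_conj => /esym nn.
move/eqP: nn; rewrite !paddr_eq0 ?addr_ge0 ?odot_ge0 // -andbA.
move=> /and3P[_ /eqP/odot_eq0 be0 /eqP/odot_eq0 al0].
by rewrite Sv al0 be0 !omul0l addr0.
Qed.

(** Let f' be the adjoint of f, J the multiplication by u and K = f - f'.  The
    symmetric operator f + f' is a scalar s, and so is J K + K J, say r.  Then
    K + (r / 2) J is skew and antilinear, hence zero. *)
Lemma commutant (f f' : 'End(octonion R)) :
  (forall x y, odot (f x) y = odot x (f' y)) ->
  (forall x, x \in C -> f x \in C) -> (forall x, x \in C -> f' x \in C) ->
  (forall d x, G d -> perp c x -> f (d x) = d (f x)) ->
  (forall d x, G d -> perp c x -> f' (d x) = d (f' x)) ->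
  exists2 a, a \in C & forall x, perp c x -> f x = a ** x.
Proof.
move=> adj fC f'C fG f'G.
have fp x : perp c x -> perp c (f x).
  by move=> xp; apply: perpP => y yC; rewrite adj (perp_plane xp) ?f'C.
have adj' x y : odot (f' x) y = odot x (f y) by rewrite odotC -adj odotC.
have f'p x : perp c x -> perp c (f' x).
  by move=> xp; apply: perpP => y yC; rewrite adj' (perp_plane xp) ?fC.
have uC := plane_u c.
have up x : perp c x -> perp c (u ** x) by apply: perpM.
have [s sP] : exists s : R, forall x, perp c x -> (f + f') x = s *: x.
  apply: symmetric_commutant => [x xp|x y xp yp|d x Gd xp]; rewrite !add_lfunE.
  - by apply: perpD; [apply: fp | apply: f'p].
  - by rewrite odotDl odotDr adj adj' addrC.
  - by rewrite fG // f'G // linearD.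
pose K := f - f'.
have KE x : K x = f x - f' x by rewrite add_lfunE opp_lfunE.
have Kp x : perp c x -> perp c (K x).
  by move=> xp; rewrite KE; apply: perpB; [apply: fp | apply: f'p].
have Kskew x y : odot (K x) y = - odot x (K y).
  by rewrite !KE odotDl odotDr odotNl odotNr adj adj'; lra.
have KG d x : G d -> perp c x -> K (d x) = d (K x).
  by move=> Gd xp; rewrite !KE fG // f'G // linearB.
pose J := omul_lfun u; have JE : forall x, J x = u ** x by exact: omul_lfunE.
have Jskew x y : odot (u ** x) y = - odot x (u ** y).
  by rewrite odotMl im_conj ?u_1 // omulNl odotNr.
have uu x : u ** (u ** x) = - x by rewrite im_sql ?u_1 ?u_unit.
pose Q := (J \o K)%VF + (K \o J)%VF.
have QE x : Q x = u ** K x + K (u ** x) by rewrite add_lfunE !comp_lfunE !JE.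
have [r rP] : exists r : R, forall x, perp c x -> Q x = r *: x.
  apply: symmetric_commutant => [x xp|x y xp yp|d x Gd xp]; rewrite !QE.
  - by apply: perpD; [apply/up/Kp | apply/Kp/up].
  - rewrite odotDl odotDr Jskew !Kskew Jskew; ring.
  - by rewrite KG // -(Gu x Gd) KG ?linearD /= ?(Gu (K x) Gd) //; apply: up.
pose S := K + (r / 2) *: J.
have SE x : S x = K x + (r / 2) *: (u ** x).
  by rewrite add_lfunE scale_lfunE JE.
have S0 : forall x, perp c x -> S x = 0.
  apply: skew_antilinear_commutant => [x xp|x y xp yp|x xp|d x Gd xp]; rewrite !SE.
  - by apply: perpD; [exact: Kp | apply/perpZ/up].
  - by rewrite odotDl odotDr odotZl odotZr Kskew Jskew; ring.
  - have := rP x xp; rewrite QE => /(canRL (addKr _)) ->.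
    rewrite uu omulDr omulZr uu opprD scalerN opprK -addrA -scalerBl.
    by congr (_ + _ *: _); field.
  - by rewrite KG // -Gu // linearD linearZ.
exists ((s / 2) *: '1 - (r / 4) *: u).
  by rewrite rpredB // rpredZ ?plane1.
move=> x xp; have := S0 x xp; have := sP x xp; rewrite SE KE add_lfunE.
rewrite omulDl omulNl !omulZl omul1l.
move=> e1 /eqP; rewrite addr_eq0 => /eqP e2.
have e3 : f x *+ 2 = s *: x - (r / 2) *: (u ** x).
  by rewrite -e1 -e2 addrACA subrr addr0 mulr2n.
apply: (scalerI (a := 2%:R)); first by rewrite pnatr_eq0.
rewrite scaler_nat e3 scalerBr !scalerA.
by congr (_ *: _ - _ *: _); field.
Qed.

End Commutant.

End Frame.

(** * Derivations of the octonions *)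

Section StdDerivations.
Variable R : realType.
Local Notation "x ** y" := (omul x y) (at level 40, left associativity).
Local Notation "''1'" := (oone R).

(** On the complement of C, identified with C^3 by the basis v, z, v ** z, this is
    the diagonal matrix with entries i (s + t), - i s, - i t plus the real
    rotations of v towards z and towards v ** z with speeds p and q. *)
Definition std_der (s t p q : R) (x : octonion R) : octonion R :=
  let r k (lt_k8 : (k < 8)%N) := x 0 (Ordinal lt_k8) in
  oct8 0
    ((s + t) * r 5 isT - p * r 2 isT - q * r 3 isT)
    (p * r 1 isT - s * r 6 isT)
    (q * r 1 isT - t * r 7 isT)
    0
    (- (s + t) * r 1 isT - p * r 6 isT - q * r 7 isT)
    (s * r 2 isT + p * r 5 isT)
    (t * r 3 isT + q * r 5 isT).

Lemma std_der8 s t p q a1 a2 a3 a4 a5 a6 a7 a8 :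
  std_der s t p q (oct8 a1 a2 a3 a4 a5 a6 a7 a8) =
  oct8 0 ((s + t) * a6 - p * a3 - q * a4) (p * a2 - s * a7) (q * a2 - t * a8)
    0 (- (s + t) * a2 - p * a7 - q * a8) (s * a3 + p * a6) (t * a4 + q * a6).
Proof. by rewrite /std_der !mxE. Qed.

Lemma std_der_linear s t p q : linear (std_der s t p q).
Proof.
move=> k x y; elim/oct8_ind: x => ? ? ? ? ? ? ? ?.
elim/oct8_ind: y => ? ? ? ? ? ? ? ?.
rewrite oct8Z oct8D !std_der8 oct8Z oct8D; congr oct8; ring.
Qed.
HB.instance Definition _ s t p q := GRing.isLinear.Build R (octonion R) (octonion R)
  *:%R (std_der s t p q) (std_der_linear s t p q).

Lemma std_derM s t p q x y : std_der s t p q (x ** y) =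
  std_der s t p q x ** y + x ** std_der s t p q y.
Proof.
elim/oct8_ind: x => a1 a2 a3 a4 a5 a6 a7 a8.
elim/oct8_ind: y => b1 b2 b3 b4 b5 b6 b7 b8.
rewrite omul8 /= !std_der8 !omul8 /= oct8D; congr oct8; ring.
Qed.

(** With H the quaternions spanned by the first four coordinates, this is
    h + k u |-> (v k) u. *)
Definition std_der_u (x : octonion R) : octonion R :=
  let r k (lt_k8 : (k < 8)%N) := x 0 (Ordinal lt_k8) in
  oct8 0 0 0 0 (- r 5 isT) (r 4 isT) (- r 7 isT) (r 6 isT).

Lemma std_der_u8 a1 a2 a3 a4 a5 a6 a7 a8 :
  std_der_u (oct8 a1 a2 a3 a4 a5 a6 a7 a8) = oct8 0 0 0 0 (- a6) a5 (- a8) a7.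
Proof. by rewrite /std_der_u !mxE. Qed.

Lemma std_der_u_linear : linear std_der_u.
Proof.
move=> k x y; elim/oct8_ind: x => ? ? ? ? ? ? ? ?.
elim/oct8_ind: y => ? ? ? ? ? ? ? ?.
rewrite oct8Z oct8D !std_der_u8 oct8Z oct8D; congr oct8; ring.
Qed.
HB.instance Definition _ := GRing.isLinear.Build R (octonion R) (octonion R)
  *:%R std_der_u std_der_u_linear.

Lemma std_der_uM x y : std_der_u (x ** y) = std_der_u x ** y + x ** std_der_u y.
Proof.
elim/oct8_ind: x => a1 a2 a3 a4 a5 a6 a7 a8.
elim/oct8_ind: y => b1 b2 b3 b4 b5 b6 b7 b8.
rewrite omul8 /= !std_der_u8 !omul8 /= oct8D; congr oct8; ring.
Qed.

(** The squares of two diagonal derivations are minus projections onto two of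
    the three coordinate lines; their product isolates one line, and the
    rotations reach the others. *)
Lemma std_der_irreducible (W : {vspace octonion R}) (y : octonion R) :
  (forall s t p q x, x \in W -> std_der s t p q x \in W) ->
  y \in W -> y != 0 -> odot y '1 = 0 -> odot y (std_u R) = 0 ->
  forall a2 a3 a4 a6 a7 a8, oct8 0 a2 a3 a4 0 a6 a7 a8 \in W.
Proof.
move=> WD; elim/oct8_ind: y => y1 y2 y3 y4 y5 y6 y7 y8 yW y0.
rewrite oone8 /std_u !odot8 => h1 h5.
have {h1} e1 : y1 = 0 by rewrite -[RHS]h1; ring.
have {h5} e5 : y5 = 0 by rewrite -[RHS]h5; ring.
have line b b' : oct8 0 b 0 0 0 b' 0 0 \in W -> (b != 0) || (b' != 0) ->
    oct8 0 1 0 0 0 0 0 0 \in W.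
  move=> bW b0; have n0 : b ^+ 2 + b' ^+ 2 != 0.
    by rewrite paddr_eq0 ?sqr_ge0 // !sqrf_eq0 negb_and.
  have := rpredD (rpredZ (b / (b ^+ 2 + b' ^+ 2)) bW)
    (rpredZ (b' / (b ^+ 2 + b' ^+ 2)) (WD 1 0 0 0 _ bW)).
  rewrite std_der8 !oct8Z oct8D; congr (_ \in W); congr oct8; field => //.
have e2W : oct8 0 1 0 0 0 0 0 0 \in W.
  have sq s t p q x xW := WD s t p q _ (WD s t p q x xW).
  have [y26|] := boolP ((y2 != 0) || (y6 != 0)).
    apply: line y26; have := sq 1 0 0 0 _ (sq 0 1 0 0 _ yW).
    by rewrite !std_der8; congr (_ \in W); congr oct8; ring.
  rewrite negb_or !negbK => /andP[/eqP e2 /eqP e6].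
  have [y37|] := boolP ((y3 != 0) || (y7 != 0)).
    apply: line y37; have := WD 0 0 1 0 _ (sq 1 0 0 0 _ yW).
    by rewrite !std_der8 e2 e6; congr (_ \in W); congr oct8; ring.
  rewrite negb_or !negbK => /andP[/eqP e3 /eqP e7].
  have [y48|] := boolP ((- y4 != 0) || (- y8 != 0)).
    apply: line y48; have := WD 0 0 0 1 _ yW.
    by rewrite !std_der8 e2 e6 e3 e7; congr (_ \in W); congr oct8; ring.
  rewrite !oppr_eq0 negb_or !negbK => /andP[/eqP e4 /eqP e8].
  case/eqP: y0; rewrite e1 e2 e3 e4 e5 e6 e7 e8 -[RHS](scale0r '1) oone8 oct8Z.
  by rewrite !mul0r.
have WZ k x x' : x \in W -> x' = k *: x -> x' \in W.
  by move=> xW ->; apply: rpredZ.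
have e3W : oct8 0 0 1 0 0 0 0 0 \in W.
  by apply: (WZ 1 _ _ (WD 0 0 1 0 _ e2W)); rewrite std_der8 oct8Z; congr oct8; ring.
have e4W : oct8 0 0 0 1 0 0 0 0 \in W.
  by apply: (WZ 1 _ _ (WD 0 0 0 1 _ e2W)); rewrite std_der8 oct8Z; congr oct8; ring.
have e6W : oct8 0 0 0 0 0 1 0 0 \in W.
  apply: (WZ (- 1) _ _ (WD 1 0 0 0 _ e2W)).
  by rewrite std_der8 oct8Z; congr oct8; ring.
have e7W : oct8 0 0 0 0 0 0 1 0 \in W.
  by apply: (WZ 1 _ _ (WD 1 0 0 0 _ e3W)); rewrite std_der8 oct8Z; congr oct8; ring.
have e8W : oct8 0 0 0 0 0 0 0 1 \in W.
  by apply: (WZ 1 _ _ (WD 0 1 0 0 _ e4W)); rewrite std_der8 oct8Z; congr oct8; ring.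
move=> a2 a3 a4 a6 a7 a8.
have -> : oct8 0 a2 a3 a4 0 a6 a7 a8 = a2 *: oct8 0 1 0 0 0 0 0 0 +
    a3 *: oct8 0 0 1 0 0 0 0 0 + a4 *: oct8 0 0 0 1 0 0 0 0 +
    a6 *: oct8 0 0 0 0 0 1 0 0 + a7 *: oct8 0 0 0 0 0 0 1 0 +
    a8 *: oct8 0 0 0 0 0 0 0 1.
  by rewrite !oct8Z !oct8D; congr oct8; ring.
by rewrite !rpredD ?rpredZ.
Qed.

End StdDerivations.

Section SU3Derivations.
Variables (R : realType) (c : cayley_triple R).
Local Notation "x ** y" := (omul x y) (at level 40, left associativity).
Local Notation "''1'" := (oone R).
Local Notation u := (cu c).
Local Notation v := (cv c).
Local Notation C := (plane_C c).

Definition octonion_derivation (d : 'End(octonion R)) : Prop :=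
  forall x y, d (x ** y) = d x ** y + x ** d y.

Definition su3_derivation (d : 'End(octonion R)) : Prop :=
  octonion_derivation d /\ forall x, x \in C -> d x = 0.

Lemma derivation_transport (F : G2 R) (D : {linear octonion R -> octonion R}) :
  (forall x y, D (x ** y) = D x ** y + x ** D y) ->
  exists2 d, octonion_derivation d & forall x, d (F x) = F (D x).
Proof.
move=> DM; have FK := lker0_lfunK (g2_ker F); have KF := lker0_lfunVK (g2_ker F).
pose d := (g2val F \o (linfun D \o (g2val F)^-1))%VF.
have dE x : d (F x) = F (D x) by rewrite !comp_lfunE lfunE /= FK.
exists d => // x y; rewrite -(KF x) -(KF y) -g2M !dE DM linearD /=.
by rewrite !g2M.
Qed.

Lemma std_der_transport (F : G2 R) s t p q : F (std_u R) = u ->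
  exists2 d, su3_derivation d & forall x, d (F x) = F (std_der s t p q x).
Proof.
move=> Fu; have [d dM dE] := derivation_transport F (std_derM s t p q).
exists d => //; split=> // x /planeP[a [b ->]].
rewrite -(g2_fix1 F) -Fu -!linearZ -linearD dE oone8 !oct8Z oct8D /= std_der8.
rewrite (_ : oct8 _ _ _ _ _ _ _ _ = 0) ?linear0 //.
by rewrite -[RHS](scale0r '1) oone8 oct8Z; congr oct8; ring.
Qed.

Lemma su3_irreducible (W : {vspace octonion R}) n :
  (forall d, su3_derivation d -> (d @: W <= W)%VS) ->
  n \in W -> n != 0 -> perp c n -> forall x, perp c x -> x \in W.
Proof.
move=> WD nW n0 np x xp; have [F [FI Fu _ _]] := std_automorphism c.
have [Fi FK KF] := octonion_isometry_bij FI.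
have FO := odot_isometry FI.
have pF y : perp c (F y) -> odot y '1 = 0 /\ odot y (std_u R) = 0.
  by rewrite /perp -Fu -{1}(g2_fix1 F) !FO.
pose W' := (g2val F @^-1: W)%VS.
have W'P y : (y \in W') = (F y \in W) by rewrite -memv_preim.
rewrite -(KF x) in xp *; rewrite -(KF n) in np nW n0.
move: (F^-1%VF x) xp => y /pF[].
elim/oct8_ind: y => y1 y2 y3 y4 y5 y6 y7 y8.
rewrite {1}oone8 {1}/std_u !odot8 => h1 h5 {x}.
have -> : y1 = 0 by rewrite -[RHS]h1; ring.
have -> : y5 = 0 by rewrite -[RHS]h5; ring.
rewrite -W'P; move: (F^-1%VF n) np nW n0 => m /pF[m1 m5] mW m0.
apply: (std_der_irreducible (y := m)) m1 m5 _ _ _ _ _ _.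
- move=> s t p q a; rewrite !W'P => aW.
  have [d dS <-] := std_der_transport s t p q Fu.
  by rewrite (subvP (WD _ dS)) // memv_img.
- by rewrite W'P.
- by apply: contra_neq m0 => ->; rewrite linear0.
Qed.

Lemma su3_nonabelian : exists d d',
  [/\ su3_derivation d, su3_derivation d' & ((d \o d')%VF - (d' \o d)%VF) != 0].
Proof.
have [F [FI Fu _ _]] := std_automorphism c.
have [Fi FK KF] := octonion_isometry_bij FI.
have [d dS dE] := std_der_transport 1 0 0 0 Fu.
have [d' dS' dE'] := std_der_transport 0 0 1 0 Fu.
exists d, d'; split=> //; apply/eqP => /lfunP/(_ (F (std_v R))).
rewrite add_lfunE opp_lfunE zero_lfunE !comp_lfunE !dE !dE' !dE -linearB /=.
rewrite -[RHS](linear0 F) => /Fi; rewrite /std_v !std_der8 -[RHS](scale0r '1).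
rewrite oone8 oct8N oct8D oct8Z => /(congr1 (odot (oct8 0 0 0 0 0 0 1 0))).
rewrite !odot8 => h; have /eqP : (2 : R) = 0 by lra.
by rewrite pnatr_eq0.
Qed.

Lemma u_moving_derivation : exists2 d, octonion_derivation d & d u != 0.
Proof.
have [F [FI Fu _ _]] := std_automorphism c.
have [Fi FK KF] := octonion_isometry_bij FI.
have [d dS dE] := derivation_transport F (@std_der_uM R).
exists d => //; rewrite -Fu dE; apply/eqP; rewrite -[RHS](linear0 F) => /Fi.
rewrite /= /std_u std_der_u8 -[RHS](scale0r '1) oone8 oct8Z.
move=> /(congr1 (odot (oct8 0 0 0 0 0 1 0 0))).
rewrite !odot8 => h; have /eqP : (2 : R) = 0 by lra.
by rewrite pnatr_eq0.
Qed.

Lemma derivation_isotope (f g : {linear octonion R -> octonion R}) d :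
  octonion_derivation d -> (forall x, d (f x) = f (d x)) ->
  (forall x, d (g x) = g (d x)) -> @derivation R (isotope f g) d.
Proof. by move=> dD df dg x y; rewrite /= /isotope_mul dD df dg. Qed.

Lemma octonion_derivation1 d : octonion_derivation d -> d '1 = 0.
Proof.
move=> dD; have := dD '1 '1; rewrite !omul1r omul1l => /eqP.
by rewrite -{1}[d '1]addr0 (inj_eq (addrI _)) eq_sym => /eqP.
Qed.

Lemma octonion_derivation_skew d x y :
  octonion_derivation d -> odot (d x) y = - odot x (d y).
Proof.
move=> dD; have sk t : odot t (d t) = 0.
  pose I : {linear octonion R -> octonion R} := idfun.
  have II t' : odot (I t') (I t') = odot t' t' by [].
  apply: (isotope_derivation_skew (d := d) II II).
  exact: derivation_isotope.
have := sk (x + y); rewrite linearD odotDl !odotDr !sk (odotC y) => h; lra.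
Qed.

End SU3Derivations.

(** * The isotopes by the maps lambda *)

Section Lambda.
Variables (R : realType) (c : cayley_triple R).
Local Notation "x ** y" := (omul x y) (at level 40, left associativity).
Local Notation "''1'" := (oone R).
Local Notation u := (cu c).
Local Notation v := (cv c).
Local Notation z := (cz c).
Local Notation C := (plane_C c).

Lemma circleP a : reflect (a \in C /\ odot a a = 1) (a \in circle c).
Proof.
rewrite inE; apply: (iffP andP) => -[aC aa]; split=> //.
  by rewrite -(sqr_sqrtr (odot_ge0 a)) -[Num.sqrt _]/(onorm a) (eqP aa) expr1n.
by rewrite /onorm aa sqrtr1.
Qed.

Lemma Kpow_cases (k : 'Z_2) :
  (@Kpow R k =1 id /\ (-1) ^+ k = 1 :> R) \/
  (@Kpow R k =1 @oconj R /\ (-1) ^+ k = -1 :> R).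
Proof.
by case: k => [[|[|k]] Hk] //; [left | right]; split=> //=; rewrite expr1.
Qed.

Lemma Kpow_u k : Kpow k u = (-1) ^+ k *: u.
Proof.
have [[-> ->]|[-> ->]] := Kpow_cases k; first by rewrite scale1r.
by rewrite im_conj ?u_1 // scaleN1r.
Qed.

Lemma Kpow_plane k x : x \in C -> Kpow k x \in C.
Proof.
by move=> xC; have [[-> _]|[-> _]] := Kpow_cases k => //; apply: plane_conj.
Qed.

Lemma Kpow_dot k (x : octonion R) : odot (Kpow k x) (Kpow k x) = odot x x.
Proof. by have [[-> _]|[-> _]] := Kpow_cases k; rewrite ?odot_conj. Qed.

Lemma Kpow_one (k : 'Z_2) : Kpow k '1 = '1.
Proof. by rewrite -[X in Kpow k X]scale1r Kpow1 scale1r. Qed.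

Lemma lambda_fix k t x : perp c x -> lambda c k t x = x.
Proof. by move=> xp; apply: lambda_perp => y; apply: perp_plane. Qed.

Lemma lambda_plane k t x : t \in C -> x \in C -> lambda c k t x \in C.
Proof. by move=> tC xC; rewrite lambda_in // planeM // Kpow_plane. Qed.

Lemma lambda_split k t a b : a \in C -> perp c b ->
  lambda c k t (a + b) = t ** Kpow k a + b.
Proof. by move=> aC bp; rewrite linearD /= (lambda_fix _ _ bp) lambda_in. Qed.

Lemma lambda_isometry k t x : t \in circle c ->
  odot (lambda c k t x) (lambda c k t x) = odot x x.
Proof.
move=> /circleP[tC tt]; have [a [b [aC bp ->]]] := plane_decomp c x.
rewrite (lambda_split k t aC bp) (pythagoras (planeM tC (Kpow_plane k aC)) bp).
by rewrite (pythagoras aC bp) odotMM tt mul1r Kpow_dot.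
Qed.

(** Holds because octonion derivations are skew. *)
Lemma su3_derivation_perp d x : su3_derivation c d -> perp c (d x).
Proof.
move=> [dD dC]; apply: perpP => y yC.
by rewrite octonion_derivation_skew // dC // odot0r oppr0.
Qed.

Lemma su3_derivation_fix d (f : {linear octonion R -> octonion R}) :
  su3_derivation c d -> (forall x, x \in C -> f x \in C) ->
  (forall x, perp c x -> f x = x) -> forall x, d (f x) = f (d x).
Proof.
move=> dS fC fp x; have [a [b [aC bp ->]]] := plane_decomp c x.
have [dD dC] := dS; rewrite !linearD /= (fp b bp) [d a]dC // [d (f a)]dC ?fC //.
by rewrite linear0 !add0r fp //; apply: su3_derivation_perp.
Qed.

Lemma su3_derivation_isotope (f g : {linear octonion R -> octonion R}) d :
  su3_derivation c d ->
  (forall x, x \in C -> f x \in C) -> (forall x, perp c x -> f x = x) ->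
  (forall x, x \in C -> g x \in C) -> (forall x, perp c x -> g x = x) ->
  @derivation R (isotope f g) d.
Proof.
move=> dS fC fp gC gp; apply: derivation_isotope; first by case: dS.
  exact: su3_derivation_fix.
exact: su3_derivation_fix.
Qed.

Lemma omul_eq_scalar (s : R) (a w : octonion R) :
  a ** w = s *: w -> w != 0 -> a = s *: '1.
Proof.
move=> aw w0; apply/eqP; rewrite -subr_eq0; apply/eqP.
have : odot ((a - s *: '1) ** w) ((a - s *: '1) ** w) = 0.
  by rewrite omulDl omulNl omulZl omul1l aw subrr odot0l.
rewrite odotMM => /eqP; rewrite mulf_eq0 => /orP[/eqP/odot_eq0 //|/eqP/odot_eq0 w0'].
by rewrite w0' eqxx in w0.
Qed.

Section Kill.
Variables (i j : 'Z_2) (a b : octonion R).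
Hypotheses (aS : a \in circle c) (bS : b \in circle c).
Hypothesis abN : (a, b) != ((-1) ^+ j *: '1, (-1) ^+ i *: '1).
Variable d : 'End(octonion R).
Hypothesis dD : derivation (A := isotope (lambda c j a) (lambda c i b)) d.

Local Notation f := (lambda c j a).
Local Notation g := (lambda c i b).

Let aC : a \in C. Proof. by case/circleP: aS. Qed.
Let bC : b \in C. Proof. by case/circleP: bS. Qed.
Let fC x : x \in C -> f x \in C. Proof. exact: lambda_plane. Qed.
Let gC x : x \in C -> g x \in C. Proof. exact: lambda_plane. Qed.

Let dM x y : d (f x ** g y) = f (d x) ** g y + f x ** g (d y).
Proof. exact: dD. Qed.

Let d_skew (x : octonion R) : odot x (d x) = 0.
Proof.
by apply: (isotope_derivation_skew _ _ dD) => y; apply: lambda_isometry.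
Qed.

Let d_adj (x y : octonion R) : odot (d x) y = - odot x (d y).
Proof.
have := d_skew (x + y); rewrite linearD odotDl !odotDr !d_skew (odotC y) => h; lra.
Qed.

Let p w : octonion R := proj_C c (d w).

(** Both sides compute d (w w), whose C-part comes from the C-part p w of d w. *)
Let key w : perp c w ->
  - (odot w w *: d '1) = (f (p w) + oconj (g (p w))) ** w.
Proof.
move=> wp; have pC : p w \in C := proj_C_plane c (d w).
have := dM w w; rewrite !(lambda_fix _ _ wp) (perp_sq wp) linearN linearZ /= => ->.
set q := d w - p w; have qp : perp c q := proj_C_perp c (d w).
have -> : d w = p w + q by rewrite addrC subrK.
rewrite [f (p w + q)]linearD [g (p w + q)]linearD /= !(lambda_fix _ _ qp).
rewrite [(f _ + q) ** w]omulDl [w ** (g _ + q)]omulDr [RHS]omulDl.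
rewrite [w ** g _](perp_mulr wp) ?gC //.
rewrite addrACA (perp_mulD qp wp).
have -> : odot q w = 0.
  rewrite /q odotDl odotNl [odot (p w) w]odotC (perp_plane wp pC).
  by rewrite odotC d_skew subr0.
by rewrite mul0rn scale0r oppr0 addr0.
Qed.

(** By [key], d '1 is a C-multiple of v as well as of z. *)
Let d1 : d '1 = 0.
Proof.
have kv := key (perp_v c); have kz := key (perp_z c).
rewrite v_unit scale1r in kv; rewrite z_unit scale1r in kz.
have sC w : f (p w) + oconj (g (p w)) \in C.
  by rewrite rpredD ?fC ?plane_conj ?gC ?proj_C_plane.
have nC : - (f (p z) + oconj (g (p z))) \in C by rewrite rpredN.
have := frame_normsq (sC v) nC (mem0v C).
rewrite omulNl -kv -kz omul0l addr0 opprK addNr !odot0l /= addr0.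
rewrite !odot0l => /esym/eqP.
rewrite paddr_eq0 ?odot_ge0 // => /andP[/eqP/odot_eq0 s0 _].
by apply/eqP; rewrite -oppr_eq0 kv s0 omul0l.
Qed.

Let pE w : perp c w -> p w = odot (d w) u *: u.
Proof.
move=> wp; rewrite /p /proj_C d_adj d1 odot0r oppr0.
by rewrite scale0r add0r.
Qed.

Let du_perp : perp c (d u).
Proof. by split; rewrite d_adj ?d_skew ?d1 ?odot0r oppr0. Qed.

Let f1 : f '1 = a.
Proof. by rewrite lambda_in ?plane1 // Kpow_one omul1r. Qed.
Let fu : f u = (-1) ^+ j *: (a ** u).
Proof. by rewrite lambda_in ?plane_u // Kpow_u omulZr. Qed.
Let gu : g u = (-1) ^+ i *: (b ** u).
Proof. by rewrite lambda_in ?plane_u // Kpow_u omulZr. Qed.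

Let sq (k : 'Z_2) : (-1) ^+ k * (-1) ^+ k = 1 :> R.
Proof. by rewrite -exprD addnn -signr_odd odd_double. Qed.

(** Suppose that n = d u is nonzero.  Then [key] at n relates a to the conjugate
    of b, and d (a w) = a g (d w) gives <a w, n> = (-1)^j <w, n> for all w
    orthogonal to C.  Together they single out the excluded pair. *)
Lemma lambda_derivation_u : d u = 0.
Proof.
have [//|du0] := eqVneq (d u) 0; case/eqP: abN.
have rightu x y : x ** u = y ** u -> x = y.
  move=> /(congr1 (fun t => t ** u)); rewrite !im_sqr ?u_1 ?u_unit //.
  exact: oppr_inj.
have ab : (-1) ^+ j *: a = (-1) ^+ i *: oconj b.
  have r0 : odot (d (d u)) u != 0.
    by rewrite d_adj oppr_eq0 gt_eqF // odot_gt0.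
  have := key du_perp; rewrite d1 scaler0 oppr0 (pE du_perp) !linearZ /= oconjZ.
  rewrite -scalerDr omulZl => /esym/eqP; rewrite scaler_eq0 (negPf r0) /=.
  move=> /eqP h; have := omul_eq_scalar (s := 0) _ du0.
  rewrite scale0r => /(_ _ h); rewrite scale0r fu gu oconjZ oconjM im_conj ?u_1 //.
  rewrite omulNl (planeMC (plane_u c) (plane_conj bC)) scalerN => /eqP.
  by rewrite subr_eq0 -!omulZl => /eqP/rightu.
have aE : oconj a = (-1) ^+ j *: '1.
  apply: omul_eq_scalar du0; apply/eqP; rewrite -subr_eq0; apply/eqP.
  set n := _ - _.
  have np : perp c n.
    by apply: perpB; [apply: perpM => //; apply: plane_conj | apply: perpZ].
  suff k w : perp c w -> odot w n = 0 by apply: odot_eq0; exact: k.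
  move=> wp; have := dM '1 w; rewrite d1 linear0 omul0l add0r f1 (lambda_fix _ _ wp).
  set q := d w - p w; have qp : perp c q := proj_C_perp c (d w).
  have -> : d w = p w + q by rewrite addrC subrK.
  rewrite [g (p w + q)]linearD /= (lambda_fix _ _ qp) (pE wp).
  rewrite [g _]linearZ /= gu omulDr !omulZr (perp_mulA _ aC bC).
  have -> : a ** b = ((-1) ^+ i * (-1) ^+ j) *: '1.
    have -> : b = ((-1) ^+ i * (-1) ^+ j) *: oconj a.
      have := congr1 (fun t => (-1) ^+ i *: oconj t) ab.
      rewrite !oconjZ oconjK !scalerA sq scale1r => <-.
      by rewrite mulrC.
    by rewrite omulZr (plane_inv aC) //; case/circleP: aS.
  rewrite omulZl omul1l !scalerA => /(congr1 (fun t => odot t u)).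
  rewrite d_adj odotDl !odotZl u_unit.
  have -> : odot (a ** q) u = 0 by case: (perpM aC qp).
  rewrite d_adj => e; rewrite /n odotDr odotNr odotZr odotC odotMl oconjK odotC.
  rewrite -[odot (a ** w) _]opprK e; move: (sq i).
  move: ((-1) ^+ i) ((-1) ^+ j) (odot w (d u)) => I J B II.
  by rewrite (_ : - B * I * (I * J) = - B * J * (I * I)); [rewrite II | ]; ring.
have aE' : a = (-1) ^+ j *: '1 by rewrite -[a]oconjK aE oconjZ oconj1.
congr (_, _); first exact: aE'.
rewrite -[b]oconjK.
have -> : oconj b = (-1) ^+ i *: '1.
  move: ab; rewrite aE' scalerA sq scale1r => ->.
  by rewrite scalerA sq scale1r.
by rewrite oconjZ oconj1.
Qed.

Lemma lambda_derivation_plane x : x \in C -> d x = 0.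
Proof.
move=> /planeP[s [t ->]].
by rewrite linearD !linearZ /= d1 lambda_derivation_u !scaler0 addr0.
Qed.

Lemma lambda_derivation_perp x : perp c x -> perp c (d x).
Proof.
move=> xp; apply: perpP => y yC.
by rewrite d_adj lambda_derivation_plane // odot0r oppr0.
Qed.

End Kill.
End Lambda.

(** * Signs of determinants *)

Section Det.
Variable R : realType.

(** Stated for two sizes because the dimensions of two vector spaces are equal
    without being convertible. *)
Lemma det_conj_mx m n (A : 'M[R]_(m, n)) (B : 'M[R]_(n, m)) (M : 'M[R]_n) :
  m = n -> A *m B = 1%:M -> \det (A *m M *m B) = \det M.
Proof.
move=> mn; subst n => AB; rewrite !det_mulmx mulrAC -det_mulmx AB.
by rewrite det1 mul1r.
Qed.

Lemma endo_det_conj (V W : vectType R) (T : 'Hom(V, W)) (S : 'Hom(W, V))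
    (f : 'End(W)) :
  \dim {:V} = \dim {:W} -> cancel T S -> endo_det (S \o (f \o T))%VF = endo_det f.
Proof.
move=> VW TS; rewrite /endo_det.
rewrite !(passmx.mxof_comp (vbasis {:V}) (f := vbasis {:W}) _ (vbasisP _)).
apply: det_conj_mx => //; rewrite -passmx.mxof_comp ?vbasisP //.
rewrite -(passmx.mxof1 (basis_free (vbasisP {:V}))); congr passmx.mxof.
by apply/lfunP => x; rewrite comp_lfunE id_lfunE TS.
Qed.

Lemma endo_detM (V : vectType R) (f g : 'End(V)) :
  endo_det (f \o g)%VF = endo_det f * endo_det g.
Proof.
by rewrite /endo_det (passmx.mxof_comp _ _ (vbasisP _)) det_mulmx mulrC.
Qed.

Lemma endo_det1 (V : vectType R) : endo_det (\1%VF : 'End(V)) = 1.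
Proof. by rewrite /endo_det passmx.mxof1 ?det1 // (basis_free (vbasisP _)). Qed.

Lemma endo_detZ (V : vectType R) k (f : 'End(V)) :
  endo_det (k *: f) = k ^+ \dim {:V} * endo_det f.
Proof.
rewrite /endo_det -detZ; congr (\det _); apply/matrixP => i l.
by rewrite !mxE /= scale_lfunE linearZ.
Qed.

Lemma endo_det_neq0 (V : vectType R) (f g : 'End(V)) : cancel f g -> endo_det f != 0.
Proof.
move=> fg; have : endo_det (g \o f)%VF = 1.
  rewrite -[RHS](endo_det1 V); congr endo_det.
  by apply/lfunP => x; rewrite comp_lfunE id_lfunE fg.
by rewrite endo_detM => /eqP; apply: contraTneq => ->; rewrite mulr0 eq_sym oner_eq0.
Qed.

Lemma sg_det_sqr (V : vectType R) (f g : 'End(V)) :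
  cancel f g -> Num.sg (endo_det (f \o f)%VF) = 1.
Proof.
move=> fg; apply: gtr0_sg; rewrite endo_detM -expr2.
by rewrite exprn_even_gt0 //= (endo_det_neq0 fg).
Qed.

Lemma sg_detZ8 k (f : 'End(octonion R)) : k != 0 ->
  Num.sg (endo_det (k *: f)) = Num.sg (endo_det f).
Proof.
move=> k0; rewrite endo_detZ sgrM dim_octonion gtr0_sg ?mul1r //.
by rewrite exprn_even_gt0.
Qed.

Lemma endo_det_octonion (f : 'End(octonion R)) :
  endo_det f = \det (lin1_mx (f : octonion R -> octonion R)).
Proof.
pose b := vbasis {:octonion R}; have bB := vbasisP {:octonion R}.
have AL : linear (passmx.vecof b : 'rV[R]_(\dim {:octonion R}) -> 'rV[R]_8).
  exact: (@passmx.vecof_linear R (octonion R) b).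
have BL : linear (passmx.rVof b : 'rV[R]_8 -> 'rV[R]_(\dim {:octonion R})).
  exact: (@passmx.rVof_linear _ (octonion R) b).
pose Av : {linear 'rV[R]_(\dim {:octonion R}) -> 'rV[R]_8} :=
  HB.pack (passmx.vecof b : 'rV[R]_(\dim {:octonion R}) -> 'rV[R]_8)
  (GRing.isLinear.Build R 'rV[R]_(\dim {:octonion R}) 'rV[R]_8 *:%R _ AL).
pose Bv : {linear 'rV[R]_8 -> 'rV[R]_(\dim {:octonion R})} :=
  HB.pack (passmx.rVof b : 'rV[R]_8 -> 'rV[R]_(\dim {:octonion R}))
  (GRing.isLinear.Build R 'rV[R]_8 'rV[R]_(\dim {:octonion R}) *:%R _ BL).
rewrite -(det_conj_mx (A := lin1_mx Av) (B := lin1_mx Bv) _ (dim_octonion R)).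
  rewrite /endo_det; congr (\det _); apply/row_matrixP => k.
  rewrite !rowE passmx.mul_mxof !mulmxA (mul_rV_lin1 Av) (mul_rV_lin1 Bv).
  congr (passmx.rVof _ _); apply/esym.
  exact: (mul_rV_lin1 (f : {linear 'rV[R]_8 -> 'rV[R]_8})).
apply/row_matrixP => k; rewrite !rowE mulmxA (mul_rV_lin1 Av) (mul_rV_lin1 Bv).
by rewrite mulmx1; apply: passmx.vecofK; apply: vbasisP.
Qed.

Fact oconj_linear : linear (@oconj R).
Proof. by move=> k x y; rewrite oconjD oconjZ. Qed.

Definition oconj_lfun : 'End(octonion R) :=
  linfun (HB.pack_for {linear octonion R -> octonion R} (@oconj R)
    (GRing.isLinear.Build R (octonion R) (octonion R) *:%R (@oconj R) oconj_linear)).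

Lemma oconj_lfunE x : oconj_lfun x = oconj x.
Proof. by rewrite lfunE. Qed.

Fact omulr_linear (a : octonion R) : linear (fun x => omul x a).
Proof. by move=> k x y; rewrite omulDl omulZl. Qed.

Definition omulr_lfun (a : octonion R) : 'End(octonion R) :=
  linfun (HB.pack_for {linear octonion R -> octonion R} (fun x => omul x a)
    (GRing.isLinear.Build R (octonion R) (octonion R) *:%R
       (fun x => omul x a) (omulr_linear a))).

Lemma omulr_lfunE a x : omulr_lfun a x = omul x a.
Proof. by rewrite lfunE. Qed.

Lemma sg_det_oconj : Num.sg (endo_det oconj_lfun) = -1.
Proof.
rewrite endo_det_octonion.
have -> : lin1_mx (oconj_lfun : octonion R -> octonion R) =
    diag_mx (oct8 1 (-1) (-1) (-1) (-1) (-1) (-1) (-1)).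
  apply/row_matrixP => k; rewrite rowE mul_rV_lin1 /= oconj_lfunE.
  apply/rowP => l; rewrite !mxE.
  have -> (x : octonion R) : oconj x 0 l = x 0 l *
      oct8 1 (-1) (-1) (-1) (-1) (-1) (-1) (-1) 0 l.
    elim/oct8_ind: x => ? ? ? ? ? ? ? ?; rewrite oconj8 !mxE.
    by case: l; do 8 (case=> [|] //=; first by move=> _; ring).
  rewrite !mxE eqxx /= [k == l]eq_sym.
  by case: eqP => [->|_] /=; rewrite ?mul1r ?mul0r ?mulr1n ?mulr0n.
rewrite det_diag !big_ord_recl big_ord0 !mxE /=.
rewrite (_ : _ * _ = -1 :> R); last by ring.
by rewrite sgrN1.
Qed.

Lemma omul_isometry_cancel (a : octonion R) : a != 0 ->
  exists g : 'End(octonion R), cancel (omul_lfun a) g.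
Proof.
move=> a0; exists ((odot a a)^-1 *: omul_lfun (oconj a)) => x.
rewrite scale_lfunE !omul_lfunE omulKl scalerA mulVf ?scale1r //.
by rewrite gt_eqF // odot_gt0.
Qed.

Lemma omul_left_alternative (x y : octonion R) :
  omul x (omul x y) = omul (omul x x) y.
Proof.
have e : x = (odot x (oone R) *+ 2) *: oone R - oconj x.
  by rewrite oconjE opprB addrC subrK.
rewrite omul_sq {1}e omulDl !omulNl omulZl omul1l omulKl.
by rewrite omulDl omulNl !omulZl omul1l.
Qed.

(** With r = |a| one has (r + a)^2 = 2 (r + Re a) a, so L_a is a multiple of a
    square, unless a = - r. *)
Lemma sg_det_omul (a : octonion R) : a != 0 -> Num.sg (endo_det (omul_lfun a)) = 1.
Proof.
move=> a0; pose r := Num.sqrt (odot a a); pose t := odot a (oone R).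
have aa : 0 < odot a a := dot_gt0 (odot_euclidean R) a0.
have r0 : 0 < r by rewrite sqrtr_gt0.
have rr : r * r = odot a a by rewrite -expr2 sqr_sqrtr ?ltW.
have [e|n0] := eqVneq (r *: oone R + a) 0.
  have -> : omul_lfun a = (- r) *: (\1%VF \o \1%VF)%VF.
    apply/lfunP => x; rewrite omul_lfunE scale_lfunE comp_lfunE !id_lfunE.
    have -> : a = - r *: oone R by apply/eqP; rewrite scaleNr -addr_eq0 addrC e.
    by rewrite omulZl omul1l.
  rewrite sg_detZ8 ?oppr_eq0 ?gt_eqF // (sg_det_sqr (g := \1%VF)) // => x.
  by rewrite !id_lfunE.
have [g gK] := omul_isometry_cancel n0.
have sqE : (omul_lfun (r *: oone R + a) \o omul_lfun (r *: oone R + a))%VF =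
    ((r + t) *+ 2) *: omul_lfun a.
  apply/lfunP => x; rewrite comp_lfunE scale_lfunE !omul_lfunE omul_left_alternative.
  have aE : omul a a = (t *+ 2) *: a - (r * r) *: oone R by rewrite rr omul_sq.
  rewrite -omulZl; congr omul.
  rewrite !(omulDl, omulDr, omulZl, omulZr) !(omul1l, omul1r) aE.
  rewrite scalerA !addrA [LHS](ACl ((1*5)*((2*3)*4)))%AC /= subrr add0r -!scalerDl.
  by congr (_ *: _); ring.
have := sg_det_sqr gK; rewrite sqE sg_detZ8 //.
apply: contra_neq n0 => k0; apply: odot_eq0.
have k0' : r + t = 0 by move/eqP: k0; rewrite mulrn_eq0 => /eqP.
rewrite odotDl !odotDr !odotZl !odotZr odot11 [odot _ a]odotC -/t -rr.
by rewrite (_ : _ + _ = 2 * r * (r + t)); [rewrite k0' mulr0 | ring].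
Qed.

Lemma sg_det_omulr (a : octonion R) : a != 0 -> Num.sg (endo_det (omulr_lfun a)) = 1.
Proof.
move=> a0; have a0' : oconj a != 0.
  by apply: contra_neq a0 => e; rewrite -[a]oconjK e -(scale0r a) oconjZ !scale0r.
have -> : omulr_lfun a = (oconj_lfun \o (omul_lfun (oconj a) \o oconj_lfun))%VF.
  apply/lfunP => x; rewrite !comp_lfunE !oconj_lfunE omul_lfunE omulr_lfunE.
  by rewrite oconjM !oconjK.
by rewrite !endo_detM !sgrM sg_det_oconj sg_det_omul // mul1r mulrNN mulr1.
Qed.

Variable c : cayley_triple R.
Local Notation "x ** y" := (omul x y) (at level 40, left associativity).
Local Notation "''1'" := (oone R).
Local Notation u := (cu c).
Local Notation C := (plane_C c).

Lemma circle_sqrt t : t \in circle c -> exists2 s, s \in circle c & s ** s = t.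
Proof.
move=> /circleP[/planeP[a [b ->]]].
rewrite odotDl !odotDr !odotZl !odotZr [odot '1 u]odotC u_1 u_unit odot11 => ab.
have sqE x y : (x *: '1 + y *: u) ** (x *: '1 + y *: u) =
    (x ^+ 2 - y ^+ 2) *: '1 + (2 * x * y) *: u.
  rewrite !(omulDl, omulDr, omulZl, omulZr) !(omul1l, omul1r) uuE !scalerA.
  rewrite scalerN !addrA [LHS](ACl ((1*4)*(2*3)))%AC /= -scalerBl -scalerDl.
  by congr (_ *: _ + _ *: _); ring.
have circ x y : x ^+ 2 + y ^+ 2 = 1 -> x *: '1 + y *: u \in circle c.
  move=> xy; apply/circleP; split; first by apply/planeP; exists x, y.
  rewrite odotDl !odotDr !odotZl !odotZr [odot '1 u]odotC u_1 u_unit odot11.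
  by rewrite -[RHS]xy; ring.
have [a1|a1] := eqVneq a (-1).
  have b0 : b = 0 by apply/eqP; rewrite -sqrf_eq0; apply/eqP; rewrite a1 in ab; lra.
  exists (0 *: '1 + 1 *: u); first by apply: circ; rewrite expr0n expr1n add0r.
  by rewrite sqE a1 b0; congr (_ *: _ + _ *: _); ring.
have a1' : 0 < 1 + a by rewrite lt_neqAle eq_sym addr_eq0 eq_sym eqr_oppLR a1 /=; nra.
pose x := Num.sqrt ((1 + a) / 2).
have xx : x ^+ 2 = (1 + a) / 2 by rewrite sqr_sqrtr // divr_ge0 ?ltW.
have x0 : x != 0 by rewrite -sqrf_eq0 xx gt_eqF // divr_gt0.
have yy : (b / (2 * x)) ^+ 2 = (1 - a) / 2.
  rewrite expr_div_n exprMn xx; have -> : b ^+ 2 = (1 - a) * (1 + a) by lra.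
  by field; rewrite gt_eqF.
exists (x *: '1 + (b / (2 * x)) *: u); first by apply: circ; rewrite xx yy; lra.
by rewrite sqE xx yy; congr (_ *: _ + _ *: _); [lra | field].
Qed.

(** For k = 0 the map is a square.  For k = 1 it is composed with the reflection
    x |-> - u (oconj x u), which is orientation reversing like oconj. *)
Lemma sg_det_lambda (k : 'Z_2) t : t \in circle c ->
  Num.sg (endo_det (linfun (lambda c k t))) = (-1) ^+ k.
Proof.
move=> tS.
have sg0 : Num.sg (endo_det (linfun (lambda c 0 t))) = 1.
  have [s sS st] := circle_sqrt tS.
  have sI x : odot (linfun (lambda c 0 s) x) (linfun (lambda c 0 s) x) = odot x x.
    by rewrite lfunE lambda_isometry.
  have [_ K _] := octonion_isometry_bij sI.
  rewrite -(sg_det_sqr K); congr (Num.sg (endo_det _)); apply/lfunP => x.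
  have [a [b [aC bp ->]]] := plane_decomp c x; have [sC _] := circleP _ _ sS.
  rewrite comp_lfunE !lfunE /= (lambda_split 0 s aC bp) (lambda_split 0 t aC bp).
  by rewrite (lambda_split 0 s (planeM sC aC) bp) /= (perp_mulA _ sC sC) st.
have [->|->] : k = 0 \/ k = 1.
  by case: k => [[|[|k]] Hk] //; [left | right]; apply: val_inj.
  by rewrite sg0 expr0.
have -> : linfun (lambda c 1 t) = (-1) *: (linfun (lambda c 0 t) \o
    (omul_lfun u \o (omulr_lfun u \o oconj_lfun)))%VF.
  apply/lfunP => x; rewrite scale_lfunE !comp_lfunE !lfunE /=.
  have [a [b [aC bp ->]]] := plane_decomp c x.
  have -> : u ** (oconj (a + b) ** u) = - oconj a - b.
    rewrite oconjD omulDl omulDr (perp_conj bp) omulNl (perp_mulr bp (plane_u c)).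
    rewrite (im_conj (u_1 c)) !omulNl opprK im_sql ?u_1 ?u_unit //.
    rewrite (planeMC (plane_conj aC) (plane_u c)) im_sql ?u_1 ?u_unit //.
  have nC : - oconj a \in C by rewrite rpredN plane_conj.
  rewrite (lambda_split 1 t aC bp) (lambda_split 0 t nC (perpN bp)) /=.
  by rewrite omulNr scaleN1r opprD !opprK.
have u0 := ounit_neq0 (u_unit c).
rewrite sg_detZ8 ?oppr_eq0 ?oner_neq0 // !endo_detM !sgrM sg0.
rewrite sg_det_omul ?sg_det_omulr //.
by rewrite sg_det_oconj !mul1r expr1.
Qed.

Lemma isotope_double_sign (i j : 'Z_2) (f g : {linear octonion R -> octonion R}) :
  (forall x, odot (f x) (f x) = odot x x) ->
  (forall x, odot (g x) (g x) = odot x x) ->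
  Num.sg (endo_det (linfun f)) = (-1) ^+ j ->
  Num.sg (endo_det (linfun g)) = (-1) ^+ i ->
  has_double_sign (isotope f g) i j.
Proof.
move=> fI gI fs gs a a0.
have nz (h : octonion R -> octonion R) (x : octonion R) :
    odot (h x) (h x) = odot x x -> x != 0 -> h x != 0.
  move=> hx; apply: contra_neq => h0; apply: odot_eq0.
  by rewrite -hx h0 odot0l.
have -> : lmult (A := isotope f g) a =
    (omul_lfun (f a) \o linfun g)%VF :> 'End(octonion R).
  apply/lfunP => x; rewrite [RHS]comp_lfunE omul_lfunE [X in _ ** X]lfunE.
  exact: (lmultE (A := isotope f g)).
have -> : rmult (A := isotope f g) a =
    (omulr_lfun (g a) \o linfun f)%VF :> 'End(octonion R).
  apply/lfunP => x; rewrite [RHS]comp_lfunE omulr_lfunE [X in X ** _]lfunE.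
  exact: (rmultE (A := isotope f g)).
rewrite !endo_detM !sgrM sg_det_omul ?sg_det_omulr ?fs ?gs ?mul1r //.
  exact: nz.
exact: nz.
Qed.

Lemma double_sign_iso (A B : algebra R) (T : 'Hom(A, B)) (S : 'Hom(B, A)) i j :
  cancel T S -> cancel S T -> \dim {:A} = \dim {:B} ->
  (forall x y, T (amul A x y) = amul B (T x) (T y)) ->
  has_double_sign B i j -> has_double_sign A i j.
Proof.
move=> TS ST AB TM Bs a a0.
have Ta0 : T a != 0 by apply: contra_neq a0 => Ta; rewrite -(TS a) Ta linear0.
have [<- <-] := Bs _ Ta0; rewrite -!(endo_det_conj _ AB TS); split.
  congr (Num.sg (endo_det _)); apply/lfunP => x.
  by rewrite !comp_lfunE !lmultE -TM TS.
congr (Num.sg (endo_det _)); apply/lfunP => x.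
by rewrite !comp_lfunE !rmultE -TM TS.
Qed.

End Det.

(** * The functor is well defined *)

Section Objects.
Variables (R : realType) (c : cayley_triple R).
Local Notation "x ** y" := (omul x y) (at level 40, left associativity).
Local Notation "''1'" := (oone R).
Local Notation u := (cu c).
Local Notation C := (plane_C c).

Lemma isotope_A8 (f g : {linear octonion R -> octonion R}) :
  (forall x, odot (f x) (f x) = odot x x) ->
  (forall x, odot (g x) (g x) = odot x x) ->
  in_A8 (isotope f g).
Proof.
move=> fI gI.
have M0 (x y : octonion R) : f x ** g y = 0 -> x = 0 \/ y = 0.
  move=> xy; have : odot (f x ** g y) (f x ** g y) = 0.
    by rewrite xy odot0l.
  rewrite odotMM fI gI => /eqP; rewrite mulf_eq0.
  by move=> /orP[/eqP/odot_eq0|/eqP/odot_eq0]; [left | right].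
split; first exact: dim_octonion.
- split=> [|a a0]; first by exists '1; exact: ounit_neq0 (odot11 R).
  have bij (h : 'End(isotope f g)) : (forall x, h x = 0 -> x = 0) -> bijective h.
    move=> h0; have k0 : lker h == 0%VS.
      by rewrite -subv0; apply/subvP => x; rewrite memv_ker memv0 => /eqP/h0/eqP.
    by exists h^-1%VF; [exact: lker0_lfunK | exact: lker0_lfunVK].
  split; apply: bij => x; rewrite ?lmultE ?rmultE => /M0[] // e.
    by rewrite e eqxx in a0.
  by rewrite e eqxx in a0.
- exists (fun x : octonion R => odot x x).
  have pE (x y : octonion R) :
      polar (fun x : octonion R => odot x x) x y = odot x y *+ 2.
    by rewrite /polar odotDl !odotDr (odotC y x) mulr2n; ring.
  split=> [|x xy|x y]; last by rewrite /= /isotope_mul odotMM fI gI.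
    split=> [k x|x y t|k x y]; first by rewrite odotZl odotZr mulrA.
      by rewrite !pE odotDl mulrnDl.
    by rewrite !pE odotZl mulrnAr.
  apply: odot_eq0; have := xy x; rewrite pE => /eqP.
  by rewrite mulrn_eq0 => /eqP.
Qed.

Lemma proj_C_id x : x \in C -> proj_C c x = x.
Proof.
move=> xC; apply/esym/eqP; rewrite -subr_eq0; apply/eqP.
by apply: plane_perp0 (proj_C_perp c x); rewrite rpredB ?proj_C_plane.
Qed.

Lemma dim_perp_space : \dim (perp_space c) = 6.
Proof.
have := limg_ker_dim (linfun (proj_C c)) {:octonion R}.
rewrite capfv dim_octonion.
have -> : limg (linfun (proj_C c)) = C.
  apply/eqP; rewrite eqEsubv; apply/andP; split; apply/subvP => x.
    by move=> /memv_imgP[y _ ->]; rewrite lfunE proj_C_plane.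
  move=> xC; have <- : linfun (proj_C c) x = x by rewrite lfunE /= proj_C_id.
  by rewrite memv_img ?memvf.
by rewrite dim_plane => /(congr1 (subn^~ 2%N)); rewrite addnK.
Qed.

Lemma plane_perp_full : (C + perp_space c)%VS = {:octonion R}%VS.
Proof.
apply/eqP; rewrite eqEsubv subvf /=; apply/subvP => x _.
have [a [b [aC /perp_spaceP bp ->]]] := plane_decomp c x.
exact: memv_add.
Qed.

Lemma der_irreducible_line (A : algebra R) (x : A) : x != 0 ->
  (forall d : 'End(A), derivation d -> d x = 0) -> der_irreducible <[x]>%VS.
Proof.
move=> x0 dx; split=> [d dD|| W _ Wx].
- by rewrite limg_line dx // sub0v.
- by rewrite -dimv_eq0 dim_vline x0.
- have [->|W0] := eqVneq W 0%VS; first by left.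
  right; apply/eqP; rewrite eqEdim Wx dim_vline x0 /= lt0n dimv_eq0.
  exact: W0.
Qed.

Lemma lambda_der_components (i j : 'Z_2) a b : circle_pairs_pred c i j (a, b) ->
  der_components (isotope (lambda c j a) (lambda c i b)) [:: 1; 1; 6]%N.
Proof.
move=> /and3P[/= aS bS abN].
have kill := lambda_derivation_plane aS bS abN.
pose U (k : 'I_3) : {vspace octonion R} :=
  nth 0%VS [:: <['1]>%VS; <[u]>%VS; perp_space c] k.
have sumU : (\sum_k U k)%VS = {:octonion R}%VS.
  rewrite !big_ord_recl big_ord0 addv0 -plane_perp_full /U /=.
  by rewrite addvA.
have dimU (k : 'I_3) : \dim (U k) = nth 0%N [:: 1; 1; 6]%N k.
  rewrite /U; case: k => [[|[|[|k]]] Hk] //=.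
  - by rewrite dim_vline ounit_neq0 // odot11.
  - by rewrite dim_vline ounit_neq0 // u_unit.
  - exact: dim_perp_space.
have aC : a \in C by case/circleP: aS.
have bC : b \in C by case/circleP: bS.
exists U; split=> //.
- move=> [[|[|[|k]]] Hk] //; rewrite /U /=.
  + apply: der_irreducible_line => [|d dD]; first exact: ounit_neq0 (odot11 R).
    exact: kill dD _ (plane1 c).
  + apply: der_irreducible_line => [|d dD]; first exact: ounit_neq0 (u_unit c).
    exact: kill dD _ (plane_u c).
  split=> [d dD||W WD Wp].
  + apply/subvP => _ /memv_imgP[x /perp_spaceP xp ->]; apply/perp_spaceP.
    exact: (lambda_derivation_perp aS bS abN dD xp).
  + by rewrite -dimv_eq0 dim_perp_space.
  have [->|W0] := eqVneq W 0%VS; first by left.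
  right; apply/eqP; rewrite eqEsubv Wp /=; apply/subvP => x /perp_spaceP xp.
  apply: (su3_irreducible _ (memv_pick W)) xp.
  + move=> d dS; apply: WD; apply: su3_derivation_isotope dS _ _ _ _ => y yP.
    * exact: lambda_plane.
    * exact: lambda_fix.
    * exact: lambda_plane.
    * exact: lambda_fix.
  + by rewrite vpick0.
  + by apply/perp_spaceP/(subvP Wp)/memv_pick.
- rewrite directvE /= sumU dim_octonion.
  by rewrite !big_ord_recl big_ord0 !dimU.
Qed.

Lemma F_obj_D116 (i j : 'Z_2) (p : circle_pairs c i j) : in_D116ij i j (F_obj p).
Proof.
case: p => [[a b] abP]; have /and3P[/= aS bS abN] := abP.
have aC : a \in C by case/circleP: aS.
have bC : b \in C by case/circleP: bS.
have fI x := lambda_isometry j x aS; have gI x := lambda_isometry i x bS.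
split; last by apply: isotope_double_sign => //; apply: sg_det_lambda.
split; last exact: lambda_der_components.
split; first exact: isotope_A8.
have [d [d' [dS dS' dd']]] := su3_nonabelian c.
exists d, d'; split=> //; apply: (su3_derivation_isotope (c := c)) => // y yP;
  by [exact: lambda_plane | exact: lambda_fix].
Qed.

(** Every x satisfies x^2 = 2 <x, 1> x - |x|^2.  An automorphism preserves this
    equation for x orthogonal to 1, where it has no linear term, and the image
    of x cannot be a real scalar. *)
Lemma g2_isometry (F : G2 R) x : odot (F x) (F x) = odot x x.
Proof.
have im y : odot y '1 = 0 -> odot (F y) '1 = 0 /\ odot (F y) (F y) = odot y y.
  move=> y1; have := omul_sq y; rewrite y1 mul0rn scale0r sub0r.
  move=> /(congr1 F); rewrite g2M linearN linearZ /= g2_fix1 omul_sq => e.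
  have [t0|t0] := eqVneq (odot (F y) '1) 0.
    split=> //; move: e; rewrite t0 mul0rn scale0r sub0r => /oppr_inj.
    by move=> /(congr1 (odot '1)); rewrite !odotZr odot11 !mulr1.
  have [s Fy] : exists s, F y = s *: '1.
    exists ((odot (F y) (F y) - odot y y) / (odot (F y) '1 *+ 2)).
    have e2 : (odot (F y) '1 *+ 2) *: F y = (odot (F y) (F y) - odot y y) *: '1.
      by rewrite scalerBl -e addrC subrK.
    by rewrite mulrC -scalerA -e2 scalerA mulVf ?scale1r // mulrn_eq0.
  have : s ^+ 2 + odot y y = 0.
    have := congr1 (odot '1) e; rewrite Fy odotDr !odotNr !odotZr !odotZl odot11.
    by rewrite expr2 mulr2n => h; nra.
  move/eqP; rewrite paddr_eq0 ?odot_ge0 ?sqr_ge0 //.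
  by rewrite sqrf_eq0 => /andP[/eqP s0 _]; case/eqP: t0; rewrite Fy s0 odotZl mul0r.
pose t := odot x '1; have y1 : odot (x - t *: '1) '1 = 0.
  by rewrite odotDl odotNl odotZl odot11 mulr1 subrr.
have [Fy1 FyI] := im _ y1.
have pyth y (s : R) : odot y '1 = 0 ->
    odot (y + s *: '1) (y + s *: '1) = odot y y + s ^+ 2.
  move=> y0; rewrite odotDl !odotDr !odotZl !odotZr [odot '1 y]odotC y0 odot11.
  by ring.
move: y1 Fy1 FyI; set y := x - _ => y1 Fy1 FyI.
have -> : x = y + t *: '1 by rewrite subrK.
by rewrite linearD linearZ /= g2_fix1 !pyth // FyI.
Qed.

Lemma g2_dot (F : G2 R) x y : odot (F x) (F y) = odot x y.
Proof. exact: odot_isometry (g2_isometry F) x y. Qed.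

Lemma g2_Kpow_plane (F : G2 R) (e : 'Z_2) x :
  F u = (-1) ^+ e *: u -> x \in C -> F x = Kpow e x.
Proof.
move=> Fu /planeP[s [t ->]]; rewrite linearD !linearZ /= Fu g2_fix1.
have [[K ->]|[K ->]] := Kpow_cases R e; rewrite K ?scale1r //.
by rewrite oconjD !oconjZ oconj1 (im_conj (u_1 c)) scaleN1r.
Qed.

Lemma g2_perp (F : G2 R) (e : 'Z_2) x :
  F u = (-1) ^+ e *: u -> perp c x -> perp c (F x).
Proof.
move=> Fu xp; apply: perpP => y yC.
have -> : y = F (Kpow e y).
  by rewrite (g2_Kpow_plane Fu) ?KpowK // Kpow_plane.
by rewrite g2_dot (perp_plane xp) // Kpow_plane.
Qed.

Lemma g2_lambda (F : G2 R) (e k : 'Z_2) t x :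
  F u = (-1) ^+ e *: u -> t \in C ->
  F (lambda c k t x) = lambda c k (Kpow e t) (F x).
Proof.
move=> Fu tC; have [a [b [aC bp ->]]] := plane_decomp c x.
rewrite (lambda_split k t aC bp) [F (_ ** _ + b)]linearD [F (a + b)]linearD /= g2M.
have FaC : F a \in C by rewrite (g2_Kpow_plane Fu) // Kpow_plane.
rewrite (lambda_split k _ FaC (g2_perp Fu bp)).
rewrite (g2_Kpow_plane Fu tC) (g2_Kpow_plane Fu (Kpow_plane k aC)).
rewrite (g2_Kpow_plane Fu aC); congr (_ ** _ + _).
have [[K _]|[K _]] := Kpow_cases R e; have [[L _]|[L _]] := Kpow_cases R k;
  by rewrite !(K, L).
Qed.

Lemma hat_su3_u (g : SU3_Z2 c) :
  (su3val g.1 * hat c g.2)%g u = (-1) ^+ g.2 *: u.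
Proof.
have [hu _ _] := hatE c g.2.
by rewrite g2_mulE hu linearZ /= su3P.
Qed.

Lemma F_hom_morphism (i j : 'Z_2) (p q : circle_pairs c i j) (g : SU3_Z2 c) :
  circle_action c i j g p = q -> is_morphism (F_hom p q g).
Proof.
move=> e; have qE : sval q = (Kpow g.2 (sval p).1, Kpow g.2 (sval p).2) by rewrite -e.
have /and3P[/= /circleP[aC _] /circleP[bC _] _] := svalP p.
have Fu := hat_su3_u g; set F := (su3val g.1 * hat c g.2)%g in Fu; split.
  apply/eqP => F0; have := g2_fix1 F.
  move/lfunP/(_ '1): F0; rewrite zero_lfunE => F0.
  move/esym/eqP; rewrite [F '1]F0.
  by rewrite (negPf (ounit_neq0 (odot11 R))).
move=> x y.
have -> : F_hom p q g = F :> 'End(octonion R) by [].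
rewrite /= /isotope_mul qE /= -!(g2_lambda _ _ Fu) //.
exact: (g2M F).
Qed.

End Objects.

(** * The functor is full *)

Section Full.
Variables (R : realType) (c : cayley_triple R).
Local Notation "x ** y" := (omul x y) (at level 40, left associativity).
Local Notation "''1'" := (oone R).
Local Notation u := (cu c).
Local Notation v := (cv c).
Local Notation C := (plane_C c).

Lemma derivation_conj (A B : algebra R) (T : 'Hom(A, B)) (S : 'Hom(B, A))
    (d : 'End(B)) :
  cancel T S -> cancel S T -> (forall x y, T (amul A x y) = amul B (T x) (T y)) ->
  derivation d -> derivation (S \o (d \o T))%VF.
Proof.
move=> TS ST TM dD x y; apply: (can_inj TS).
have STx z : T (S z) = z by exact: ST.
have TD z z' : T (z + z') = T z + T z' by exact: linearD.
by rewrite !comp_lfunE STx TD !TM !STx dD.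
Qed.

Lemma su3_invariant w : perp c w ->
  (forall d, su3_derivation c d -> d w = 0) -> w = 0.
Proof.
move=> wp dw; have [//|w0] := eqVneq w 0.
have : (perp_space c <= <[w]>)%VS.
  apply/subvP => x /perp_spaceP; apply: (su3_irreducible (n := w)) => //.
    by move=> d dS; rewrite limg_line dw // sub0v.
  exact: memv_line.
by move/dimvS; rewrite dim_perp_space dim_vline; case: (w != 0).
Qed.

Section Morphism.
Variables (i j : 'Z_2) (a b a' b' : octonion R).
Hypotheses (abP : circle_pairs_pred c i j (a, b))
           (abP' : circle_pairs_pred c i j (a', b')).
Local Notation f := (lambda c j a).
Local Notation g := (lambda c i b).
Local Notation f' := (lambda c j a').
Local Notation g' := (lambda c i b').
Variable phi : 'End(octonion R).
Hypothesis phi_mor : is_morphism (A := isotope f g) (B := isotope f' g') phi.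

Let aS : a \in circle c. Proof. by case/and3P: abP. Qed.
Let bS : b \in circle c. Proof. by case/and3P: abP. Qed.
Let abN : (a, b) != ((-1) ^+ j *: '1, (-1) ^+ i *: '1).
Proof. by case/and3P: abP. Qed.
Let aS' : a' \in circle c. Proof. by case/and3P: abP'. Qed.
Let bS' : b' \in circle c. Proof. by case/and3P: abP'. Qed.
Let abN' : (a', b') != ((-1) ^+ j *: '1, (-1) ^+ i *: '1).
Proof. by case/and3P: abP'. Qed.
Let aC : a \in C. Proof. by case/circleP: aS. Qed.
Let bC : b \in C. Proof. by case/circleP: bS. Qed.
Let aC' : a' \in C. Proof. by case/circleP: aS'. Qed.
Let bC' : b' \in C. Proof. by case/circleP: bS'. Qed.

Let phiM x y : phi (f x ** g y) = f' (phi x) ** g' (phi y).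
Proof. by case: phi_mor => _; apply. Qed.

Let phi_inj : injective phi.
Proof.
have [_ divA _] := isotope_A8 (fun x => lambda_isometry j x aS)
  (fun x => lambda_isometry i x bS).
exact: (morphism_inj divA phi_mor).
Qed.

Let phi_ker : lker phi == 0%VS. Proof. exact/lker0P. Qed.
Let phiK : cancel phi phi^-1%VF. Proof. exact: lker0_lfunK. Qed.
Let phiVK : cancel phi^-1%VF phi. Proof. exact: lker0_lfunVK. Qed.

Let psiM (x y : octonion R) :
  phi^-1%VF (f' x ** g' y) = f (phi^-1%VF x) ** g (phi^-1%VF y).
Proof. by apply: phi_inj; rewrite phiVK phiM !phiVK. Qed.

Let su3_src d : su3_derivation c d -> derivation (A := isotope f g) d.
Proof.
move=> dS; apply: (su3_derivation_isotope (c := c)) => // x xP;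
  by [exact: lambda_plane | exact: lambda_fix].
Qed.
Let su3_tgt d : su3_derivation c d -> derivation (A := isotope f' g') d.
Proof.
move=> dS; apply: (su3_derivation_isotope (c := c)) => // x xP;
  by [exact: lambda_plane | exact: lambda_fix].
Qed.

(** The image of an invariant is an invariant. *)
Let phi_plane x : x \in C -> phi x \in C.
Proof.
move=> xC; have [s [w [sC wp e]]] := plane_decomp c (phi x).
suff w0 : w = 0 by rewrite e w0 addr0.
apply: su3_invariant wp _ => d dS.
have dD := @derivation_conj (isotope f g) (isotope f' g') phi phi^-1%VF d
  phiK phiVK phiM (su3_tgt dS).
have := lambda_derivation_plane aS bS abN dD xC.
rewrite !comp_lfunE => /(congr1 phi); rewrite phiVK linear0 e linearD /=.
by rewrite (dS.2 _ sC) add0r.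
Qed.

(** The complement is spanned by values of derivations, and phi maps values of
    derivations to such values. *)
Let phi_perp x : perp c x -> perp c (phi x).
Proof.
move=> xp; pose W := (phi @^-1: perp_space c :&: perp_space c)%VS.
have WP y : y \in W <-> perp c (phi y) /\ perp c y.
  rewrite memv_cap -memv_preim.
  split=> [/andP[/perp_spaceP ? /perp_spaceP]|[/perp_spaceP-> /perp_spaceP->]] //.
have dW d y : su3_derivation c d -> d y \in W.
  move=> dS; apply/WP; split; last exact: su3_derivation_perp.
  have dD := @derivation_conj (isotope f' g') (isotope f g) phi^-1%VF phi d
    phiVK phiK psiM (su3_src dS).
  have -> : phi (d y) = (phi \o (d \o phi^-1))%VF (phi y) by rewrite !comp_lfunE phiK.
  have [s [w [sC wp ->]]] := plane_decomp c (phi y).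
  rewrite linearD /= (lambda_derivation_plane aS' bS' abN' dD sC) add0r.
  exact: (lambda_derivation_perp aS' bS' abN' dD wp).
have [d dS dv] : exists2 d, su3_derivation c d & d v != 0.
  apply: contrapT => nd; have := ounit_neq0 (v_unit c); apply/negP/negPn/eqP.
  apply: su3_invariant (perp_v c) _ => d dS; apply: contrapT => /eqP dv.
  by apply: nd; exists d.
suff /WP[] : x \in W by [].
apply: (su3_irreducible _ (dW d v dS)) xp => //; last exact: su3_derivation_perp.
by move=> e eS; apply/subvP => _ /memv_imgP[t _ ->]; apply: dW.
Qed.

Let phi_sq w : perp c w -> odot (phi w) (phi w) *: '1 = odot w w *: phi '1.
Proof.
move=> wp; have := phiM w w.
rewrite !(lambda_fix _ _ wp) !(lambda_fix _ _ (phi_perp wp)).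
rewrite (perp_sq wp) (perp_sq (phi_perp wp)) linearN linearZ /=.
by move/oppr_inj.
Qed.

Let vp := perp_v c.

(** By [phi_sq] the map phi multiplies '1 and the norms of vectors orthogonal
    to C by the same n.  Products of C with the complement show that it is
    isometric on C, so n = 1. *)
Let phi_isometry : phi '1 = '1 /\
  forall x, odot (phi x) (phi x) = odot x x.
Proof.
pose n := odot (phi v) (phi v).
have p1 : phi '1 = n *: '1 by rewrite phi_sq // v_unit scale1r.
have pw w : perp c w -> odot (phi w) (phi w) = n * odot w w.
  move=> wp; have := phi_sq wp; rewrite p1 scalerA => /(congr1 (odot '1)).
  by rewrite !odotZr odot11 !mulr1 mulrC.
have n0 : n != 0.
  rewrite gt_eqF // odot_gt0 //.
  apply: contraNneq (ounit_neq0 (v_unit c)) => e.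
  by apply/eqP/phi_inj; rewrite e linear0.
have ps s : s \in C -> odot (phi s) (phi s) = odot s s.
  move=> sC; have := congr1 (fun x => odot x x) (phiM s v).
  rewrite !(lambda_fix _ _ vp) (lambda_fix _ _ (phi_perp vp)) /=.
  rewrite (pw _ (perpM (lambda_plane j aC sC) vp)) !odotMM !lambda_isometry //.
  rewrite v_unit mulr1.
  by rewrite -/n [RHS]mulrC => /(mulfI n0).
have n1 : n = 1.
  have := ps _ (plane1 c); rewrite p1 odotZl odotZr odot11 mulr1 => nn.
  have ge0 : 0 <= n := odot_ge0 _.
  by apply/eqP; rewrite -(@eqrXn2 _ 2%N) ?ler01 // expr1n expr2 nn.
split=> [|x]; first by rewrite p1 n1 scale1r.
have [s [w [sC wp ->]]] := plane_decomp c x.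
rewrite linearD /= (pythagoras (phi_plane sC) (phi_perp wp)) (pythagoras sC wp).
by rewrite ps // pw // n1 mul1r.
Qed.

Let phi1 : phi '1 = '1. Proof. by case: phi_isometry. Qed.
Let phiI x : odot (phi x) (phi x) = odot x x. Proof. by case: phi_isometry. Qed.

Let omul_fix x w : x ** w = w -> w != 0 -> x = '1.
Proof.
by move=> e w0; rewrite -['1]scale1r; apply: omul_eq_scalar w0; rewrite scale1r.
Qed.

Let phi_v0 : phi v != 0.
Proof. by apply: ounit_neq0; rewrite phiI v_unit. Qed.

Let lambda_preim1 k t : t \in circle c ->
  exists2 x, x \in C & lambda c k t x = '1.
Proof.
move=> /circleP[tC tt]; have xC : Kpow k (oconj t) \in C.
  by rewrite Kpow_plane ?plane_conj.
by exists (Kpow k (oconj t)); rewrite // lambda_in // KpowK (plane_inv tC tt).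
Qed.

(** If g y = '1 then f is the right multiplication by y in the isotope; that
    phi y has the same property is seen on a vector orthogonal to C. *)
Let phi_f x : phi (f x) = f' (phi x).
Proof.
have [y yC gy] := lambda_preim1 i bS.
have k t : phi (f t) = f' (phi t) ** g' (phi y) by rewrite -phiM gy omul1r.
suff g1 : g' (phi y) = '1 by rewrite k g1 omul1r.
have gC : g' (phi y) \in C by rewrite lambda_plane ?phi_plane.
have := k v; rewrite (lambda_fix _ _ vp) (lambda_fix _ _ (phi_perp vp)).
rewrite (perp_mulr (phi_perp vp) gC) => /esym e.
by rewrite -[LHS]oconjK (omul_fix e phi_v0) oconj1.
Qed.

Let phi_g x : phi (g x) = g' (phi x).
Proof.
have [y yC fy] := lambda_preim1 j aS.
have k t : phi (g t) = f' (phi y) ** g' (phi t) by rewrite -phiM fy omul1l.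
suff f1 : f' (phi y) = '1 by rewrite k f1 omul1l.
have := k v; rewrite (lambda_fix _ _ vp) (lambda_fix _ _ (phi_perp vp)).
by move=> /esym e; apply: omul_fix e phi_v0.
Qed.

Let lambda_surj k t x : t \in circle c -> exists y, lambda c k t y = x.
Proof.
move=> tS.
have LI y : odot (linfun (lambda c k t) y) (linfun (lambda c k t) y) = odot y y.
  by rewrite lfunE lambda_isometry.
have [_ _ KL] := octonion_isometry_bij LI.
by exists ((linfun (lambda c k t))^-1%VF x); rewrite -[RHS]KL lfunE.
Qed.

Let phi_oaut : is_oaut phi.
Proof.
split=> [|x y]; first by exists phi^-1%VF.
have [x' <-] := lambda_surj j x aS; have [y' <-] := lambda_surj i y bS.
by rewrite phiM phi_f phi_g.
Qed.

Lemma isotope_morphism_full : exists (rho : SU3 c) (e : 'Z_2),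
  phi = (su3val rho * hat c e)%g /\ (a', b') = (Kpow e a, Kpow e b).
Proof.
pose F := MkG2 (asboolT phi_oaut : `[< is_oaut phi >]).
have [e Fu] : exists e : 'Z_2, F u = (-1) ^+ e *: u.
  have /planeP[s [t uE]] := phi_plane (plane_u c).
  have s0 : s = 0.
    have : odot (phi u) (phi '1) = odot u '1.
      exact: (odot_isometry phiI).
    rewrite phi1 u_1 uE odotDl !odotZl odot11 u_1 => h; lra.
  have tt : t * t = 1.
    have := phiI u; rewrite uE s0 scale0r add0r odotZl odotZr u_unit => h; lra.
  have [t1|t1] := eqVneq t 1.
    by exists 0; rewrite expr0 /= uE s0 t1 scale0r add0r.
  exists 1; rewrite expr1 /= uE s0 scale0r add0r; congr (_ *: _).
  apply/eqP; rewrite -addr_eq0; apply/eqP; apply: (mulfI (_ : t - 1 != 0)).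
    by rewrite subr_eq0.
  by rewrite mulr0; lra.
have FaE x : x \in C -> phi x = Kpow e x := g2_Kpow_plane (F := F) Fu.
have [hu _ _] := hatE c e.
have rhoP : (F * hat c e)%g u == u.
  rewrite g2_mulE hu linearZ /= -[phi u]/(F u) Fu scalerA.
  by rewrite -exprD addnn -signr_odd odd_double scale1r.
exists (MkSU3 rhoP), e; split.
  by rewrite -[RHS]/(g2val (F * hat c e * hat c e)%g) -mulgA hatK mulg1.
have := phi_f '1; rewrite phi1 !lambda_in ?plane1 // !Kpow_one !omul1r FaE // => <-.
have := phi_g '1; rewrite phi1 !lambda_in ?plane1 // !Kpow_one !omul1r FaE // => <-.
by [].
Qed.

End Morphism.
End Full.

(** * The functor is essentially surjective *)

Section Components.
Variables (R : realType) (A : algebra R) (dot : A -> A -> R).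
Hypotheses (Ad : composition_dot dot) (A8 : \dim {:A} = 8%N).
Hypothesis d_skew : forall (d : 'End(A)) x, derivation d -> dot x (d x) = 0.

(** A line that is a submodule is killed, as derivations are skew.  The third
    component contains no invariant, being irreducible and not a line. *)
Lemma derivation_plane : der_components A [:: 1; 1; 6]%N ->
  exists P : {vspace A}, [/\ \dim P = 2%N,
    forall x, x \in P <-> forall d, derivation d -> d x = 0
    & forall W, der_submodule W -> (W <= P)%VS \/ (W + P)%VS = fullv].
Proof.
case=> U [Uirr Udim Udir Usum].
pose k0 : 'I_3 := ord0; pose k1 : 'I_3 := lift ord0 ord0.
pose k2 : 'I_3 := lift ord0 (lift ord0 ord0).
have [dotE _] := Ad.
have line k : \dim (U k) = 1%N -> forall x d, x \in U k -> derivation d -> d x = 0.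
  move=> Uk x d xU dD; have [->|x0] := eqVneq x 0; first exact: linear0.
  have UE : U k = <[x]>%VS.
    apply/eqP; rewrite eq_sym eqEdim dim_vline x0 Uk /= andbT.
    by rewrite -memvE.
  have [Us _ _] := Uirr k.
  have := subvP (Us d dD) (d x) (memv_img d xU); rewrite UE => /vlineP[l dx].
  have := d_skew x dD; rewrite dx (dotZr dotE) => /eqP; rewrite mulf_eq0.
  by rewrite [dot x x == 0]gt_eqF ?(dot_gt0 dotE) // orbF => /eqP ->; rewrite scale0r.
pose P := (U k0 + U k1)%VS.
have PU : (P + U k2)%VS = fullv.
  by rewrite -Usum !big_ord_recl big_ord0 addv0 /P addvA.
have dimP : \dim P = 2%N.
  apply/eqP; rewrite eqn_leq; apply/andP; split.
    by apply: leq_trans (dimv_add_leqif _ _) _; rewrite !Udim.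
  have := dimv_add_leqif P (U k2); rewrite PU A8 Udim /= => -[h _].
  by rewrite -(leq_add2r 6).
have Pkill x d : x \in P -> derivation d -> d x = 0.
  move=> /memv_addP[y yU [z zU ->]] dD.
  by rewrite linearD /= (line k0) ?(line k1) ?addr0 ?Udim.
have cap0 : (P :&: U k2)%VS = 0%VS.
  apply/eqP; rewrite -dimv_eq0.
  have := dimv_sum_cap P (U k2); rewrite PU A8 dimP Udim /=.
  by move=> /(congr1 (subn^~ 8%N)); rewrite addKn => ->.
have irr W : der_submodule W -> (W <= P)%VS \/ (W + P)%VS = fullv.
  move=> Wsub; have [U2s _ U2irr] := Uirr k2.
  have [d dD||W0|W2] := U2irr ((W + P) :&: U k2)%VS.
  - rewrite (subv_trans (limg_cap _ _ _)) // capvS ?U2s //.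
    rewrite limgD addvS ?Wsub //; apply/subvP => _ /memv_imgP[x xP ->].
    by rewrite Pkill // mem0v.
  - exact: capvSr.
  - left; apply/subvP => x xW.
    have : x \in (P + U k2)%VS by rewrite PU memvf.
    move=> /memv_addP[s sP [t tU xE]].
    suff : t \in 0%VS by rewrite memv0 => /eqP t0; rewrite xE t0 addr0.
    rewrite -W0 memv_cap tU andbT.
    have -> : t = x - s by rewrite xE addrC addKr.
    by rewrite memv_add // rpredN.
  - right; apply/eqP; rewrite eqEsubv subvf /= -PU subv_add addvSr /=.
    by rewrite -W2 capvSl.
exists P; split=> // x; split=> [xP d|xk]; first exact: Pkill.
have [|xP|xP] := irr <[x]>%VS; last 2 first.
- by rewrite memvE.
- have := dimv_add_leqif <[x]>%VS P; rewrite xP A8 dimP dim_vline => -[].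
  by case: (x != 0).
by move=> d dD; rewrite limg_line xk // sub0v.
Qed.

End Components.

Section Essential.
Variables (R : realType) (c : cayley_triple R) (A : algebra R) (dot : A -> A -> R).
Local Notation "x ** y" := (omul x y) (at level 40, left associativity).
Local Notation "''1'" := (oone R).
Local Notation u := (cu c).
Local Notation v := (cv c).
Local Notation C := (plane_C c).
Hypotheses (Ad : composition_dot dot) (A8 : \dim {:A} = 8%N).
Variable P : {vspace A}.
Hypothesis dimP : \dim P = 2%N.
Hypothesis PP : forall x, x \in P <-> forall d, derivation d -> d x = 0.
Hypothesis P_irr : forall W, der_submodule W -> (W <= P)%VS \/ (W + P)%VS = fullv.

Let dotE : euclidean dot. Proof. by case: Ad. Qed.

Let PM x y : x \in P -> y \in P -> amul A x y \in P.
Proof.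
move=> /PP xP /PP yP; apply/PP => d dD.
by rewrite dD xP // yP // linear0l linear0r addr0.
Qed.

Lemma kaplansky_plane (e1 e2 : A) :
  e1 \in P -> e2 \in P -> dot e1 e1 = 1 -> dot e2 e2 = 1 ->
  exists (T : 'Hom(octonion R, A)) (f g : 'End(octonion R)),
  [/\ forall x, dot (T x) (T x) = odot x x,
      forall x, (T x \in P) = (x \in C),
      forall x, odot (f x) (f x) = odot x x /\ odot (g x) (g x) = odot x x,
      forall x, T (f x) = amul A (T x) e1 /\ T (g x) = amul A e2 (T x)
    & forall x y, T (f x ** g y) = amul A (T x) (T y)].
Proof.
move=> e1P e2P e11 e22.
have [u' [uP uu uO]] : exists u', [/\ u' \in P, dot u' u' = 1 &
    forall y, y \in [:: amul A e2 e1] -> dot u' y = 0].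
  by apply: exists_unit_orthogonal_in; rewrite ?dimP.
have [T [f [g [TI [T1 Tu] fgI fgE TM]]]] :=
  kaplansky_isotope c Ad A8 e11 e22 uu (uO _ (mem_head _ _)).
exists T, f, g; split=> //.
have [Tinj _ _] := isometry_octonion_bij dotE A8 TI.
have TC : (T @: C)%VS = P.
  apply/eqP; rewrite eqEdim limg_dim_eq ?dim_plane ?dimP ?andbT; last first.
    by apply/eqP; rewrite -subv0; have /lker0P/eqP -> := Tinj; exact: capvSr.
  apply/subvP => _ /memv_imgP[x /planeP[a [b ->]] ->].
  by rewrite linearD !linearZ /= T1 Tu rpredD ?rpredZ // PM.
move=> x; apply/idP/idP => [|xC]; last by rewrite -TC memv_img.
by rewrite -TC => /memv_imgP[y yC /Tinj ->].
Qed.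

(** For an arbitrary first choice e of both unit vectors, [commutant] gives
    complex numbers a, b by which right and left multiplication by e act on the
    complement.  The multiplications by other elements of P act through the
    same numbers, and solving for them yields e1 and e2. *)
Lemma exists_trivial_multipliers : exists e1 e2 : A,
  [/\ e1 \in P, e2 \in P, dot e1 e1 = 1, dot e2 e2 = 1 &
   forall x, (forall y, y \in P -> dot x y = 0) ->
     amul A x e1 = x /\ amul A e2 x = x].
Proof.
have [e [eP ee _]] : exists e, [/\ e \in P, dot e e = 1 &
    forall y, y \in [::] -> dot e y = 0].
  by apply: exists_unit_orthogonal_in; rewrite ?dimP.
have [T [f [g [TI TP fgI fgE TM]]]] := kaplansky_plane eP eP ee ee.
have fI x : odot (f x) (f x) = odot x x by have [] := fgI x.
have gI x : odot (g x) (g x) = odot x x by have [] := fgI x.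
have fE x : T (f x) = amul A (T x) e by have [] := fgE x.
have gE x : T (g x) = amul A e (T x) by have [] := fgE x.
have [Tinj TK KT] := isometry_octonion_bij dotE A8 TI.
have [finj fK Kf] := octonion_isometry_bij fI.
have [ginj gK Kg] := octonion_isometry_bij gI.
pose G (d : 'End(octonion R)) := derivation (A := isotope f g) d.
have TMi x y : T^-1%VF (amul A x y) = f (T^-1%VF x) ** g (T^-1%VF y).
  by apply: Tinj; rewrite TM !KT.
have GA (d : 'End(octonion R)) : G d -> derivation (A := A) (T \o (d \o T^-1))%VF.
  exact: (@derivation_conj _ A (isotope f g) T^-1%VF T d KT TK TMi).
have AG (d : 'End(A)) : derivation d -> G (T^-1 \o (d \o T))%VF.
  exact: (@derivation_conj _ (isotope f g) A T T^-1%VF d TK KT TM).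
have Gkill d x : G d -> x \in C -> d x = 0.
  rewrite -TP => Gd /PP/(_ _ (GA d Gd)); rewrite !comp_lfunE TK => dx.
  by apply: Tinj; rewrite dx linear0.
have Cchar x : (forall d, G d -> d x = 0) -> x \in C.
  move=> dx; rewrite -TP; apply/PP => d dD; have := dx _ (AG d dD).
  by rewrite !comp_lfunE => /(congr1 T); rewrite KT linear0.
pose e0 := T^-1%VF e; have e0C : e0 \in C by rewrite -TP KT.
have fe x : f x ** g e0 = f x by apply: Tinj; rewrite TM KT fE.
have eg x : f e0 ** g x = g x by apply: Tinj; rewrite TM KT gE.
have dM d x y : G d -> d (f x ** g y) = f (d x) ** g y + f x ** g (d y).
  by move=> Gd; exact: Gd.
have df d x : G d -> d (f x) = f (d x).
  move=> Gd; rewrite -fe dM // (Gkill d e0) // linear0 -[RHS]fe -[RHS]addr0.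
  by rewrite -(scale0r '1) omulZr !scale0r.
have dg d x : G d -> d (g x) = g (d x).
  by move=> Gd; rewrite -eg dM // (Gkill d e0) // linear0 omul0l add0r eg.
have dO d : G d -> octonion_derivation d.
  move=> Gd x y; rewrite -(Kf x) -(Kg y) dM // -df // -dg //.
have Gskew d x : G d -> odot x (d x) = 0.
  by move=> Gd; apply: (isotope_derivation_skew fI gI).
have Girr (W : {vspace octonion R}) : (forall d, G d -> (d @: W <= W)%VS) ->
    (W <= C)%VS \/ (W + C)%VS = fullv.
  move=> WG; have Wsub : der_submodule (T @: W)%VS.
    move=> d dD; apply/subvP => _ /memv_imgP[_ /memv_imgP[x xW ->] ->].
    have -> : d (T x) = T ((T^-1 \o (d \o T))%VF x) by rewrite !comp_lfunE KT.
    by rewrite memv_img // (subvP (WG _ (AG d dD))) // memv_img.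
  have TC : (T @: C)%VS = P.
    apply/vspaceP => y; rewrite -(KT y) TP; apply/idP/idP; last exact: memv_img.
    by move=> /memv_imgP[x xC /Tinj ->].
  have [WP|WP] := P_irr Wsub; [left|right].
    by apply/subvP => x xW; rewrite -TP (subvP WP) // memv_img.
  have Tk : lker T == 0%VS by apply/lker0P.
  apply/eqP; rewrite -(eq_limg_ker0 _ _ Tk) limgD TC WP eqEsubv subvf andbT.
  by apply/subvP => y _; rewrite -(KT y) memv_img ?memvf.
have Gu d x : G d -> d (u ** x) = u ** d x.
  by move=> Gd; rewrite dO // (Gkill d u) ?plane_u // omul0l add0r.
have scal (h h' : 'End(octonion R)) : cancel h h' -> cancel h' h ->
    (forall x, odot (h x) (h x) = odot x x) ->
    (forall d x, G d -> d (h x) = h (d x)) ->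
    exists2 a, a \in C & odot a a = 1 /\ forall x, perp c x -> h x = a ** x.
  move=> hK Kh hI dh.
  have dh' d x : G d -> d (h' x) = h' (d x).
    by move=> Gd; apply: (can_inj hK); rewrite -dh // !Kh.
  have [a aC aE] : exists2 a, a \in C & forall x, perp c x -> h x = a ** x.
    apply: (commutant Gkill Gu Gskew Girr (f' := h')).
    - move=> x y; rewrite -{1}(Kh y).
      exact: (odot_isometry hI).
    - by move=> x xC; apply: Cchar => d Gd; rewrite dh // (Gkill d x) // linear0.
    - by move=> x xC; apply: Cchar => d Gd; rewrite dh' // (Gkill d x) // linear0.
    - by move=> d x Gd _; rewrite dh.
    - by move=> d x Gd _; rewrite dh'.
  exists a => //; split=> //.
  by have := hI v; rewrite aE ?odotMM ?v_unit ?mulr1 //; apply: perp_v.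
have [a aC [aa fa]] := scal f _ fK Kf fI df.
have [b bC [bb gb]] := scal g _ gK Kg gI dg.
pose y1 := g^-1%VF a; pose x2 := f^-1%VF (oconj b).
have y1C : y1 \in C.
  by apply: Cchar => d Gd; apply: ginj; rewrite -dg // Kg (Gkill d a) // linear0.
have x2C : x2 \in C.
  apply: Cchar => d Gd; apply: finj; rewrite -df // Kf (Gkill d _) ?linear0 //.
  exact: plane_conj.
exists (T y1), (T x2); split; rewrite ?TP //.
- by rewrite TI -gI Kg.
- by rewrite TI -fI Kf odot_conj.
move=> x xP; have [w wE] : exists w, x = T w by exists (T^-1%VF x); rewrite KT.
have TO : forall x y, dot (T x) (T y) = odot x y.
  exact: (isometry_dot (odot_euclidean R) dotE TI).
have wp : perp c w.
  by apply: perpP => y yC; rewrite -TO -wE xP // TP.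
rewrite wE -!TM Kg Kf fa // gb // (perp_mulr (perpM aC wp) aC).
have bbV : oconj b ** b = '1 by have := omulKl b '1; rewrite omul1r bb scale1r.
by rewrite omulKl aa scale1r (perp_mulA _ (plane_conj bC) bC) bbV omul1l.
Qed.

Lemma lambda_characterization (f : 'End(octonion R)) :
  (forall x, odot (f x) (f x) = odot x x) ->
  (forall x, x \in C -> f x \in C) -> (forall x, perp c x -> f x = x) ->
  exists (k : 'Z_2) (t : octonion R),
    t \in circle c /\ forall x, f x = lambda c k t x.
Proof.
move=> fI fC fp; pose t := f '1.
have tC : t \in C by rewrite fC ?plane1.
have tt : odot t t = 1 by rewrite fI odot11.
pose s := oconj t ** f u.
have sC : s \in C := planeM (plane_conj tC) (fC _ (plane_u c)).
have fuE : f u = t ** s.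
  by rewrite /s (perp_mulA _ tC (plane_conj tC)) (plane_inv tC tt) omul1l.
have [k sE] : exists k : 'Z_2, s = (-1) ^+ k *: u.
  have /planeP[s1 [s2 sE]] := sC.
  have s10 : s1 = 0.
    have : odot (f u) (f '1) = odot u '1.
      exact: (odot_isometry fI).
    rewrite -/t fuE -{2}[t]omul1r odot_mull tt mul1r u_1 sE.
    by rewrite odotDl !odotZl odot11 u_1 => h; lra.
  have ss : s2 * s2 = 1.
    have := fI u; rewrite fuE odotMM tt mul1r sE s10 scale0r add0r.
    by rewrite odotZl odotZr u_unit => h; lra.
  have [s21|s21] := eqVneq s2 1.
    by exists 0; rewrite expr0 sE s10 s21 scale0r add0r.
  exists 1; rewrite expr1 sE s10 scale0r add0r; congr (_ *: _).
  apply/eqP; rewrite -addr_eq0; apply/eqP; apply: (mulfI (_ : s2 - 1 != 0)).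
    by rewrite subr_eq0.
  by rewrite mulr0; lra.
exists k, t; split; first exact/circleP.
move=> x; have [y [w [yC wp ->]]] := plane_decomp c x.
rewrite (lambda_split k t yC wp) linearD /= (fp w wp); congr (_ + _).
have /planeP[p [q ->]] := yC; rewrite linearD !linearZ /= fuE sE -/t.
have -> : Kpow k (p *: '1 + q *: u) = p *: '1 + q *: ((-1) ^+ k *: u).
  have [[K ->]|[K ->]] := Kpow_cases R k; rewrite K ?scale1r //.
  by rewrite oconjD !oconjZ oconj1 (im_conj (u_1 c)) scaleN1r.
by rewrite omulDr !omulZr omul1r.
Qed.

Lemma essential_model :
  exists (T : 'Hom(octonion R, A)) (i j : 'Z_2) (a b : octonion R),
  [/\ a \in circle c, b \in circle c, bijective T,
      forall x, (T x \in P) = (x \in C)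
    & forall x y, T (lambda c j a x ** lambda c i b y) = amul A (T x) (T y)].
Proof.
have [e1 [e2 [e1P e2P e11 e22 eE]]] := exists_trivial_multipliers.
have [T [f [g [TI TP fgI fgE TM]]]] := kaplansky_plane e1P e2P e11 e22.
have [Tinj TK KT] := isometry_octonion_bij dotE A8 TI.
have TO : forall x y, dot (T x) (T y) = odot x y.
  exact: (isometry_dot (odot_euclidean R) dotE TI).
have pT x : perp c x -> forall y, y \in P -> dot (T x) y = 0.
  by move=> xp y; rewrite -(KT y) TP TO; apply: perp_plane.
have fI x : odot (f x) (f x) = odot x x by have [] := fgI x.
have gI x : odot (g x) (g x) = odot x x by have [] := fgI x.
have [j [a [aS fE]]] : exists (k : 'Z_2) (t : octonion R),
    t \in circle c /\ forall x, f x = lambda c k t x.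
  apply: lambda_characterization => // x xP; have [Tf _] := fgE x.
    by rewrite -TP Tf PM // TP.
  by apply: Tinj; rewrite Tf; have [] := eE _ (pT x xP).
have [i [b [bS gE]]] : exists (k : 'Z_2) (t : octonion R),
    t \in circle c /\ forall x, g x = lambda c k t x.
  apply: lambda_characterization => // x xP; have [_ Tg] := fgE x.
    by rewrite -TP Tg PM // TP.
  by apply: Tinj; rewrite Tg; have [] := eE _ (pT x xP).
exists T, i, j, a, b; split=> //; first by exists T^-1%VF.
by move=> x y; rewrite -fE -gE TM.
Qed.

End Essential.

(** * The equivalence *)

Section Main.
Variables (R : realType) (c : cayley_triple R).
Local Notation "x ** y" := (omul x y) (at level 40, left associativity).
Local Notation "''1'" := (oone R).
Local Notation u := (cu c).
Local Notation C := (plane_C c).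

(** For the excluded parameter, lambda is the identity or the reflection in
    the hyperplane orthogonal to the unit, hence commutes with all of G2. *)
Lemma excluded_lambda (k : 'Z_2) :
  lambda c k ((-1) ^+ k *: '1) =1 id \/
  lambda c k ((-1) ^+ k *: '1) =1 (fun x => x - (odot x '1 *+ 2) *: '1).
Proof.
have [[K ->]|[K ->]] := Kpow_cases R k; [left | right] => x; rewrite /lambda K.
  by rewrite scale1r omul1l addrC subrK.
have p1 : odot (proj_C c x) '1 = odot x '1.
  by rewrite /proj_C odotDl !odotZl odot11 u_1 mulr0 mulr1 addr0.
by rewrite scaleN1r omulNl omul1l oconjE p1 opprB addrC addrA subrK.
Qed.

Lemma excluded_derivation (i j : 'Z_2) d : octonion_derivation d ->
  derivation (A := isotope (lambda c j ((-1) ^+ j *: '1))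
                           (lambda c i ((-1) ^+ i *: '1))) d.
Proof.
move=> dD.
have comm (k : 'Z_2) x : d (lambda c k ((-1) ^+ k *: '1) x) =
    lambda c k ((-1) ^+ k *: '1) (d x).
  have [K|K] := excluded_lambda k; rewrite !K //.
  rewrite linearB linearZ /= octonion_derivation1 // scaler0 subr0.
  rewrite [odot (d x) _]octonion_derivation_skew // octonion_derivation1 //.
  by rewrite odot0r oppr0 mul0rn scale0r subr0.
by apply: derivation_isotope => // x; apply: comm.
Qed.

Lemma sign_inj (k l : 'Z_2) : (-1) ^+ k = (-1) ^+ l :> R -> k = l.
Proof.
have N1 : (1 : R) <> -1.
  by move=> h; suff /eqP : (2 : R) = 0; [rewrite pnatr_eq0 | lra].
case: k l => [[|[|k]] Hk] [[|[|l]] Hl] //=; rewrite ?expr0 ?expr1 => e;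
  by [apply: val_inj | case: (N1 e) | case: (N1 (esym e))].
Qed.

Lemma D116_isotope (i j : 'Z_2) (A : algebra R) : in_D116ij i j A ->
  exists (p : circle_pairs c i j) (T : 'Hom(F_obj p, A)) (S : 'Hom(A, F_obj p)),
    [/\ is_morphism T, is_morphism S, cancel T S & cancel S T].
Proof.
move=> [[[[A8 Adiv Acomp] _] A116] Asign].
have [dot Ad] := composition_dotP (And3 A8 Adiv Acomp).
have d_skew (d : 'End(A)) x : derivation d -> dot x (d x) = 0.
  by move=> dD; apply: (derivation_skew c Ad A8 dD).
have [P [dimP PP P_irr]] := derivation_plane Ad A8 d_skew A116.
have [T [i' [j' [a [b [aS bS Tbij TP TM]]]]]] :=
  essential_model c Ad A8 dimP PP P_irr.
have Tk : lker T == 0%VS by apply/lker0P/bij_inj.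
have TS : cancel T T^-1%VF := lker0_lfunK Tk.
have ST : cancel T^-1%VF T by apply/(bij_can_sym Tbij).
have [ii jj] : i' = i /\ j' = j.
  have B1 := isotope_double_sign (fun x => lambda_isometry j' x aS)
    (fun x => lambda_isometry i' x bS) (sg_det_lambda j' aS) (sg_det_lambda i' bS).
  have B2 := @double_sign_iso R (isotope (lambda c j' a) (lambda c i' b)) A T T^-1%VF
    i j TS ST (etrans (dim_octonion R) (esym A8)) TM Asign.
  have o0 := ounit_neq0 (odot11 R).
  have [s1 s2] := B1 '1 o0; have [t1 t2] := B2 '1 o0.
  by split; apply: sign_inj; [rewrite -s1 -t1 | rewrite -s2 -t2].
subst i' j'.
have SM x y : T^-1%VF (amul A x y) =
    lambda c j a (T^-1%VF x) ** lambda c i b (T^-1%VF y).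
  by apply: (can_inj TS); rewrite TM !ST.
have abN : (a, b) != ((-1) ^+ j *: '1, (-1) ^+ i *: '1).
  apply/eqP => -[aE bE]; have [d dD /eqP] := u_moving_derivation c; apply.
  have dI : derivation (A := isotope (lambda c j a) (lambda c i b)) d.
    by rewrite aE bE; apply: excluded_derivation.
  have dA := @derivation_conj _ A (isotope (lambda c j a) (lambda c i b))
    T^-1%VF T d ST TS SM dI.
  have TuP : T u \in P by rewrite TP plane_u.
  have := (PP (T u)).1 TuP _ dA; rewrite !comp_lfunE TS => e.
  by apply: (can_inj TS); rewrite e linear0.
have abP : circle_pairs_pred c i j (a, b) by apply/and3P.
exists (exist _ (a, b) abP), T, T^-1%VF; split=> //; split=> //.
  apply/eqP => T0; have := ounit_neq0 (odot11 R).
  by rewrite -(TS '1) [T]T0 zero_lfunE linear0 eqxx.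
have [a0 a00] := Adiv.1; apply: contraNneq a00 => S0.
by rewrite -(ST a0) S0 zero_lfunE linear0.
Qed.

Lemma SU3_Z2_inj (g h : SU3_Z2 c) :
  (su3val g.1 * hat c g.2 = su3val h.1 * hat c h.2)%g -> g = h.
Proof.
case: g h => [rho e] [rho' e'] /= E.
have ee : e = e'.
  have := congr1 (fun F : G2 R => odot (F u) u) E.
  rewrite (hat_su3_u (c := c) (rho, e)) (hat_su3_u (c := c) (rho', e')) /=.
  by rewrite !odotZl u_unit !mulr1 => /sign_inj.
by rewrite -ee in E *; congr (_, _); apply: val_inj; apply: (mulIg (hat c e)).
Qed.

End Main.

Theorem proposition3p5 (R : realType) (c : cayley_triple R) (i j : 'Z_2) :
  exists (F_objP : forall p : circle_pairs c i j, in_D116ij i j (F_obj p))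
         (F_homP : forall (p q : circle_pairs c i j) (g : SU3_Z2 c),
                     circle_action c i j g p = q -> is_morphism (F_hom p q g)),
    is_equivalence (F_functor F_objP F_homP).
Proof.
exists (@F_obj_D116 R c i j), (@F_hom_morphism R c i j).
apply: functor_equivalence => [p q [g gP] [h hP] gh|p q [phi phiM]|[[A A8] AD]].
- apply: eq_exist; apply: SU3_Z2_inj; apply: val_inj.
  exact: (congr1 sval gh).
- case: p q phi phiM => [[a b] abP] [[a' b'] abP'] phi phiM.
  have [rho [e [phiE abE]]] := isotope_morphism_full abP abP' phiM.
  have gP : circle_action c i j (rho, e) (exist _ (a, b) abP) =
      exist _ (a', b') abP'.
    by apply: eq_exist; rewrite abE.
  by exists (exist _ (rho, e) gP); apply: eq_exist; rewrite phiE.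
- have [p [T [S [TM SM TS ST]]]] := D116_isotope c AD.
  exists p, (exist _ T TM), (exist _ S SM).
  by split; apply: eq_exist; apply/lfunP => x; rewrite comp_lfunE id_lfunE.
Qed.
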